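(* Let $\gamma:K^*\to K$ be a non-degenerate simplicial dynamical system on an everywhere $d$-dimensional polyhedron $X$ ($d\ge1$), with associated p.l. map $g$. With $v_0$ a positive distribution on ${}^dK$, let $\lambda_0=\sum_{s\in{}^dK}v_0(s)\lambda_s$ (a locally Lebesgue background measure on $X$). For each terminal $G$ basic set $B\subset{}^dK$, the measure $\lambda_B=\sum_{s\in B}v_B(s)\lambda_s$ is an ergodic $g$-invariant measure whose support is $\bigcup_{s\in B}s=\bigcup_{s^*\in B^*}s^*$, where $B^*$ is the associated $G^*$ basic set. Moreover, with background measure $\lambda_0$ and ergodic measures $\{\lambda_B\}$ indexed by the terminal $G$ basic sets, the system $(X,g)$ is tractable.
   Context: $\gamma:K^*\to K$ is a simplicial map with $K^*$ a proper subdivision of $K$ (every simplex of $K$ is a union of simplices of $K^*$ and no simplex of $K^*$ meets two disjoint simplices of $K$), non-degenerate ($\dim\gamma(s^* )=\dim s^*$); $g(x)=\sum_vb_v(x)\gamma(v)$ its p.l. map; $X=X(K)$ is a union of $d$-simplices. ${}^dK,{}^dK^*$ are the sets of $d$-simplices, $J:{}^dK^*\to{}^dK$ maps $s^*$ to the $d$-simplex of $K$ containing it, and $\gamma$ maps ${}^dK^*\to{}^dK$. Relations: $(s,t)\in G$ iff $t=\gamma(s^* )$ for some $s^*\subset s$; $(s_1^*,s_2^* )\in G^*$ iff $s_2^*\subset\gamma(s_1^* )$. $G$ basic sets are classes of $\{s:(s,s)\in\mathcal{O}G\}$ under mutual reachability, $\mathcal{O}G=\bigcup_{n\ge1}G^n$;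 terminal means $\mathcal{O}G(B)\subset B$; the associated $G^*$ basic set is $B^*=\gamma^{-1}(B)\cap J^{-1}(B)$. $\lambda_s$ is normalized Lebesgue measure on the $d$-simplex $s$; $\nu(s^* )=\lambda_{J(s^* )}(s^* )$; $\Gamma$ is the stochastic matrix on ${}^dK$ with $\Gamma_{s_2s_1}=\sum\{\nu(s^* ):J(s^* )=s_1,\gamma(s^* )=s_2\}$; for terminal $B$, $v_B$ is the unique distribution with $\Gamma v_B=v_B$ and support exactly $B$. Tractability of $(X,g)$ with respect to a full background measure $\lambda_0$: TRAC 1: $g$ has finitely many basic sets (chain components); TRAC 2: there are finitely many ergodic invariant probability measures $\mu_1,\dots,\mu_k$ such that every point outside a $\lambda_0$-null set is generic for some $\mu_i$ (generic: $\frac1n\sum_{i<n}u(g^ix)\to\int u\,d\mu_i$ for all continuous $u$); TRAC 3: each support $|\mu_i|$ is contained in a visible basic set (one with nonempty basin $\operatorname{int}\{x:\omega g(x)\subset B\}$); TRAC 4: for $i\ne j$, $\lambda_0(|\mu_i|\cap|\mu_j|)=0$. *)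

(* Defs.v *)
From HB Require Import structures.
From mathcomp Require Import all_boot all_order all_algebra.
From mathcomp Require Import all_classical all_reals all_analysis.
From Stdlib Require Import Relations.Relation_Operators.

Set Implicit Arguments.
Unset Strict Implicit.
Unset Printing Implicit Defensive.

Import Order.TTheory GRing.Theory Num.Theory.
Import numFieldNormedType.Exports.

Local Open Scope classical_set_scope.
Local Open Scope ring_scope.

Section Geometry.
Context {R : realType} {N : nat}.
Local Notation E := 'rV[R]_N.

Definition borel (A : set E) : Prop := <<s open >> A.

Definition shull {V : finType} (p : V -> E) (s : {set V}) : set E :=
  [set x | exists b : V -> R,
     [/\ (forall v, 0 <= b v), (forall v, v \notin s -> b v = 0),
         \sum_v b v = 1 & x = \sum_v b v *: p v]].

Definition aff_indep {V : finType} (p : V -> E) (s : {set V}) : Prop :=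
  forall c : V -> R, (forall v, v \notin s -> c v = 0) ->
    \sum_v c v = 0 -> \sum_v c v *: p v = 0 -> forall v, c v = 0.

Definition gcomplex {V : finType} (p : V -> E) (S : {set {set V}}) : Prop :=
  [/\ forall s, s \in S -> (0 < #|s|)%N,
      forall s t : {set V}, s \in S -> t \subset s -> (0 < #|t|)%N -> t \in S,
      forall v, [set v]%SET \in S,
      forall s, s \in S -> aff_indep p s &
      forall s t, s \in S -> t \in S -> shull p s `&` shull p t = shull p (s :&: t)].

Definition polyh {V : finType} (p : V -> E) (S : {set {set V}}) : set E :=
  [set x | exists2 s, s \in S & shull p s x].

Definition everywhere_dim {V : finType} (S : {set {set V}}) (d : nat) : Prop :=
  forall s, s \in S -> (#|s| <= d.+1)%N /\
    exists2 t, t \in S & (s \subset t) && (#|t| == d.+1).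

Definition proper_subdivision {V V' : finType} (p : V -> E) (S : {set {set V}})
    (p' : V' -> E) (S' : {set {set V'}}) : Prop :=
  [/\ forall s', s' \in S' -> exists2 s, s \in S & shull p' s' `<=` shull p s,
      forall s, s \in S ->
        shull p s = [set x | exists s', [/\ s' \in S', shull p' s' `<=` shull p s
                                          & shull p' s' x]] &
      forall s' s1 s2, s' \in S' -> s1 \in S -> s2 \in S ->
        shull p s1 `&` shull p s2 = set0 ->
        ~ (shull p' s' `&` shull p s1 !=set0 /\ shull p' s' `&` shull p s2 !=set0)].

Definition simplicial_nondeg {V V' : finType} (S : {set {set V}})
    (S' : {set {set V'}}) (gamma : V' -> V) : Prop :=
  forall s', s' \in S' -> gamma @: s' \in S /\ #|gamma @: s'| = #|s'|.

Definition bary {V' : finType} (p' : V' -> E) (S' : {set {set V'}})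
    (x : E) (b : V' -> R) : Prop :=
  exists2 s', s' \in S' &
    [/\ (forall v, 0 <= b v), (forall v, v \notin s' -> b v = 0),
        \sum_v b v = 1 & x = \sum_v b v *: p' v].

Definition pl_map_of {V V' : finType} (p : V -> E) (p' : V' -> E)
    (S' : {set {set V'}}) (gamma : V' -> V) (X : set E) (g : E -> E) : Prop :=
  forall x b, X x -> bary p' S' x b -> g x = \sum_v b v *: p (gamma v).

(* itint n f = iterated Lebesgue integral of f over the cube [0,1]^n         *)
(* (coordinates 0..n-1 of a point t : nat -> R).                             *)
Fixpoint itint (n : nat) (f : (nat -> R) -> \bar R) : \bar R :=
  match n with
  | 0 => f (fun _ => 0)
  | n'.+1 => (\int[@lebesgue_measure R]_(t in `[0%R, 1%R]%classic)
               itint n' (fun x => f (fun i => if i == n' then t else x i)))%E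
  end.

(* affine parametrisation of the d-simplex s by the standard simplex
   {t in [0,1]^d | sum t <= 1}, using an enumeration of its vertices *)
Definition sparam {V : finType} (p : V -> E) (d : nat) (s : {set V})
    (t : nat -> R) : E :=
  let ps := map p (enum s) in
  (1 - \sum_(i < d) t i) *: nth 0 ps 0 + \sum_(i < d) t i *: nth 0 ps i.+1.

(* lam s A = normalized Lebesgue measure of A on the d-simplex s
          = d! * Leb_d { t in standard simplex | sparam t \in A } *)
Definition lam {V : finType} (p : V -> E) (d : nat) (s : {set V})
    (A : set E) : \bar R :=
  ((d`!)%:R%:E * itint d (fun t =>
     (\1_[set t : nat -> R | \sum_(i < d) t i <= 1 /\ A (sparam p d s t)] t)%:E))%E.

Definition lamint {V : finType} (p : V -> E) (d : nat) (s : {set V})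
    (u : E -> R) : \bar R :=
  ((d`!)%:R%:E * itint d (fun t =>
     (\1_[set t : nat -> R | \sum_(i < d) t i <= 1] t * u (sparam p d s t))%:E))%E.

(* A (finite Borel) measure on E, given by its values on sets and its        *)
(* integrals of real functions.                                             *)
Record meas := Meas { mval : set E -> \bar R ; mint : (E -> R) -> \bar R }.

Definition lam_comb {V : finType} (p : V -> E) (d : nat) (D : {set {set V}})
    (w : {set V} -> R) : meas :=
  Meas (fun A => (\sum_(s in D) (w s)%:E * lam p d s A)%E)
       (fun u => (\sum_(s in D) (w s)%:E * lamint p d s u)%E).

Definition msupp (mu : meas) : set E :=
  [set x | forall e : R, 0 < e -> (0 < mval mu (ball x e))%E].

Definition invariant_meas (X : set E) (g : E -> E) (mu : meas) : Prop :=
  forall A, borel A -> mval mu (X `&` g @^-1` A) = mval mu A.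

Definition ergodic_inv_prob (X : set E) (g : E -> E) (mu : meas) : Prop :=
  [/\ mval mu setT = 1%E, invariant_meas X g mu &
      forall A, borel A -> X `&` g @^-1` A = X `&` A ->
        mval mu A = 0%E \/ mval mu A = 1%E].

Definition generic (X : set E) (g : E -> E) (mu : meas) (x : E) : Prop :=
  forall u : E -> R, {within X, continuous u} ->
    (fun n : nat => ((n%:R)^-1 * \sum_(i < n) u (iter i g x))%:E) @ \oo
      --> mint mu u.

Definition eps_chain (X : set E) (g : E -> E) (e : R) (x y : E) : Prop :=
  exists n : nat, exists z : nat -> E,
    [/\ (0 < n)%N, z 0%N = x, z n = y, (forall i, (i <= n)%N -> X (z i)) &
        forall i, (i < n)%N -> `|g (z i) - z i.+1| < e].

Definition chain_rel (X : set E) (g : E -> E) (x y : E) : Prop :=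
  forall e : R, 0 < e -> eps_chain X g e x y.

Definition basic_set (X : set E) (g : E -> E) (B : set E) : Prop :=
  exists x, [/\ X x, chain_rel X g x x &
    B = [set y | X y /\ chain_rel X g x y /\ chain_rel X g y x]].

Definition omega_lim (g : E -> E) (x : E) : set E :=
  [set y | forall e : R, 0 < e -> forall m : nat,
     exists2 n, (m <= n)%N & `|iter n g x - y| < e].

Definition rel_interior (X A : set E) : set E :=
  [set x | X x /\ exists2 e : R, 0 < e &
     forall y, X y -> `|x - y| < e -> A y].

Definition basin (X : set E) (g : E -> E) (B : set E) : set E :=
  rel_interior X [set x | X x /\ omega_lim g x `<=` B].

Definition visible (X : set E) (g : E -> E) (B : set E) : Prop :=
  basic_set X g B /\ basin X g B !=set0.

Definition tractable (X : set E) (g : E -> E) (lam0 : meas)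
    {I : finType} (P : pred I) (mu : I -> meas) : Prop :=
  [/\ (* TRAC 1 *) finite_set [set B | basic_set X g B],
      (* TRAC 2 *) (forall i, P i -> ergodic_inv_prob X g (mu i)) /\
        (exists Z, [/\ borel Z, mval lam0 Z = 0%E &
           forall x, X x -> ~ Z x -> exists2 i, P i & generic X g (mu i) x]),
      (* TRAC 3 *) (forall i, P i ->
         exists2 B, visible X g B & msupp (mu i) `<=` B) &
      (* TRAC 4 *) forall i j, P i -> P j -> i != j ->
         mval lam0 (msupp (mu i) `&` msupp (mu j)) = 0%E].

Definition dsimp {V : finType} (S : {set {set V}}) (d : nat) : {set {set V}} :=
  [set s in S | #|s| == d.+1]%SET.

(* Gamma_{s2 s1} = sum { nu(s') : J(s') = s1, gamma(s') = s2 },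
   nu(s') = lam_{J(s')}(s'), J(s') = the d-simplex of K containing s'. *)
Definition Gamma {V V' : finType} (p : V -> E) (p' : V' -> E)
    (S' : {set {set V'}}) (gamma : V' -> V) (d : nat) (s2 s1 : {set V}) : R :=
  \sum_(s' in dsimp S' d | (gamma @: s' == s2) && `[< shull p' s' `<=` shull p s1 >])
     fine (lam p d s1 (shull p' s')).

Definition Grel {V V' : finType} (p : V -> E) (S : {set {set V}}) (p' : V' -> E)
    (S' : {set {set V'}}) (gamma : V' -> V) (d : nat) (s t : {set V}) : Prop :=
  [/\ s \in dsimp S d, t \in dsimp S d &
      exists2 s', s' \in dsimp S' d & shull p' s' `<=` shull p s /\ gamma @: s' = t].

Definition OG {V V' : finType} (p : V -> E) (S : {set {set V}}) (p' : V' -> E)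
    (S' : {set {set V'}}) (gamma : V' -> V) (d : nat) :=
  clos_trans {set V} (Grel p S p' S' gamma d).

Definition G_basic {V V' : finType} (p : V -> E) (S : {set {set V}}) (p' : V' -> E)
    (S' : {set {set V'}}) (gamma : V' -> V) (d : nat) (B : {set {set V}}) : Prop :=
  exists s, OG p S p' S' gamma d s s /\
    B = [set t in dsimp S d | `[< OG p S p' S' gamma d s t /\ OG p S p' S' gamma d t s >]]%SET.

Definition G_terminal {V V' : finType} (p : V -> E) (S : {set {set V}}) (p' : V' -> E)
    (S' : {set {set V'}}) (gamma : V' -> V) (d : nat) (B : {set {set V}}) : Prop :=
  G_basic p S p' S' gamma d B /\
  forall s t, s \in B -> OG p S p' S' gamma d s t -> t \in B.

Definition Bstar {V V' : finType} (p : V -> E) (p' : V' -> E) (S' : {set {set V'}})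
    (gamma : V' -> V) (d : nat) (B : {set {set V}}) (s' : {set V'}) : Prop :=
  [/\ s' \in dsimp S' d, gamma @: s' \in B &
      exists2 s, s \in B & shull p' s' `<=` shull p s].

Definition stat_supp {V V' : finType} (p : V -> E) (S : {set {set V}}) (p' : V' -> E)
    (S' : {set {set V'}}) (gamma : V' -> V) (d : nat) (B : {set {set V}})
    (v : {ffun {set V} -> R}) : Prop :=
  [/\ forall s, s \in dsimp S d -> 0 <= v s,
      \sum_(s in dsimp S d) v s = 1,
      forall s2, s2 \in dsimp S d ->
        \sum_(s1 in dsimp S d) Gamma p p' S' gamma d s2 s1 * v s1 = v s2 &
      [set s in dsimp S d | v s != 0]%SET = B].

(* v_B : the (unique) such distribution *)
Definition vB {V V' : finType} (p : V -> E) (S : {set {set V}}) (p' : V' -> E)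
    (S' : {set {set V'}}) (gamma : V' -> V) (d : nat) (B : {set {set V}}) :
    {ffun {set V} -> R} :=
  xget [ffun=> 0] [set v | stat_supp p S p' S' gamma d B v].

Definition lamB {V V' : finType} (p : V -> E) (S : {set {set V}}) (p' : V' -> E)
    (S' : {set {set V'}}) (gamma : V' -> V) (d : nat) (B : {set {set V}}) : meas :=
  lam_comb p d B (vB p S p' S' gamma d B).

End Geometry.

(* Main.v *)
(* The inverse branches of [g] are affine maps from a simplex gamma(s* ) onto s*, so by
   uniqueness of Haar measure they carry normalized Lebesgue measure to a multiple of
   Lebesgue measure.  Hence lambda_s(A) is the sum over s* in s of nu(s* ) times the
   lambda_{gamma(s* )}-measure of the preimage of A under the branch.  Everything follows
   from this self-similarity.  Summing against v_B gives invariance.  If A is invariant,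
   s |-> lambda_s(A) is harmonic for Gamma, hence equal to a constant c on a terminal
   basic set by the maximum principle; because the branches contract (properness and
   Dobrushin's coefficient), A then has density c in every open set, so
   lambda_B(A) = c = c^2.

   Birkhoff's theorem for an ergodic measure is obtained from Garsia's maximal
   inequality.  The set of points whose whole orbit avoids the good sets of all terminal
   basic sets is subharmonic and null on the terminal ones, so it is null by the maximum
   principle.  Contraction also shadows: from a point whose itinerary visits s*
   infinitely often, every point of gamma(s* ) is reached by epsilon-chains.  So a symbol
   visited infinitely often determines the basic set of a chain recurrent point, and the
   union of a terminal class lies in a single basic set. *)
Require Import Defs.
From HB Require Import structures.
From mathcomp Require Import all_boot all_order all_algebra.
From mathcomp Require Import all_classical all_reals all_analysis.
From mathcomp Require Import measurable_realfun ring lra.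
From Stdlib Require Import Relations.Relation_Operators.

Set Implicit Arguments.
Unset Strict Implicit.
Unset Printing Implicit Defensive.

Import Order.TTheory GRing.Theory Num.Theory.
Import numFieldNormedType.Exports.
Local Open Scope classical_set_scope.
Local Open Scope ring_scope.

(** * Lebesgue measure on tuples and uniqueness of Haar measure *)

(** The set function [lam s] is given by iterated integrals, so it first has to be identified, on
    Borel sets, with the image of Lebesgue measure under an affine chart of the simplex. Two
    d-simplices of a complex meet in a face of lower dimension; nullity of hyperplanes is therefore
    what makes self-similarity an exact sum, and it also shows that the d-simplices of the
    subdivision already cover the polyhedron. Contraction is measured in the l1 distance of
    barycentric coordinates: whatever the shape of the simplices, an inverse branch acts there as a
    stochastic matrix, and properness says that its rows have pairwise overlapping supports. A point
    on a common face has several itineraries, so symbols are chosen compatibly, each inside the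
    image of the preceding one. Genericity quantifies over uncountably many functions but allows
    only one exceptional null set; continuous functions are therefore approximated by step functions
    built from countably many cells. *)

Section LebesgueStep.
Context {R : realType} {n : nat} (m : {sigma_finite_measure set (n.-tuple R) -> \bar R}).

Definition tcons (x : R * n.-tuple R) : n.+1.-tuple R := [tuple of x.1 :: x.2].

Lemma measurable_tcons : measurable_fun setT tcons.
Proof. exact: measurable_cons. Qed.

Definition lebS := pushforward (@lebesgue_measure R \x m)%E tcons.

Let mS : {measure set (n.+1.-tuple R) -> \bar R} :=
  @measure_function_pushforward__canonical__measure_function_Measure _ _ _ _ _
   (@lebesgue_measure R \x m)%E _ measurable_tcons.

Let lebS0 : lebS set0 = 0%E.
Proof. exact: (measure0 mS). Qed.
Let lebS_ge0 A : (0 <= lebS A)%E.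
Proof. exact: (measure_ge0 mS). Qed.
Let lebS_sigma : semi_sigma_additive lebS.
Proof. exact: (@measure_semi_sigma_additive _ _ _ mS). Qed.

HB.instance Definition _ := isMeasure.Build _ _ _ lebS lebS0 lebS_ge0 lebS_sigma.

Let lebS_fin : sigma_finite setT lebS.
Proof.
have /sigma_finiteP[F [FT ndF mF]] := sigma_finiteT (@lebesgue_measure R).
have /sigma_finiteP[G [GT ndG mG]] := sigma_finiteT m.
pose u (x : n.+1.-tuple R) : R * n.-tuple R := (thead x, [tuple of behead x]).
have mu : measurable_fun setT u.
  apply/measurable_fun_pairP; split; first exact: measurable_tnth.
  exact: measurable_behead.
exists (fun k => u @^-1` (F k `*` G k)).
  apply/seteqP; split => // x _.
  have [i _ Fi] : (\bigcup_i F i) (u x).1 by rewrite -FT.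
  have [j _ Gj] : (\bigcup_i G i) (u x).2 by rewrite -GT.
  exists (maxn i j) => //; split.
    by move: Fi; exact/subsetPset/ndF/leq_maxl.
  by move: Gj; exact/subsetPset/ndG/leq_maxr.
move=> k; have [mFk Fk] := mF k; have [mGk Gk] := mG k.
have mFG : measurable (F k `*` G k) by exact: measurableX.
split; first by rewrite -[X in measurable X]setTI; exact: mu.
rewrite /lebS /pushforward (_ : _ @^-1` _ = F k `*` G k); last first.
  apply/seteqP; split => -[t x]; rewrite /preimage /u /tcons/= theadE;
    by rewrite (_ : [tuple of _] = x)//; apply/val_inj.
by rewrite product_measure1E// lte_mul_pinfty// ge0_fin_numE.
Qed.

HB.instance Definition _ := Measure_isSigmaFinite.Build _ _ _ lebS lebS_fin.

End LebesgueStep.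

(** Each step adds a coordinate at the head of the tuple, as [itint] adds an outermost integral; in
    dimension 0 the only point has mass 1. *)
Fixpoint leb (R : realType) n : {sigma_finite_measure set (n.-tuple R) -> \bar R} :=
  match n with
  | 0 => \d_([tuple] : 0.-tuple R)
  | n'.+1 => lebS (leb R n')
  end.

Lemma lebE (R : realType) n (A : set (n.+1.-tuple R)) :
  leb R n.+1 A = (@lebesgue_measure R \x leb R n)%E (@tcons R n @^-1` A).
Proof. by []. Qed.

(** The image of Lebesgue measure under a translation gives half-open intervals their length, and
    these values determine it. *)
Lemma lebesgue_measureD (R : realType) (a : R) (A : set (measurableTypeR R)) : measurable A ->
  @lebesgue_measure R ((fun x : measurableTypeR R => x + a : measurableTypeR R) @^-1` A) = lebesgue_measure A.
Proof.
have ma : measurable_fun setT (fun x : measurableTypeR R => x + a : measurableTypeR R).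
  exact: measurable_funD.
move=> mA; apply/esym.
apply: (@lebesgue_measure_unique R
  (@measure_function_pushforward__canonical__measure_function_Measure _ _ _ _ _
   (@lebesgue_measure R) _ ma)) => // _ [[b c]] _ <-.
rewrite [RHS](_ : _ = lebesgue_measure (`]b - a, c - a]%classic : set R)); last first.
  congr (lebesgue_measure _).
  by apply/seteqP; split => x; rewrite /= !in_itv/= ltrBlDr lerBrDr.
rewrite !lebesgue_measure_itv/= !lte_fin ltrD2r -!EFinB.
by congr (if _ then _%:E else _); ring.
Qed.

Section translate.
Context {R : realType}.

Definition tadd n (x a : n.-tuple R) : n.-tuple R := [tuple tnth x i + tnth a i | i < n].

Lemma measurable_tadd n : measurable_fun setT (fun z : n.-tuple R * n.-tuple R => tadd z.1 z.2).
Proof.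
apply/measurable_fun_tnthP => i.
rewrite (_ : _ \o _ = fun z => tnth z.1 i + tnth z.2 i).
  apply: measurable_funD.
    exact: (measurableT_comp (measurable_tnth i) measurable_fst).
  exact: (measurableT_comp (measurable_tnth i) measurable_snd).
by apply/funext => z; rewrite /= tnth_mktuple.
Qed.

Lemma measurable_taddl n (a : n.-tuple R) : measurable_fun setT (fun x => tadd x a).
Proof. exact: (measurableT_comp (@measurable_tadd n) (measurable_fun_pair _ _)). Qed.

Lemma tadd_cons n (x a : R) (y b : n.-tuple R) :
  tadd (tcons (x, y)) (tcons (a, b)) = tcons (x + a, tadd y b).
Proof.
apply: eq_from_tnth => i; rewrite tnth_mktuple.
by case: (unliftP ord0 i) => [j|] ->; rewrite ?tnthS ?tnth0 //= tnth_mktuple.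
Qed.

Lemma tcons_eta n (a : n.+1.-tuple R) : tcons (thead a, [tuple of behead a]) = a.
Proof. by rewrite [RHS]tuple_eta; apply: val_inj. Qed.

Lemma leb_tadd n (a : n.-tuple R) (A : set (n.-tuple R)) : measurable A ->
  leb R n ((fun x => tadd x a) @^-1` A) = leb R n A.
Proof.
elim: n a A => [|n IH] a A mA.
  rewrite (_ : _ @^-1` _ = A)//; apply/seteqP; split => x;
  by rewrite /preimage/= (tuple0 x) (tuple0 (tadd _ _)).
rewrite !lebE.
have mA' : measurable (@tcons R n @^-1` A).
  by rewrite -[X in measurable X]setTI; exact: (@measurable_tcons R n).
pose G (t : measurableTypeR R) := leb R n (xsection (@tcons R n @^-1` A) t).
have mG : measurable_fun setT G by exact: measurable_fun_xsection.
have ma : measurable_fun setT (fun x : measurableTypeR R => x + thead a : measurableTypeR R).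
  exact: measurable_funD.
transitivity (\int[@lebesgue_measure R]_t (G (t + thead a)%R))%E.
  apply: eq_integral => t _; rewrite /= /G -[RHS](IH [tuple of behead a]); last exact: measurable_xsection.
  congr (leb R n _); apply/seteqP; split => x; rewrite /preimage /xsection/= !inE/=;
  by rewrite -tadd_cons tcons_eta.
rewrite -(@ge0_integral_pushforward _ _ _ _ _ _ ma lebesgue_measure setT G) //.
apply: eq_measure_integral => //= B mB _; exact: lebesgue_measureD.
Qed.
End translate.

Section haar.
Context {R : realType} {n : nat}.
Local Notation T := (n.-tuple R).

Definition topp (x : T) : T := [tuple - tnth x i | i < n].

Lemma measurable_topp : measurable_fun setT topp.
Proof.
apply/measurable_fun_tnthP => i.
rewrite (_ : _ \o _ = fun z => - tnth z i).
  apply: measurableT_comp; first exact: oppr_measurable.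
  exact: measurable_tnth.
by apply/funext => z; rewrite /= tnth_mktuple.
Qed.

Lemma taddC (x y : T) : tadd x y = tadd y x.
Proof. by apply: eq_from_tnth => i; rewrite !tnth_mktuple addrC. Qed.

Lemma taddK (x y : T) : tadd (tadd x y) (topp y) = x.
Proof. by apply: eq_from_tnth => i; rewrite !tnth_mktuple addrK. Qed.

Lemma topp_tadd (x y : T) : topp (tadd x y) = tadd (topp x) (topp y).
Proof. by apply: eq_from_tnth => i; rewrite !tnth_mktuple opprD. Qed.

Lemma toppK (x : T) : topp (topp x) = x.
Proof. by apply: eq_from_tnth => i; rewrite !tnth_mktuple opprK. Qed.

Local Open Scope ereal_scope.

Variable mu : {sigma_finite_measure set T -> \bar R}.
Hypothesis mu_tadd : forall (a : T) (A : set T), measurable A ->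
  mu ((fun x => tadd x a) @^-1` A) = mu A.

Let measurable_pre d (U : measurableType d) (f : U -> T) (A : set T) :
  measurable_fun setT f -> measurable A -> measurable (f @^-1` A).
Proof. by move=> mf mA; rewrite -[X in measurable X]setTI; exact: mf. Qed.

Let indicM (A : set T) (c : \bar R) : measurable A -> 0 <= c ->
  \int[mu]_x (c * (\1_A x)%:E) = c * mu A.
Proof.
move=> mA c0; rewrite ge0_integralZl// ?integral_indic ?setIT//.
  by apply/measurable_EFinP.
Qed.

Let fub (P : set (T * T)) : measurable P ->
  \int[mu]_x leb R n (xsection P x) = \int[leb R n]_y mu (ysection P y).
Proof.
move=> mP; have := indic_fubini_tonelli mu (leb R n) mP.
by rewrite indic_fubini_tonelli_FE// indic_fubini_tonelli_GE.
Qed.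

(* Both sides are computed by Fubini from the set of [(x, y)] with [x \in A] and [x + y \in B]. *)
Lemma haar_swap (A B : set T) : measurable A -> measurable B ->
  mu A * leb R n B = mu B * leb R n (topp @^-1` A).
Proof.
move=> mA mB.
pose P : set (T * T) := (fst @^-1` A) `&` ((fun z => tadd z.1 z.2) @^-1` B).
pose Q : set (T * T) := (fst @^-1` B) `&` ((fun z => tadd z.1 (topp z.2)) @^-1` A).
have mtN : measurable_fun setT (fun z : T * T => tadd z.1 (topp z.2)).
  apply: (measurableT_comp (@measurable_tadd _ n) (measurable_fun_pair _ _)) => //.
  exact: (measurableT_comp measurable_topp).
have mP : measurable P.
  by apply: measurableI; apply: measurable_pre => //; exact: measurable_tadd.
have mQ : measurable Q by apply: measurableI; apply: measurable_pre.
have mNA : measurable (topp @^-1` A).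
  by apply: measurable_pre => //; exact: measurable_topp.
rewrite muleC -indicM// [RHS]muleC -indicM//.
transitivity (\int[mu]_x leb R n (xsection P x)).
  apply: eq_integral => x _; rewrite indicE.
  have [Ax|Ax] := boolP (x \in A).
    rewrite mule1 -[LHS](leb_tadd x)//; congr (leb R n _).
    apply/seteqP; split => y; rewrite /xsection /P /preimage/= !inE/= taddC//.
      by rewrite inE in Ax.
    by case.
  rewrite mule0 (_ : xsection _ _ = set0) ?measure0//.
  apply/seteqP; split => // y; rewrite /xsection /P /preimage/= !inE/= => -[Ax'].
  by rewrite notin_setE in Ax.
rewrite fub//.
transitivity (\int[leb R n]_y mu (ysection Q y)).
  apply: eq_integral => y _; rewrite -[RHS](mu_tadd y); last exact: measurable_ysection.
  congr (mu _); apply/seteqP; split => x; rewrite /ysection /P /Q /preimage/= !inE/= taddK => -[]//.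
rewrite -fub//.
apply: eq_integral => x _; rewrite indicE.
have [Bx|Bx] := boolP (x \in B).
  rewrite mule1 -[RHS](leb_tadd (topp x))//; congr (leb R n _).
  apply/seteqP; split => y; rewrite /xsection /P /preimage/= !inE/= topp_tadd toppK (taddC (topp y))//.
    by case.
  by rewrite inE in Bx.
rewrite mule0 (_ : xsection _ _ = set0) ?measure0//.
apply/seteqP; split => // y; rewrite /xsection /P /preimage/= !inE/= => -[Ax'].
by rewrite notin_setE in Bx.
Qed.

End haar.

(** Swapping with [leb] itself in the role of [mu] shows that [leb] is invariant under reflection;
    swapping with [mu] then gives proportionality. The set [B], of positive finite volume, fixes the
    factor. *)
Lemma haar_uniq {R : realType} {n : nat} (mu : {sigma_finite_measure set (n.-tuple R) -> \bar R})
   (B : set (n.-tuple R)) (c : R) :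
   (forall (a : n.-tuple R) A, measurable A -> mu ((fun x => tadd x a) @^-1` A) = mu A) ->
  measurable B -> leb R n B = c%:E -> 0 < c ->
  forall A, measurable A -> mu A = ((c^-1)%:E * mu B * leb R n A)%E.
Proof.
move=> inv mB Bc c0 A mA.
have NA : leb R n (topp @^-1` A) = leb R n A.
  have := haar_swap (@leb_tadd R n) mA mB.
  rewrite Bc muleC => /(congr1 (fun x => (c^-1)%:E * x)%E).
  by rewrite !muleA -EFinM mulVf ?gt_eqF// !mul1e.
have := haar_swap inv mA mB.
rewrite Bc muleC => /(congr1 (fun x => (c^-1)%:E * x)%E).
by rewrite !muleA -EFinM mulVf ?gt_eqF// !mul1e NA.
Qed.

(** * The iterated integral as an integral over the unit cube *)

Section itint.
Context {R : realType}.

Definition box (M : R) n : set (n.-tuple R) := [set x | forall i, 0 <= tnth x i <= M].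
Arguments box M n _ : clear implicits.
Local Notation cube := (box 1).

(* The head of the tuple is the last coordinate of [t], which [itint] integrates outermost. *)
Definition tot n (t : nat -> R) : n.-tuple R := [tuple t (rev_ord i) | i < n].

Lemma boxS M n : @tcons R n @^-1` box M n.+1 = `[0, M]%classic `*` box M n.
Proof.
apply/seteqP; split => -[t x]; rewrite /box /preimage /=.
  move=> H; split; first by have := H ord0; rewrite tnth0 in_itv.
  by move=> i; have := H (lift ord0 i); rewrite tnthS.
rewrite in_itv/= => -[t01 xc] i.
by case: (unliftP ord0 i) => [j|] ->; rewrite ?tnthS ?tnth0.
Qed.

Lemma measurable_box M n : measurable (box M n).
Proof.
rewrite (_ : box M n = \bigcap_(i in [set: 'I_n]) ((fun x => tnth x i) @^-1` `[0, M]%classic)).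
  apply: fin_bigcap_measurable; first exact: finite_finset.
  by move=> i _; rewrite -[X in measurable X]setTI; exact: measurable_tnth.
apply/seteqP; split => x /= H i; first by move=> _; rewrite /preimage/= in_itv/= H.
by have := H i I; rewrite /preimage/= in_itv.
Qed.

Lemma leb_box M n : 0 < M -> leb R n (box M n) = (M ^+ n)%:E.
Proof.
move=> M0; elim: n => [|n IH].
  rewrite /= diracE mem_set//; case; by [].
rewrite lebE boxS product_measure1E//; last exact: measurable_box.
rewrite IH.
have H : lebesgue_measure (`[0, M]%classic : set R) = M%:E.
  by rewrite lebesgue_measure_itv/= lte_fin M0/= oppr0 adde0.
by rewrite exprS EFinM; congr (_ * _)%E; exact: H.
Qed.

Lemma leb_cube n : leb R n (cube n) = 1%E.
Proof. by rewrite leb_box// expr1n. Qed.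

Lemma tot_cons n t (x : nat -> R) :
  tot n.+1 (fun i => if i == n then t else x i) = tcons (t, tot n x).
Proof.
apply: eq_from_tnth => i; rewrite tnth_mktuple /=.
case: (unliftP ord0 i) => [j|] ->; last by rewrite tnth0 subSS subn0 eqxx.
rewrite tnthS /= tnth_mktuple /= /bump leq0n add1n subSS ifF//.
by apply/negbTE; rewrite neq_ltn ltn_subrL /= (leq_trans _ (ltn_ord j)).
Qed.

(** The bound makes [F] integrable on the cube, so that Fubini applies to integrands of any sign, as
    [lamint] requires. *)
Lemma itintE n (F : n.-tuple R -> R) M : measurable_fun setT F ->
  (forall x, `|F x| <= M) ->
  itint n (fun t => (F (tot n t))%:E) = (\int[leb R n]_(x in cube n) (F x)%:E)%E.
Proof.
elim: n F => [|n IH] F mF FM.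
  rewrite /= (_ : box 1 0 = setT).
    rewrite [RHS]integral_dirac//; last exact/measurable_EFinP.
    rewrite [X in (_ = X * _)%E]diracT mul1e; congr (F _)%:E.
    by rewrite [LHS]tuple0 [RHS]tuple0.
  by apply/seteqP; split => // x _ [].
have mc : measurable (`[0, 1]%classic `*` cube n : set (measurableTypeR R * _)%type).
  by apply: measurableX => //; exact: measurable_box.
have mFc : measurable_fun setT (F \o @tcons R n).
  exact: (measurableT_comp mF (@measurable_tcons R n)).
have iF : (@lebesgue_measure R \x leb R n)%E.-integrable (`[0, 1]%classic `*` cube n)
    (EFin \o (F \o @tcons R n)).
  apply: measurable_bounded_integrable => //.
  - have H := leb_cube n.+1; rewrite lebE boxS in H.
    by apply: (@le_lt_trans _ _ 1%E); [rewrite -H|rewrite ltry].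
  - exact: measurable_funTS.
  - exists M; split; first by rewrite num_real.
    by move=> y My x _ /=; rewrite (le_trans (FM _))// ltW.
pose D : set (measurableTypeR R * n.-tuple R) := `[0, 1]%classic `*` cube n.
transitivity (\int[lebesgue_measure \x leb R n]_(x in D) (F (tcons x))%:E)%E; last first.
  rewrite /D -boxS.
  have mt : measurable_fun [set: (measurableTypeR R * n.-tuple R)%type] (@tcons R n).
    exact: measurable_tcons.
  apply/esym; apply: (@integral_pushforward _ _ _ _ _ _ mt
    (@lebesgue_measure R \x leb R n)%E (cube n.+1) (EFin \o F)).
  - exact/measurable_EFinP.
  - by rewrite boxS.
  - exact: measurable_box.
rewrite [RHS]integral_mkcond -integral12_prod_meas1; last first.
  exact: ((integrable_mkcond _ mc).1 iF).
rewrite [itint _ _]/= [LHS]integral_mkcond; apply: eq_integral => t _.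
rewrite /fubini_F patchE; case: ifPn => t01.
  rewrite (_ : (fun x => _) = (fun x => (F (tcons (t, tot n x)))%:E)); last first.
    by apply/funext => x; rewrite tot_cons.
  rewrite (IH (fun x => F (tcons (t, x)))) //; last first.
    exact: (measurableT_comp mFc (measurable_pair1 _)).
  rewrite [LHS]integral_mkcond; apply: eq_integral => x _.
  rewrite !patchE; congr (if _ then _ else _).
  rewrite in_setX/= t01//.
rewrite integral0_eq// => x _; rewrite patchE in_setX/= (negbTE t01)//.
Qed.
End itint.
Arguments box {R} M n _.
Notation cube := (box 1).
Arguments tot {R} n t.

(** * Volume of the standard simplex *)

Section simplex_volume.
Context {R : realType}.

Definition tsum n (x : n.-tuple R) : R := \sum_(i < n) tnth x i.

Lemma is_derive_powB (c k : R) n (t : R) :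
  is_derive t 1 (fun t => - ((c - t) ^+ n.+1 * k)) (n.+1%:R * (c - t) ^+ n * k).
Proof.
have H : is_derive t (1 : R) (fun t : R => c - t) (-1).
  by apply: is_derive_eq; rewrite add0r mul1r.
rewrite (_ : (fun t => _) = (- k) *: ((fun t : R => c - t) ^+ n.+1)); last first.
  apply/funext => x; rewrite -mulrN mulrC; congr (- k * _).
  by elim: n => // n IH; rewrite exprS IH [in RHS]exprS.
apply: is_derive_eq.
by rewrite /GRing.scale/= mulrN1 mulrNN mulrC.
Qed.

Lemma integral_powB (c k : R) n : 0 <= c ->
  (\int[lebesgue_measure]_(t in `[0%R, c]) (n.+1%:R * (c - t) ^+ n * k)%:E = (c ^+ n.+1 * k)%:E)%E.
Proof.
move=> c0; have [->|cn0] := eqVneq c 0.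
  by rewrite set_itv1 integral_set1 expr0n mul0r.
have {}c0 : 0 < c by rewrite lt_neqAle eq_sym cn0.
have cF : continuous (fun t : R => - ((c - t) ^+ n.+1 * k)).
  move=> t; apply: differentiable_continuous; apply/derivable1_diffP.
  by have [] := is_derive_powB c k n t.
have cf : continuous (fun t : R => n.+1%:R * (c - t) ^+ n * k).
  move=> t; apply: (@continuousM _ _ (fun t => n.+1%:R * (c - t) ^+ n) (fun=> k)); last exact: cvg_cst.
  apply: (@continuousM _ _ (fun t => n.+1%:R) (fun t => (c - t) ^+ n)); first exact: cvg_cst.
  apply: (continuous_comp (f := fun t => c - t) (g := fun x => x ^+ n)); last exact: exprn_continuous.
  by apply: continuousB; [exact: cvg_cst|exact: cvg_id].
apply: etrans (continuous_FTC2 c0 (continuous_subspaceT (A := `[0, c]%classic) cf) (F := fun t : R => - ((c - t) ^+ n.+1 * k)) _ _) _.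
- split.
  + by move=> x _; have [] := is_derive_powB c k n x.
  + exact/cvg_at_right_filter/cF.
  + exact/cvg_at_left_filter/cF.
- move=> x _; rewrite derive1E.
  by have [_ ->] := is_derive_powB c k n x.
by rewrite subrr expr0n mul0r oppr0 sub0e -EFinN opprK addr0.
Qed.

Definition ssimp n : set (n.-tuple R) := cube n `&` [set x | tsum x <= 1].
Arguments ssimp n : clear implicits.

Lemma measurable_tsum n : measurable_fun setT (@tsum n).
Proof.
apply: (@measurable_sum _ _ _ _ _ _ (fun i (x : n.-tuple R) => tnth x i)) => i.
exact: measurable_tnth.
Qed.

Lemma measurable_ssimp n : measurable (ssimp n).
Proof.
apply: measurableI; first exact: measurable_box.
rewrite (_ : mkset _ = @tsum n @^-1` `]-oo, 1]%classic).
  by rewrite -[X in measurable X]setTI; exact: measurable_tsum.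
by apply/seteqP; split => x; rewrite /preimage/= in_itv.
Qed.

Lemma tsum_cons n t (x : n.-tuple R) : tsum (tcons (t, x)) = t + tsum x.
Proof.
rewrite /tsum big_ord_recl tnth0; congr (_ + _).
by apply: eq_bigr => i _; rewrite tnthS.
Qed.

(** The size [c] is a parameter because the section of the simplex of size [c] at first coordinate
    [t] is the simplex of size [c - t]. With [c <= 1] the cube constraint on that coordinate holds
    automatically. *)
Lemma leb_scaled_simp n (c : R) : 0 <= c <= 1 ->
  leb R n (cube n `&` [set x | tsum x <= c]) = (c ^+ n / n`!%:R)%:E.
Proof.
elim: n c => [|n IH] c /andP[c0 c1].
  rewrite /= diracE expr0 divr1 mem_set//; split; first by case.
  by rewrite /= /tsum big_ord0.
rewrite lebE /= /product_measure1.
have E t : (leb R n \o xsection (@tcons R n @^-1` (cube n.+1 `&` [set x | tsum x <= c]))) t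
   = ((fun t => ((c - t) ^+ n / n`!%:R)%:E) \_ `[0, c]%classic) t.
  rewrite patchE; case: ifPn => [|tc]; rewrite ?inE/= ?in_itv/=.
    move=> /andP[t0 tc]; rewrite -IH; last by rewrite subr_ge0 tc lerBlDr ler_wpDr.
    congr (leb R n _); apply/seteqP; split => x; rewrite /xsection/= inE/= tsum_cons lerBrDl;
    rewrite -[cube n.+1 _]/((@tcons R n @^-1` cube n.+1) (t, x)) boxS/= in_itv/=.
      by move=> [[]].
    by move=> [? ?]; rewrite t0 (le_trans tc).
  rewrite (_ : xsection _ _ = set0) ?measure0//.
  apply/seteqP; split => // x; rewrite /xsection/= inE/= tsum_cons.
  rewrite -[cube n.+1 _]/((@tcons R n @^-1` cube n.+1) (t, x)) boxS/= in_itv/=.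
  move=> [[/andP[t0 t1] cx] le]; move: tc; rewrite notin_setE/= in_itv/= t0/=; apply.
  rewrite (le_trans _ le)// lerDl sumr_ge0// => i _.
  by have /andP[] := cx i.
under eq_integral do rewrite E.
rewrite -integral_mkcond.
transitivity (\int[lebesgue_measure]_(t in `[0%R, c]) (n.+1%:R * (c - t) ^+ n * n.+1`!%:R^-1)%:E)%E.
  apply: eq_integral => t _; congr (_%:E).
  by rewrite factS natrM invfM mulrCA mulrA mulrC !mulrA mulVf ?pnatr_eq0// mul1r mulrC.
exact: integral_powB.
Qed.

Lemma leb_ssimp n : leb R n (ssimp n) = (n`!%:R^-1)%:E.
Proof. by rewrite leb_scaled_simp ?ler01 ?lexx// expr1n div1r. Qed.

End simplex_volume.
Arguments ssimp {R} n.

(** * Borel sets and affine charts of simplices *)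

Section borel_rV.
Context {R : realType} {N : nat}.

Definition borelT := g_sigma_algebraType (@open 'rV[R]_N).
HB.instance Definition _ := Measurable.on borelT.

(** These balls form a base of the topology indexed by a countable type, so unions over them, and
    families indexed by lists of them, are countable. *)
Definition ratball (qk : 'rV[rat]_N * nat) : set 'rV[R]_N :=
  ball (map_mx ratr qk.1 : 'rV[R]_N) (qk.2.+1%:R^-1).

Lemma ratball_sub (x : 'rV[R]_N) (e : R) : 0 < e ->
  exists qk, ratball qk x /\ ratball qk `<=` ball x e.
Proof.
move=> e0.
have [k ke] : exists k, (k.+1%:R^-1 : R) < e / 2.
  have [k _ /(_ k (leqnn k)) Hk] := near_infty_natSinv_lt (PosNum (divr_gt0 e0 (ltr0n _ 2))).
  by exists k.
have kp : (0 : R) < k.+1%:R^-1 by rewrite invr_gt0.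
have H (i : 'I_N) : exists q : rat, `|ratr q - x 0 i| < k.+1%:R^-1.
  have [|q] := @rat_in_itvoo R (x 0 i) (x 0 i + k.+1%:R^-1); first by rewrite ltrDl.
  rewrite in_itv/= => /andP[q1 q2]; exists q.
  by rewrite ger0_norm ?subr_ge0 ?(ltW q1)// ltrBlDl.
have [q Hq] := choice H.
exists (\row_i q i, k); split.
  split => // i j; rewrite !mxE (ord1 i) /ball/=; exact: Hq.
move=> y [_ By]; split => // i j.
have := By i j; rewrite !mxE (ord1 i) => Bij.
have := Hq j; move: Bij; rewrite /ball/= => B1 B2.
rewrite (le_lt_trans (ler_distD (ratr (q j)) _ _))// (splitr e) ltrD// (lt_trans _ ke)//.
by rewrite distrC.
Qed.

Lemma measurable_open (U : set 'rV[R]_N) : open U -> measurable (U : set borelT).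
Proof. by move=> oU; exact: sub_sigma_algebra. Qed.

Lemma measurable_closed (U : set 'rV[R]_N) : closed U -> measurable (U : set borelT).
Proof.
by move=> cU; rewrite -(setCK U); apply: measurableC; apply: measurable_open; rewrite openC.
Qed.

Lemma measurable_ratball qk : measurable (ratball qk : set borelT).
Proof. by apply: measurable_open; exact: ball_open. Qed.

(** An open set is a countable union of rational balls, and in the sup norm a ball is a finite
    conjunction of conditions on single coordinates. *)
Lemma measurable_fun_borel d (T : measurableType d) (f : T -> borelT) :
  (forall i, measurable_fun setT (fun x => (f x : 'rV[R]_N) 0 i)) -> measurable_fun setT f.
Proof.
move=> mf; apply: (@measurability _ _ _ borelT setT f (@open 'rV[R]_N)) => // _ [U oU <-].
rewrite setTI.
pose P := [set qk | ratball qk `<=` U].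
rewrite (_ : U = \bigcup_(qk in P) ratball qk); last first.
  apply/seteqP; split => [x Ux|x [qk Pqk Qx]]; last exact: Pqk.
  have [e /= e0 xeO] : exists2 e : R, 0 < e & ball x e `<=` U.
    by have := open_nbhs_nbhs (conj oU Ux); rewrite -nbhs_ballE => -[e ? ?]; exists e.
  have [qk [xqk qke]] := ratball_sub x e0.
  by exists qk => //; exact: subset_trans xeO.
rewrite preimage_bigcup bigcup_mkcond; apply: countable_bigcupT_measurable => //.
move=> [q k]; case: ifPn => // _.
rewrite (_ : f @^-1` _ = \bigcap_(i in [set: 'I_N])
   ((fun x => (f x : 'rV[R]_N) 0 i) @^-1` ball (ratr (q 0 i) : R) k.+1%:R^-1)).
  apply: fin_bigcap_measurable; first exact: finite_finset.
  move=> i _; rewrite -[X in measurable X]setTI; apply: mf => //.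
  by apply: open_measurable; exact: ball_open.
apply/seteqP; split => x.
  by move=> [_ H] i _; have := H 0 i; rewrite mxE.
move=> H; split; first by rewrite invr_gt0.
by move=> i j; rewrite mxE (ord1 i); exact: H.
Qed.

Lemma measurable_fun_cont (f : 'rV[R]_N -> 'rV[R]_N) : continuous f ->
  measurable_fun setT (f : borelT -> borelT).
Proof.
move=> cf; apply: (@measurability _ _ borelT borelT setT f (@open 'rV[R]_N)) => // _ [U oU <-].
by rewrite setTI; apply: measurable_open; exact: open_comp.
Qed.
End borel_rV.
Arguments borelT R N : clear implicits.

Lemma measurable_preimageT d1 d2 (T1 : measurableType d1) (T2 : measurableType d2)
  (f : T1 -> T2) (A : set T2) : measurable_fun setT f -> measurable A -> measurable (f @^-1` A).
Proof. by move=> mf mA; rewrite -[X in measurable X]setTI; exact: mf. Qed.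

Section rowtuple.
Context {R : realType} {d : nat}.

(** The reversal undoes the one in [tot], so that entry [i] of the row is again [t i]. *)
Definition rw (x : d.-tuple R) : 'rV[R]_d := \row_i tnth x (rev_ord i).
Definition unrw (v : 'rV[R]_d) : d.-tuple R := [tuple v 0 (rev_ord i) | i < d].

Lemma rwK : cancel rw unrw.
Proof. by move=> x; apply: eq_from_tnth => i; rewrite tnth_mktuple mxE rev_ordK. Qed.

Lemma unrwK : cancel unrw rw.
Proof. by move=> x; apply/rowP => i; rewrite mxE tnth_mktuple rev_ordK. Qed.

Lemma rw_tadd (x y : d.-tuple R) : rw (tadd x y) = rw x + rw y.
Proof. by apply/rowP => i; rewrite !mxE tnth_mktuple. Qed.

Lemma rw_tot (t : nat -> R) : rw (tot d t) = \row_i t i.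
Proof. by apply/rowP => i; rewrite !mxE tnth_mktuple rev_ordK. Qed.

Definition affm m (a0 : 'rV[R]_m) (A : 'M[R]_(d, m)) (x : d.-tuple R) : 'rV[R]_m :=
  a0 + rw x *m A.

Lemma measurable_affm_coord m (a0 : 'rV[R]_m) (A : 'M[R]_(d, m)) i :
  measurable_fun setT (fun x => affm a0 A x 0 i).
Proof.
rewrite (_ : (fun x => _) = fun x => a0 0 i + \sum_(j < d) tnth x (rev_ord j) * A j i); last first.
  by apply/funext => x; rewrite !mxE; congr (_ + _); apply: eq_bigr => j _; rewrite !mxE.
apply: measurable_funD; first exact: measurable_cst.
apply: (@measurable_sum _ _ _ _ _ _ (fun j (x : d.-tuple R) => tnth x (rev_ord j) * A j i)) => j.
by apply: measurable_funM; [exact: measurable_tnth|exact: measurable_cst].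
Qed.

Lemma measurable_affm m (a0 : 'rV[R]_m) (A : 'M[R]_(d, m)) :
  measurable_fun setT (affm a0 A : _ -> borelT R m).
Proof. by apply: measurable_fun_borel => i; exact: measurable_affm_coord. Qed.

Definition affT (a0 : 'rV[R]_d) (A : 'M[R]_d) (x : d.-tuple R) := unrw (affm a0 A x).

Lemma measurable_affT (a0 : 'rV[R]_d) (A : 'M[R]_d) : measurable_fun setT (affT a0 A).
Proof.
apply/measurable_fun_tnthP => i.
rewrite (_ : _ \o _ = fun x => affm a0 A x 0 (rev_ord i)); first exact: measurable_affm_coord.
by apply/funext => x; rewrite /= tnth_mktuple.
Qed.

Lemma affTK (a0 : 'rV[R]_d) (A : 'M[R]_d) : A \in unitmx ->
  cancel (affT a0 A) (affT (- a0 *m invmx A) (invmx A)).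
Proof.
move=> uA x; rewrite /affT /affm unrwK mulmxDl mulNmx addKr mulmxK//.
exact: rwK.
Qed.

Lemma affTVK (a0 : 'rV[R]_d) (A : 'M[R]_d) : A \in unitmx ->
  cancel (affT (- a0 *m invmx A) (invmx A)) (affT a0 A).
Proof.
move=> uA x; rewrite /affT /affm unrwK mulmxDl -!mulmxA mulVmx//.
by rewrite !mulmx1 addrA subrr add0r rwK.
Qed.
End rowtuple.

(** * Lebesgue measure under an invertible affine map *)

Section lebaff.
Context {R : realType} {d : nat} (t0 : 'rV[R]_d) (A : 'M[R]_d) (uA : A \in unitmx).

(* The invertibility proof is an argument so that the sigma-finiteness instance below,
   which needs it, can be inferred. *)
Definition lebaff of A \in unitmx := pushforward (leb R d) (affT t0 A).
Local Notation mu := (lebaff uA).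

Let mS : {measure set (d.-tuple R) -> \bar R} :=
  @measure_function_pushforward__canonical__measure_function_Measure _ _ _ _ _
   (leb R d) _ (measurable_affT t0 A).

Let lebS0 : mu set0 = 0%E.
Proof. exact: (measure0 mS). Qed.
Let lebS_ge0 X : (0 <= mu X)%E.
Proof. exact: (measure_ge0 mS). Qed.
Let lebS_sigma : semi_sigma_additive mu.
Proof. exact: (@measure_semi_sigma_additive _ _ _ mS). Qed.

HB.instance Definition _ := isMeasure.Build _ _ _ mu lebS0 lebS_ge0 lebS_sigma.

Let lebS_fin : sigma_finite setT mu.
Proof.
have [F FT mF] := sigma_finiteT (leb R d).
pose u := affT (- t0 *m invmx A) (invmx A).
exists (fun k => u @^-1` F k); first by rewrite -preimage_bigcup -FT.
move=> k; have [mFk Fk] := mF k; split.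
  exact: (measurable_preimageT (measurable_affT _ _)).
rewrite /lebaff /pushforward (_ : _ @^-1` _ = F k)//.
by apply/seteqP; split => x; rewrite /preimage /u /= affTK.
Qed.

HB.instance Definition _ := Measure_isSigmaFinite.Build _ _ _ mu lebS_fin.

(** Translating the target by [a] amounts to translating the source by [a *m invmx A], so the image
    measure is translation invariant. The factor is read off on the standard simplex, of volume
    [1 / d!]. *)
Lemma leb_affT (X : set (d.-tuple R)) : measurable X ->
  leb R d (affT t0 A @^-1` X) =
  ((d`!%:R)%:E * leb R d (affT t0 A @^-1` ssimp d) * leb R d X)%E.
Proof.
move=> mX; have f0 : (0 : R) < d`!%:R^-1 by rewrite invr_gt0 ltr0n fact_gt0.
have := @haar_uniq R d (lebaff uA) (ssimp d) _ _ (@measurable_ssimp R d) (leb_ssimp d) f0 X mX.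
rewrite invrK; apply => a Y mY.
transitivity (leb R d ((fun x => tadd x (unrw (rw a *m invmx A))) @^-1` (affT t0 A @^-1` Y))).
  2: exact: (leb_tadd _ (measurable_preimageT (measurable_affT _ _) mY)).
congr (leb R d _); apply/seteqP; split => x; rewrite /preimage/= /affT /affm rw_tadd unrwK mulmxDl mulmxKV//.
  by rewrite (_ : tadd _ _ = unrw (t0 + (rw x *m A + rw a)))// -[LHS]rwK rw_tadd unrwK addrA.
by rewrite (_ : tadd _ _ = unrw (t0 + (rw x *m A + rw a)))// -[LHS]rwK rw_tadd unrwK addrA.
Qed.

(** If the factor vanished, [leb_affT] would give the whole space measure zero. *)
Lemma leb_affT_gt0 : (0 < leb R d (affT t0 A @^-1` ssimp d))%E.
Proof.
rewrite lt0e measure_ge0 andbT; apply/eqP => l0.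
have := @leb_affT setT measurableT; rewrite preimage_setT l0 mule0 mul0e => T0.
have := @leb_ssimp R d; apply/eqP.
rewrite (@subset_measure0 _ _ _ (leb R d) _ setT)//; last exact: measurable_ssimp.
by rewrite eq_sym eqe invr_eq0 pnatr_eq0 -lt0n fact_gt0.
Qed.
End lebaff.

Section hyperplane.
Context {R : realType} {d : nat}.

Lemma leb_hyperplane (z : 'cV[R]_d) (c : R) : z != 0 ->
  leb R d (cube d `&` [set x | (rw x *m z) 0 0 = c]) = 0%E.
Proof.
move=> z0; have [i zi] : exists i, z i 0 != 0.
  apply/existsP; apply: contraNT z0; rewrite negb_exists => /forallP H.
  by apply/eqP/colP => i; rewrite mxE; apply/eqP; have := H i; rewrite negbK.
set H := _ `&` _.
have mH : measurable H.
  apply: measurableI; first exact: measurable_box.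
  rewrite (_ : mkset _ = (fun x => affm 0 z x 0 0) @^-1` [set c]).
    by apply: measurable_preimageT => //; exact: measurable_affm_coord.
  by apply/seteqP; split => x; rewrite /preimage/= /affm add0r.
(* Infinitely many disjoint translates of [H] fit into a bounded box. *)
pose a (k : nat) : d.-tuple R := unrw ((k.+1)%:R^-1 *: delta_mx 0 i).
have tak k j : tnth (a k) j = if rev_ord j == i then k.+1%:R^-1 else 0.
  by rewrite tnth_mktuple !mxE eqxx/=; case: eqP => _; rewrite ?mulr1 ?mulr0.
pose F k := (fun x => tadd x (topp (a k))) @^-1` H.
have mF k : measurable (F k).
  by apply: measurable_preimageT => //; exact: measurable_taddl.
have lF k : leb R d (F k) = leb R d H by rewrite leb_tadd.
have Fbox k : F k `<=` box 2 d.
  move=> x [/= Hc _] j; have := Hc j; rewrite tnth_mktuple tnth_mktuple tak.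
  have k1 : (k.+1%:R^-1 : R) <= 1 by rewrite invf_le1 ?ler1n.
  have k0 : (0 : R) < k.+1%:R^-1 by rewrite invr_gt0.
  by move: (k.+1%:R^-1 : R) k0 k1 => q q0 q1; case: ifP => _ /andP[h1 h2]; apply/andP; split; lra.
have rtopp (x : d.-tuple R) : rw (topp x) = - rw x.
  by apply/rowP => j; rewrite !mxE tnth_mktuple.
(* On [F k] the linear form takes the value [c] plus [z i 0] divided by [k + 1], so the translates
   lie in distinct level sets. *)
have tF : trivIset setT F.
  apply/trivIsetP => k l _ _ kl; apply/seteqP; split => // x [[_ /= h1] [_ /= h2]].
  have : (rw (a k) *m z) 0 0 = (rw (a l) *m z) 0 0.
    have E k' : (rw (tadd x (topp (a k'))) *m z) 0 0 = (rw x *m z) 0 0 - (rw (a k') *m z) 0 0.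
      by rewrite rw_tadd rtopp mulmxDl mulNmx mxE; congr (_ + _); rewrite mxE.
    by apply: oppr_inj; apply: (addrI ((rw x *m z) 0 0)); rewrite -!E h1 h2.
  rewrite /a !unrwK -!scalemxAl -rowE !mxE => /(mulIf zi)/invr_inj/eqP.
  by rewrite eqr_nat eqSS (negbTE kl).
have fH : leb R d H \is a fin_num.
  rewrite ge0_fin_numE ?measure_ge0//.
  apply: (@le_lt_trans _ _ (leb R d (box 2 d))); last by rewrite leb_box// ltry.
  by rewrite -(lF 0%N) le_measure ?inE//; exact: measurable_box.
have K k : (k%:R * fine (leb R d H) <= 2 ^+ d).
  rewrite -lee_fin EFinM fineK// -leb_box//.
  apply: (@le_trans _ _ (leb R d (\big[setU/set0]_(j < k) F j))); last first.
    apply: le_measure; rewrite ?inE.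
    - by apply: bigsetU_measurable.
    - exact: measurable_box.
    - by move=> x; rewrite -bigcup_mkord => -[j _]; exact: Fbox.
  rewrite measure_bigsetU//.
  rewrite (eq_bigr (fun=> leb R d H)) => [|j _]; last exact: lF.
  by rewrite -(fineK fH) sumEFin -EFinM sumr_const card_ord lee_fin mulr_natl.
rewrite -(fineK fH); congr (_%:E); apply/eqP; rewrite eq_le fine_ge0 ?measure_ge0// andbT.
rewrite leNgt; apply/negP => m0.
have [k kb] : exists k : nat, 2 ^+ d < k%:R * fine (leb R d H).
  exists (Num.truncn (2 ^+ d / fine (leb R d H))).+1.
  by rewrite -ltr_pdivrMr// truncnS_gt.
by have := K k; rewrite leNgt kb.
Qed.
End hyperplane.

(** * Normalised Lebesgue measure of an affine simplex *)

Section lamM.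
Context {R : realType} {d N : nat} (a0 : 'rV[R]_N) (A : 'M[R]_(d, N)).

Definition lamM (D : set (borelT R N)) : \bar R :=
  ((d`!%:R)%:E * leb R d (affm a0 A @^-1` D `&` ssimp d))%E.

Let mP : {measure set (d.-tuple R) -> \bar R} := mrestr (leb R d) (@measurable_ssimp R d).
Let mS : {measure set (borelT R N) -> \bar R} :=
  @measure_function_pushforward__canonical__measure_function_Measure _ _ _ _ _
   mP _ (measurable_affm a0 A).
Let mC : {measure set (borelT R N) -> \bar R} := mscale (d`!%:R)%:nng mS.

Let lamM0 : lamM set0 = 0%E.
Proof. exact: (measure0 mC). Qed.
Let lamM_ge0 X : (0 <= lamM X)%E.
Proof. exact: (measure_ge0 mC). Qed.
Let lamM_sigma : semi_sigma_additive lamM.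
Proof. exact: (@measure_semi_sigma_additive _ _ _ mC). Qed.

HB.instance Definition _ := isMeasure.Build _ _ _ lamM lamM0 lamM_ge0 lamM_sigma.

Let lamM_setT : lamM setT = 1%E.
Proof.
rewrite /lamM preimage_setT setTI leb_ssimp -EFinM divff// pnatr_eq0 -lt0n.
Qed.

HB.instance Definition _ := Measure_isProbability.Build _ _ _ lamM lamM_setT.

Lemma lamM_out D : D `&` (affm a0 A @` ssimp d) = set0 -> lamM D = 0%E.
Proof.
move=> D0; rewrite /lamM (_ : _ `&` _ = set0) ?measure0 ?mule0//.
apply/seteqP; split => // x [Dx sx].
suff : (set0 : set (borelT R N)) (affm a0 A x) by [].
by rewrite -D0; split => //; exists x.
Qed.

End lamM.

Section affine_pieces.
Context {R : realType} {d N : nat}.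
Implicit Types (a b : 'rV[R]_N) (A B : 'M[R]_(d, N)).

Definition unitv (i : 'I_d) : d.-tuple R := unrw (delta_mx 0 i).

Lemma ssimp_unrw (v : 'rV[R]_d) : (forall i, 0 <= v 0 i) -> \sum_i v 0 i <= 1 ->
  ssimp d (unrw v).
Proof.
move=> v0 v1; split.
  move=> i; rewrite tnth_mktuple v0/= (le_trans _ v1)//.
  by rewrite (bigD1 (rev_ord i))//= lerDl sumr_ge0.
rewrite /= /tsum; under eq_bigr do rewrite tnth_mktuple.
by rewrite (reindex_inj rev_ord_inj)/=; under eq_bigr do rewrite rev_ordK.
Qed.

Lemma ssimp_rw (x : d.-tuple R) : ssimp d x ->
  (forall i, 0 <= rw x 0 i <= 1) /\ \sum_i rw x 0 i <= 1.
Proof.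
move=> [c s]; split; first by move=> i; rewrite mxE; exact: c.
move: s; rewrite /= /tsum (reindex_inj rev_ord_inj)/= => s.
by under eq_bigr do rewrite mxE.
Qed.

Lemma ssimp_unitv i : ssimp d (unitv i).
Proof.
apply: ssimp_unrw; first by move=> j; rewrite mxE ler0n.
rewrite (bigD1 i)//= big1; first by rewrite mxE !eqxx addr0.
by move=> j ji; rewrite mxE (negbTE ji) andbF.
Qed.

Lemma affm_unitv a A i : affm a A (unitv i) = a + row i A.
Proof. by rewrite /affm /unitv unrwK -rowE. Qed.

Lemma affm0 a A : affm a A (unrw 0) = a.
Proof. by rewrite /affm unrwK mul0mx addr0. Qed.

Lemma ssimp0 : ssimp d (unrw 0 : d.-tuple R).
Proof. by apply: ssimp_unrw => [i|]; rewrite ?mxE// big1// => i _; rewrite mxE. Qed.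

Lemma affm_inj a A : row_free A -> injective (affm a A).
Proof.
move=> /row_freeP[A' AA'] x y /addrI /(congr1 (mulmx^~ A')).
by rewrite -!mulmxA AA' !mulmx1 => /(can_inj rwK).
Qed.

(** The edge vectors of the inner simplex are differences of points of the outer one. *)
Lemma affm_sub a A b B : affm b B @` ssimp d `<=` affm a A @` ssimp d -> (B <= A)%MS.
Proof.
move=> BA; have [x0 _ x0E] : (affm a A @` ssimp d) b.
  by apply: BA; exists (unrw 0); [exact: ssimp0|rewrite affm0].
apply/row_subP => i.
have [x _ xE] : (affm a A @` ssimp d) (b + row i B).
  by apply: BA; exists (unitv i); [exact: ssimp_unitv|rewrite affm_unitv].
apply/submxP; exists (rw x - rw x0); rewrite mulmxBl.
by rewrite -[LHS](addrK b) [row _ _ + b]addrC -xE -x0E /affm opprD addrACA subrr add0r.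
Qed.

(* The coordinate change [th] between the two charts turns one measure into a
   multiple of the other by uniqueness of Haar measure; no determinant is computed. *)
Lemma lamM_piece a A b B : row_free A -> row_free B ->
  affm b B @` ssimp d `<=` affm a A @` ssimp d ->
  (0 < lamM a A (affm b B @` ssimp d))%E /\
  forall D : set 'rV[R]_N, measurable (D : set (borelT R N)) ->
    lamM a A (D `&` (affm b B @` ssimp d)) = (lamM a A (affm b B @` ssimp d) * lamM b B D)%E.
Proof.
move=> fA fB BA.
have [x0 _ x0E] : (affm a A @` ssimp d) b.
  by apply: BA; exists (unrw 0); [exact: ssimp0|rewrite affm0].
have [T TE] := submxP (affm_sub BA).
have uT : T \in unitmx.
  rewrite -row_free_unit /row_free eqn_leq rank_leq_row /=.
  by move: fB; rewrite /row_free TE => /eqP {1}<-; exact: mxrankM_maxl.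
pose th := affT (rw x0) T; pose th' := affT (- rw x0 *m invmx T) (invmx T).
have thE y : affm a A (th y) = affm b B y.
  by rewrite /th /affT /affm unrwK mulmxDl -mulmxA -TE addrA -/(affm a A x0) x0E.
have uT' : invmx T \in unitmx by rewrite unitmx_inv.
have key D : affm a A @^-1` (D `&` affm b B @` ssimp d) `&` ssimp d =
    th' @^-1` (affm b B @^-1` D `&` ssimp d).
  apply/seteqP; split => x.
    move=> [[/= Dx [y sy yx]] sx].
    have -> : x = th y by apply: (affm_inj fA); exact: (esym (etrans (thE y) yx)).
    by rewrite /preimage/= /th' /th affTK//; split => //; rewrite yx.
  move=> [/= Dx sx].
  have xE : affm a A x = affm b B (th' x) by rewrite -thE /th /th' affTVK.
  have Qx : (affm b B @` ssimp d) (affm a A x) by exists (th' x).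
  split; first by split => //=; rewrite xE.
  by have [y sy /(affm_inj fA) <-] := BA _ Qx.
have E (D : set 'rV[R]_N) : measurable (D : set (borelT R N)) -> lamM a A (D `&` (affm b B @` ssimp d)) =
    (d`!%:R%:E * leb R d (th' @^-1` ssimp d) * lamM b B D)%E.
  move=> mD; rewrite /lamM key leb_affT//; last first.
    apply: measurableI; last exact: measurable_ssimp.
    exact: (measurable_preimageT (measurable_affm _ _)).
  by rewrite -!muleA; congr (_ * _)%E; rewrite muleCA.
have cE : lamM a A (affm b B @` ssimp d) = (d`!%:R%:E * leb R d (th' @^-1` ssimp d))%E.
  by rewrite -[X in lamM _ _ X]setTI E// (@probability_setT _ _ _ (lamM b B)) mule1.
split; last by move=> D mD; rewrite E// cE.
by rewrite cE mule_gt0 ?lte_fin ?ltr0n ?fact_gt0//; exact: leb_affT_gt0.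
Qed.
End affine_pieces.

(** * Barycentric coordinates and charts *)

Section shull_chart.
Context {R : realType} {N : nat} {V : finType}.
Implicit Types (p : V -> 'rV[R]_N) (s : {set V}).

Definition va p s : 'rV[R]_N := nth 0 (map p (enum s)) 0.
Definition vA p d s : 'M[R]_(d, N) :=
  \matrix_(i < d) (nth 0 (map p (enum s)) i.+1 - nth 0 (map p (enum s)) 0).

Lemma sum_simplex_enum (U : zmodType) d s (v0 : V) (F : V -> U) : #|s| = d.+1 ->
  (forall v, v \notin s -> F v = 0) ->
  \sum_v F v = F (nth v0 (enum s) 0) + \sum_(i < d) F (nth v0 (enum s) i.+1).
Proof.
move=> sd F0; rewrite (bigID (mem s))/= [X in _ + X]big1 // addr0.
rewrite -big_enum (big_nth v0) -cardE sd big_mkord big_ord_recl/=; congr (_ + _).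
Qed.

Lemma affmE p d s (x : d.-tuple R) :
  affm (va p s) (vA p d s) x =
  (1 - \sum_i rw x 0 i) *: nth 0 (map p (enum s)) 0 +
   \sum_(i < d) rw x 0 i *: nth 0 (map p (enum s)) i.+1.
Proof.
rewrite /affm mulmx_sum_row; under eq_bigr do rewrite rowK scalerBr.
by rewrite sumrB -scaler_suml scalerBl scale1r addrA addrAC.
Qed.

Lemma sparamE p d s t : sparam p d s t = affm (va p s) (vA p d s) (tot d t).
Proof.
rewrite affmE rw_tot /sparam; congr ((1 - _) *: _ + _).
  by apply: eq_bigr => i _; rewrite mxE.
by apply: eq_bigr => i _; rewrite mxE.
Qed.

Let coef s (h : nat -> R) (v : V) := if v \in s then h (index v (enum s)) else 0.

Let coef_nth s d h (v0 : V) i : #|s| = d.+1 -> (i <= d)%N -> coef s h (nth v0 (enum s) i) = h i.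
Proof.
move=> sd id; rewrite /coef index_uniq ?enum_uniq -?cardE ?sd//.
by rewrite -mem_enum mem_nth// -cardE sd.
Qed.

Let nth_map_enum p s d (v0 : V) i : #|s| = d.+1 -> (i <= d)%N ->
  nth 0 (map p (enum s)) i = p (nth v0 (enum s) i).
Proof. by move=> sd id; rewrite (nth_map v0)// -cardE sd. Qed.

(* The coordinates do not depend on the vertex map, so that the charts of
   [p'] and of [p \o gamma] on the same simplex can be compared. *)
Lemma chart_of_coef d s (b : V -> R) : #|s| = d.+1 ->
  (forall v, 0 <= b v) -> (forall v, v \notin s -> b v = 0) -> \sum_v b v = 1 ->
  exists2 y, ssimp d y & forall p, \sum_v b v *: p v = affm (va p s) (vA p d s) y.
Proof.
move=> sd b0 bs b1; have [v0 _] : exists v0, v0 \in s by apply/card_gt0P; rewrite sd.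
pose y : 'rV[R]_d := \row_i b (nth v0 (enum s) i.+1).
have b1' : b (nth v0 (enum s) 0) = 1 - \sum_i y 0 i.
  rewrite -b1 (sum_simplex_enum v0 sd)//.
  rewrite [\sum_i y 0 i](_ : _ = \sum_(i < d) b (nth v0 (enum s) i.+1)) ?addrK//.
  by apply: eq_bigr => i _; rewrite mxE.
exists (unrw y).
  apply: ssimp_unrw => [i|]; first by rewrite mxE.
  by rewrite -subr_ge0 -b1'.
move=> p; rewrite affmE unrwK -b1' (sum_simplex_enum v0 sd); last by move=> v /bs ->; rewrite scale0r.
rewrite (nth_map_enum _ v0 sd)//; congr (_ + _).
by apply: eq_bigr => i _; rewrite mxE (nth_map_enum _ v0 sd).
Qed.

Lemma coef_of_chart d s y : #|s| = d.+1 -> ssimp d y ->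
  exists b : V -> R, [/\ (forall v, 0 <= b v), (forall v, v \notin s -> b v = 0),
   \sum_v b v = 1 & forall p, affm (va p s) (vA p d s) y = \sum_v b v *: p v].
Proof.
move=> sd /ssimp_rw [y01 y1].
have [v0 _] : exists v0, v0 \in s by apply/card_gt0P; rewrite sd.
(* The first vertex receives the weight missing to 1; [insub] merely turns the remaining indices
   into ordinals. *)
pose h k : R := if k is k'.+1 then (if insub k' is Some i then rw y 0 i else 0) else 1 - \sum_i rw y 0 i.
have hS (i : 'I_d) : h i.+1 = rw y 0 i by rewrite /h/= valK.
have h0 k : 0 <= h k.
  case: k => [|k]; rewrite /h ?subr_ge0//; case: insubP => // i _ _.
  by have /andP[] := y01 i.
have cs v : v \notin s -> coef s h v = 0 by rewrite /coef => /negbTE ->.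
exists (coef s h); split => //.
- by move=> v; rewrite /coef; case: ifP.
- rewrite (sum_simplex_enum (F := coef s h) v0 sd)// (coef_nth _ _ sd)//=.
  by rewrite [X in _ + X](eq_bigr (fun i => rw y 0 i)) ?subrK// => i _; rewrite (coef_nth _ _ sd)// hS.
- move=> p; rewrite (sum_simplex_enum (F := fun v => coef s h v *: p v) v0 sd)/=; last by move=> v /cs ->; rewrite scale0r.
  rewrite affmE (coef_nth _ _ sd)//= (nth_map_enum _ v0 sd)//; congr (_ + _).
  by apply: eq_bigr => i _; rewrite (coef_nth _ _ sd)// hS (nth_map_enum _ v0 sd).
Qed.

Lemma shull_chart p d s : #|s| = d.+1 ->
  shull p s = affm (va p s) (vA p d s) @` ssimp d.
Proof.
move=> sd; apply/seteqP; split => x.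
  move=> [b [b0 bs b1 ->]]; have [y sy yE] := chart_of_coef sd b0 bs b1.
  by exists y.
move=> [y sy <-]; have [b [b0 bs b1 bE]] := coef_of_chart sd sy.
by exists b.
Qed.

Lemma vA_free p d s : #|s| = d.+1 -> aff_indep p s -> row_free (vA p d s).
Proof.
move=> sd ind; have [v0 _] : exists v0, v0 \in s by apply/card_gt0P; rewrite sd.
apply: inj_row_free => y yA.
(* A linear relation between edge vectors becomes an affine one when the first vertex receives minus
   the sum of the coefficients. *)
pose h k : R := if k is k'.+1 then (if insub k' is Some i then y 0 i else 0) else - \sum_i y 0 i.
have hS (i : 'I_d) : h i.+1 = y 0 i by rewrite /h/= valK.
have cs v : v \notin s -> coef s h v = 0 by rewrite /coef => /negbTE ->.
have : forall v, coef s h v = 0.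
  apply: ind => //.
    rewrite (sum_simplex_enum (F := coef s h) v0 sd)// (coef_nth _ _ sd)//=.
    by rewrite [X in _ + X](eq_bigr (fun i => y 0 i)) ?addNr// => i _; rewrite (coef_nth _ _ sd)// hS.
  rewrite (sum_simplex_enum (F := fun v => coef s h v *: p v) v0 sd)/=; last by move=> v /cs ->; rewrite scale0r.
  rewrite (coef_nth _ _ sd)//= -[RHS]yA mulmx_sum_row.
  under [in RHS]eq_bigr do rewrite rowK scalerBr.
  rewrite sumrB -scaler_suml scaleNr addrC (nth_map_enum _ v0 sd)//; congr (_ - _).
  by apply: eq_bigr => i _; rewrite (coef_nth _ _ sd)// hS (nth_map_enum _ v0 sd).
move=> c0; apply/rowP => i; rewrite mxE -hS.
by rewrite -(@coef_nth s d h v0 i.+1 sd)// c0.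
Qed.
End shull_chart.

Lemma continuous_sumr {R : realType} {T : topologicalType} {W : normedModType R} (I : finType)
  (F : I -> T -> W) : (forall i, continuous (F i)) -> continuous (fun x => \sum_i F i x).
Proof. by move=> cF; apply: continuous_big => //; exact: add_continuous. Qed.

Section shull_topology.
Context {R : realType} {N : nat} {V : finType}.
Implicit Types (p : V -> 'rV[R]_N) (s : {set V}).

Lemma continuous_sum_scale n (q : 'I_n -> 'rV[R]_N) :
  continuous (fun b : 'rV[R]_n => \sum_i b 0 i *: q i).
Proof.
apply: continuous_sumr => i b.
apply: (continuous_comp (f := fun b : 'rV[R]_n => b 0 i) (g := fun r : R => r *: q i)).
  exact: coord_continuous.
exact: scalel_continuous.
Qed.

(** The admissible coefficient vectors form a closed subset of a cube, and the hull is its image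
    under a linear map. *)
Lemma shull_compact p s : compact (shull p s).
Proof.
pose n := #|V|.
pose C : set 'rV[R]_n := [set b : 'rV[R]_n | forall i, `[0, 1]%classic (b 0 i)] `&`
  ((\bigcap_(i in [set i | enum_val i \notin s]) ((fun b : 'rV[R]_n => b 0 i) @^-1` [set 0])) `&`
   (fun b : 'rV[R]_n => \sum_i b 0 i) @^-1` [set 1]).
have cC : compact C.
  apply: compact_closedI.
    by apply: (@rV_compact R _ (fun=> `[0, 1]%classic)) => i; exact: segment_compact.
  apply: closedI.
    apply: closed_bigI => i _; apply: preimage_closed; last exact: closed_eq.
    by move=> b _; exact: coord_continuous.
  apply: preimage_closed; last exact: closed_eq.
  by move=> b _; apply: (@continuous_sumr R _ R^o _ (fun i (b : 'rV[R]_n) => b 0 i)) => i; exact: coord_continuous.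
rewrite (_ : shull p s = (fun b : 'rV[R]_n => \sum_i b 0 i *: p (enum_val i)) @` C).
  apply: continuous_compact => //; apply: continuous_subspaceT.
  exact: continuous_sum_scale.
apply/seteqP; split => x.
  move=> [b [b0 bs b1 ->]]; exists (\row_i b (enum_val i)); last first.
    rewrite [RHS](reindex (@enum_val V V)) /=; last exact: onW_bij (enum_val_bij V).
    by apply: eq_bigr => i _; rewrite mxE.
  have b1' : \sum_(i < n) b (enum_val i) = 1.
    by rewrite -b1 [RHS](reindex (@enum_val V V)) //; exact: onW_bij (enum_val_bij V).
  split; last split.
  - move=> i; rewrite mxE /= in_itv/= b0/= -b1' (bigD1 i)//= lerDl sumr_ge0//.
  - by move=> i /= /bs H; rewrite /preimage/= mxE.
  - by rewrite /preimage/= -[RHS]b1'; apply: eq_bigr => i _; rewrite mxE.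
move=> [b [b01 [bs b1]] <-]; exists (fun v => b 0 (enum_rank v)); split.
- by move=> v; have := b01 (enum_rank v); rewrite /= in_itv/= => /andP[].
- by move=> v vs; apply: (bs (enum_rank v)); rewrite /= enum_rankK.
- rewrite -[RHS]b1 (reindex (@enum_val V V)) /=; last exact: onW_bij (enum_val_bij V).
  by apply: eq_bigr => i _; rewrite enum_valK.
- rewrite [RHS](reindex (@enum_val V V)) /=; last exact: onW_bij (enum_val_bij V).
  by apply: eq_bigr => i _; rewrite enum_valK.
Qed.

Lemma shull_closed p s : closed (shull p s).
Proof. by apply: compact_closed; [exact: norm_hausdorff|exact: shull_compact]. Qed.

Lemma measurable_shull p s : measurable (shull p s : set (borelT R N)).
Proof. by apply: measurable_closed; exact: shull_closed. Qed.

Lemma polyh_bigsetU p (S : {set {set V}}) : polyh p S = \big[setU/set0]_(s in S) shull p s.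
Proof.
rewrite -big_enum -bigcup_seq; apply/seteqP; split => x [s sS sx]; exists s => //.
  by rewrite /= mem_enum.
by move: sS; rewrite /= mem_enum.
Qed.

Lemma polyh_compact p (S : {set {set V}}) : compact (polyh p S).
Proof. by rewrite polyh_bigsetU; apply: bigsetU_compact => s _; exact: shull_compact. Qed.

Lemma polyh_closed p (S : {set {set V}}) : closed (polyh p S).
Proof. by apply: compact_closed; [exact: norm_hausdorff|exact: polyh_compact]. Qed.

End shull_topology.

Lemma affm_ssimp_compact {R : realType} {N d} (a0 : 'rV[R]_N) (A : 'M[R]_(d, N)) :
  compact (affm a0 A @` ssimp d).
Proof.
pose C : set 'rV[R]_d := [set b : 'rV[R]_d | forall i, `[0, 1]%classic (b 0 i)] `&`
   (fun b : 'rV[R]_d => \sum_i b 0 i) @^-1` [set x | x <= 1].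
have cC : compact C.
  apply: compact_closedI.
    by apply: (@rV_compact R _ (fun=> `[0, 1]%classic)) => i; exact: segment_compact.
  apply: preimage_closed; last exact: closed_le.
  by move=> b _; apply: (@continuous_sumr R _ R^o _ (fun i (b : 'rV[R]_d) => b 0 i)) => i; exact: coord_continuous.
rewrite (_ : _ @` _ = (fun b : 'rV[R]_d => a0 + \sum_i b 0 i *: row i A) @` C).
  apply: continuous_compact => //; apply: continuous_subspaceT => b.
  apply: continuousD; first (move=> ?; exact: cst_continuous).
  exact: continuous_sum_scale.
apply/seteqP; split => _ [x xC <-].
  have [x0 x1] := ssimp_rw xC; exists (rw x); first by split => // i; rewrite /= in_itv/= x0.
  by rewrite /affm mulmx_sum_row.
case: xC => x0 x1; exists (unrw x); last by rewrite /affm unrwK mulmx_sum_row.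
by apply: ssimp_unrw => // i; have := x0 i; rewrite /= in_itv/= => /andP[].
Qed.

(** * Low-dimensional simplices are null, balls are not *)

Section null_and_positive.
Context {R : realType} {N d : nat} (a0 : 'rV[R]_N) (A : 'M[R]_(d, N)).
Hypothesis fA : row_free A.

(** The edge vectors of [s] span a space [Q] of dimension below [d], which cannot contain the row
    space of [A]. Hence some linear form [z] vanishes on [Q] but not on [A]; it is constant on the
    hull, and the chart pulls the hull back into a hyperplane. *)
Lemma lamM_lowdim {V : finType} (q : V -> 'rV[R]_N) (s : {set V}) : (#|s| <= d)%N ->
  lamM a0 A (shull q s) = 0%E.
Proof.
move=> sd.
have [->|[v0 v0s]] := set_0Vmem s.
  rewrite lamM_out//; apply/seteqP; split => // x [[b [b0 bs b1 _]] _].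
  by move: b1; rewrite big1 => [/eqP|v _]; rewrite ?bs ?inE// eq_sym oner_eq0.
pose Q : 'M[R]_N := (\sum_(v in s :\ v0) <<q v - q v0>>)%MS.
have rQ : (\rank Q < d)%N.
  apply: leq_trans sd; rewrite (cardsD1 v0 s) v0s add1n ltnS.
  apply: leq_trans (mxrank_sum_leqif _).1 _ => /=.
  rewrite -sum1_card; apply: leq_sum => v _; rewrite genmxE.
  exact: rank_leq_row.
have AQ : A *m cokermx Q != 0.
  rewrite -submxE; apply: contraL rQ => /mxrankS; rewrite (eqP fA) -leqNgt//.
have [i AQi] : exists i, A *m col i (cokermx Q) != 0.
  apply/existsP; apply: contraNT AQ; rewrite negb_exists => /forallP H.
  apply/eqP/matrixP => k j; have := H j; rewrite negbK => /eqP/colP/(_ k).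
  by rewrite colE mulmxA -colE !mxE.
set z := col i (cokermx Q) in AQi.
have qz v : v \in s -> (q v *m z) = q v0 *m z.
  move=> vs; have [->//|vv0] := eqVneq v v0.
  apply/eqP; rewrite -subr_eq0 -mulmxBl; apply/eqP.
  have : (q v - q v0 <= Q)%MS.
    rewrite -(genmxE (q v - q v0)) /Q.
    by apply: (sumsmx_sup v) => //; rewrite !inE vv0.
  by rewrite submxE => /eqP H; rewrite /z colE mulmxA H mul0mx.
have shz x : shull q s x -> x *m z = q v0 *m z.
  move=> [b [b0 bs b1 ->]].
  rewrite mulmx_suml -[RHS]scale1r -b1 scaler_suml; apply: eq_bigr => v _.
  have [vs|vs] := boolP (v \in s); first by rewrite -scalemxAl qz.
  by rewrite bs// !scale0r mul0mx.
rewrite /lamM; apply/eqP; rewrite mule_eq0; apply/orP; right; apply/eqP.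
pose c := ((q v0 - a0) *m z) 0 0.
have mc : measurable [set x : d.-tuple R | (rw x *m (A *m z)) 0 0 = c].
  rewrite (_ : mkset _ = (fun x => affm 0 (A *m z) x 0 0) @^-1` [set c]).
    by apply: measurable_preimageT => //; exact: measurable_affm_coord.
  by apply/seteqP; split => x; rewrite /preimage/= /affm add0r.
apply: (subset_measure0 _ _ _ (leb_hyperplane c AQi)).
- apply: measurableI; last exact: measurable_ssimp.
  exact: (measurable_preimageT (measurable_affm _ _) (measurable_shull _ _)).
- by apply: measurableI => //; exact: measurable_box.
- move=> x [/shz xz [cx _]]; split => //=.
  by rewrite /c mulmxBl -xz /affm mulmxDl addrAC subrr add0r mulmxA.
Qed.

(** The ball contains a copy of the simplex shrunk towards [x], and [lamM_piece] gives such a copy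
    positive measure. *)
Lemma lamM_ball_gt0 x e : (affm a0 A @` ssimp d) x -> 0 < e -> (0 < lamM a0 A (ball x e))%E.
Proof.
move=> [y sy <-] e0.
pose C := \sum_(j < d) `|row j A|.
have C0 : 0 <= C by exact: sumr_ge0.
(* Any two points of the simplex are at distance at most [C]; this ratio satisfies both [k <= 1] and
   [k * C < e]. *)
pose k := (1 + (C + 1) / e)^-1.
have q0 : 0 <= (C + 1) / e by rewrite divr_ge0 ?addr_ge0// ltW.
have q1 : 0 < 1 + (C + 1) / e by lra.
have k0 : 0 < k by rewrite invr_gt0.
have k1 : k <= 1 by rewrite /k invf_le1//; lra.
have kC : k * C < e.
  rewrite /k mulrC ltr_pdivrMr//.
  rewrite mulrDr mulr1 mulrCA divff ?gt_eqF// mulr1; lra.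
have sub : affm (a0 + (1 - k) *: (rw y *m A)) (k *: A) @` ssimp d `<=`
    (affm a0 A @` ssimp d) `&` ball (affm a0 A y) e.
  move=> _ [w sw <-].
  have [y0 y1] := ssimp_rw sy; have [w0 w1] := ssimp_rw sw; split.
    exists (unrw ((1 - k) *: rw y + k *: rw w)).
      apply: ssimp_unrw.
        move=> i; rewrite !mxE; have := y0 i; have := w0 i; rewrite !mxE.
        by move=> /andP[? _] /andP[? _]; rewrite addr_ge0// mulr_ge0// ?subr_ge0// ltW.
      rewrite [X in X <= _](_ : _ = (1 - k) * (\sum_i rw y 0 i) + k * (\sum_i rw w 0 i)); last first.
        by rewrite !mulr_sumr -big_split; apply: eq_bigr => i _; rewrite !mxE.
      have h1 : (1 - k) * (\sum_i rw y 0 i) <= (1 - k) * 1 by rewrite ler_wpM2l// subr_ge0.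
      have h2 : k * (\sum_i rw w 0 i) <= k * 1 by rewrite ler_wpM2l// ltW.
      lra.
    by rewrite /affm unrwK mulmxDl -!scalemxAl -scalemxAr addrA.
  rewrite -ball_normE /ball_/=.
  rewrite (_ : _ - _ = k *: ((rw y - rw w) *m A)); last first.
    rewrite /affm -scalemxAr mulmxBl; move: (rw y *m A) (rw w *m A) => Y W.
    by apply/rowP => i; rewrite !mxE; ring.
  rewrite normrZ gtr0_norm// (le_lt_trans _ kC)// ler_wpM2l ?(ltW k0)//.
  rewrite mulmx_sum_row; apply: le_trans (ler_norm_sum _ _ _) _; apply: ler_sum => i _.
  rewrite normrZ ler_piMl// !mxE ler_norml.
  by have := y0 i; have := w0 i; rewrite !mxE => /andP[? ?] /andP[? ?]; apply/andP; split; lra.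
have fk : row_free (k *: A).
  have E : (k *: A :=: A)%MS by apply: eqmx_scale; rewrite gt_eqF.
  by rewrite /row_free E.
have [pos _] := lamM_piece fA fk (subset_trans sub (@subIsetl _ _ _)).
apply: lt_le_trans pos _; apply: le_measure; rewrite ?inE.
- apply: measurable_closed; apply: compact_closed; first exact: norm_hausdorff.
  exact: affm_ssimp_compact.
- by apply: measurable_open; exact: ball_open.
- exact: subset_trans sub (@subIsetr _ _ _).
Qed.

End null_and_positive.

Lemma itint_congr {R : realType} n (f g : (nat -> R) -> \bar R) :
  (forall t, (forall i, (i < n)%N -> 0 <= t i <= 1) -> f t = g t) -> itint n f = itint n g.
Proof.
elim: n f g => [|n IH] f g fg /=; first exact: fg.
apply: eq_integral => t; rewrite inE/= in_itv/= => t01.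
apply: IH => x x01; apply: fg => i; rewrite ltnS leq_eqVlt; case: eqVneq => //= _.
exact: x01.
Qed.

Lemma leb_ssimp_lty {R : realType} d : (leb R d (ssimp d) < +oo)%E.
Proof. by rewrite leb_ssimp ltry. Qed.

(** * Comparison with the iterated integrals [lam] and [lamint] *)

Section lam_lamM.
Context {R : realType} {N d : nat} {V : finType} (p : V -> 'rV[R]_N) (s : {set V}).

Local Notation chart := (affm (va p s) (vA p d s)).
Local Notation lamS := (lamM (va p s) (vA p d s)).

Lemma tsum_tot (t : nat -> R) : tsum (tot d t) = \sum_(i < d) t i.
Proof.
rewrite /tsum (reindex_inj rev_ord_inj)/=; apply: eq_bigr => i _.
by rewrite tnth_mktuple rev_ordK.
Qed.

Lemma measurable_tsum_le1 : measurable [set x : d.-tuple R | tsum x <= 1].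
Proof.
rewrite (_ : mkset _ = @tsum R d @^-1` `]-oo, 1]%classic).
  by rewrite -[X in measurable X]setTI; exact: measurable_tsum.
by apply/seteqP; split => x; rewrite /preimage/= in_itv.
Qed.

Lemma lamE D : measurable (D : set (borelT R N)) -> lam p d s D = lamS D.
Proof.
move=> mD; rewrite /lam /lamM; congr (_ * _)%E.
pose X : set (d.-tuple R) := [set x | tsum x <= 1] `&` chart @^-1` D.
have mX : measurable X.
  apply: measurableI; first exact: measurable_tsum_le1.
  exact: (measurable_preimageT (measurable_affm _ _)).
rewrite (_ : (fun t => _) = (fun t => (\1_X (tot d t))%:E)); last first.
  apply/funext => t; rewrite !indicE; congr (_%:R%:E); congr nat_of_bool.
  by apply/idP/idP; rewrite !inE /X/= -tsum_tot sparamE.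
rewrite (@itintE R d _ 1) //; last first.
  by move=> x; rewrite indicE; case: (_ \in _); rewrite ?normr0 ?normr1.
rewrite integral_indic//; last exact: measurable_box.
by congr (leb R d _); rewrite /X/ssimp setIAC setIC setIA [cube d `&` _]setIC -!setIA.
Qed.

(** The mean of [F] over the simplex, as a real number. *)
Definition cint (F : 'rV[R]_N -> R) : R :=
  d`!%:R * (\int[leb R d]_(x in ssimp d) F (chart x))%R.

Lemma chart_integrable (F : borelT R N -> R) M : measurable_fun setT F -> (forall x, `|F x| <= M) ->
  (leb R d).-integrable (ssimp d) (fun x => (F (chart x))%:E).
Proof.
move=> mF FM; apply: (@measurable_bounded_integrable _ _ _ _ (F \o chart)).
- exact: measurable_ssimp.
- exact: leb_ssimp_lty.
- by apply: measurable_funTS; exact: (measurableT_comp mF (measurable_affm _ _)).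
- exists M; split; first by rewrite num_real.
  by move=> y My x _ /=; rewrite (le_trans (FM _))// ltW.
Qed.

(** A function that is continuous on the polyhedron is uncontrolled elsewhere, so it is replaced by
    a bounded Borel function [U] that agrees with it on the simplex. *)
Lemma lamintE (u : 'rV[R]_N -> R) (U : borelT R N -> R) M :
  measurable_fun setT U -> (forall x, `|U x| <= M) ->
  (forall x, (chart @` ssimp d) x -> u x = U x) ->
  lamint p d s u = (cint U)%:E.
Proof.
move=> mU UM uU; rewrite /lamint /cint EFinM; congr (_ * _)%E.
rewrite (@itint_congr _ _ _ (fun t => ((\1_(ssimp d) (tot d t) * U (chart (tot d t)))%:E))); last first.
  move=> t t01.
  have ct : cube d (tot d t) by move=> i; rewrite tnth_mktuple t01// rev_ord_proof.
  have sE : [set t : nat -> R | \sum_(i < d) t i <= 1] t = ssimp d (tot d t).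
    rewrite /ssimp /= tsum_tot propeqE; split => [h|[]//].
    by split.
  rewrite !indicE; have [st|st] := pselect (ssimp d (tot d t)).
    rewrite !mem_set ?sE//= sparamE uU//; by exists (tot d t).
  by rewrite !memNset ?sE// !mul0r.
have m1 : measurable_fun setT (\1_(ssimp d) \* (U \o chart) : d.-tuple R -> R).
  apply: measurable_funM; first by apply: measurable_indic; exact: measurable_ssimp.
  exact: (measurableT_comp mU (measurable_affm _ _)).
rewrite (@itintE R d _ M m1); last first.
  move=> x; rewrite /= indicE; case: (_ \in _); rewrite ?mul1r ?mul0r ?UM//.
  by rewrite normr0 (le_trans _ (UM 0)).
rewrite /Rintegral fineK; last by apply: (integrable_fin_num (@measurable_ssimp R d)); exact: (chart_integrable mU UM).
rewrite [RHS]integral_mkcond [LHS]integral_mkcond; apply: eq_integral => x _.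
rewrite !patchE /= indicE; case: ifPn => xc.
  by case: ifPn => _; rewrite ?mul1r ?mul0r.
rewrite ifF//; apply/negbTE; apply: contraNN xc; rewrite !inE; by case.
Qed.

Lemma cintD (F G : borelT R N -> R) M1 M2 : measurable_fun setT F -> measurable_fun setT G ->
  (forall x, `|F x| <= M1) -> (forall x, `|G x| <= M2) ->
  cint (fun x => F x + G x) = cint F + cint G.
Proof.
move=> mF mG FM GM; rewrite /cint RintegralD ?mulrDr//; first exact: measurable_ssimp.
  exact: (chart_integrable mF FM).
exact: (chart_integrable mG GM).
Qed.

Lemma cint_indic (D : set (borelT R N)) k : measurable D ->
  cint (fun x => k * \1_D x) = k * fine (lamS D).
Proof.
move=> mD; rewrite /cint RintegralZl//; first last.
- apply: (@chart_integrable (\1_D : borelT R N -> R) 1) => //.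
  by move=> x; rewrite indicE; case: (_ \in _); rewrite ?normr0 ?normr1.
- exact: measurable_ssimp.
rewrite mulrCA; congr (k * _).
rewrite /lamM fineM//; last first.
  rewrite ge0_fin_numE ?measure_ge0//; apply: (@le_lt_trans _ _ (leb R d (ssimp d))).
    apply: le_measure; rewrite ?inE//; last exact: measurable_ssimp.
    apply: measurableI; last exact: measurable_ssimp.
    exact: (measurable_preimageT (measurable_affm _ _)).
  exact: leb_ssimp_lty.
congr (_ * _); rewrite /Rintegral.
rewrite (_ : (fun x => _) = (fun x => (\1_(chart @^-1` D) x)%:E)) //.
have mX : measurable (chart @^-1` D) by exact: (measurable_preimageT (measurable_affm _ _) mD).
by rewrite integral_indic//; exact: measurable_ssimp.
Qed.

Lemma cint_approx (F G : borelT R N -> R) M1 M2 e : measurable_fun setT F -> measurable_fun setT G ->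
  (forall x, `|F x| <= M1) -> (forall x, `|G x| <= M2) ->
  (forall x, (chart @` ssimp d) x -> `|F x - G x| <= e) -> `|cint F - cint G| <= e.
Proof.
move=> mF mG FM GM FG; rewrite /cint -mulrBr -RintegralB; last 3 first.
- exact: measurable_ssimp.
- exact: (chart_integrable mF FM).
- exact: (chart_integrable mG GM).
have i1 : (leb R d).-integrable (ssimp d) (fun x => (F (chart x) - G (chart x))%:E).
  apply: (@chart_integrable (fun x => F x - G x) (M1 + M2)).
    exact: measurable_funB.
  by move=> x; rewrite (le_trans (ler_normB _ _))// lerD.
have d0 : (0 : R) < d`!%:R by rewrite ltr0n fact_gt0.
rewrite normrM gtr0_norm// mulrC -ler_pdivlMr//.
apply: le_trans (le_normr_Rintegral _ i1) _; first exact: measurable_ssimp.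
apply: le_trans (@le_Rintegral _ _ _ _ _ _ (fun=> e) _ _ _ _) _.
- exact: measurable_ssimp.
- exact: integrable_norm.
- apply: (@chart_integrable (fun=> e) `|e|) => //.
- by move=> x sx; apply: FG; exists x.
rewrite Rintegral_cst; last exact: measurable_ssimp.
have H : fine (leb R d (ssimp d)) = d`!%:R^-1 by rewrite leb_ssimp.
by rewrite -H.
Qed.

End lam_lamM.

(** * The ergodic theorem *)

Section birkhoff.
Context {R : realType} d (T : measurableType d) (mu : probability T R) (h : T -> T).
Hypothesis mh : measurable_fun setT h.
Hypothesis mu_h : forall A, measurable A -> mu (h @^-1` A) = mu A.
Hypothesis erg : forall A, measurable A -> h @^-1` A = A -> mu A = 0%E \/ mu A = 1%E.

Definition birkhoff_sum (f : T -> R) n x := \sum_(i < n) f (iter i h x).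

Lemma birkhoff_sumS (f : T -> R) n x :
  birkhoff_sum f n.+1 x = f x + birkhoff_sum f n (h x).
Proof.
rewrite /birkhoff_sum big_ord_recl; congr (_ + _).
by apply: eq_bigr => i _; rewrite -iterSr.
Qed.

Variables (f : T -> R) (M : R).
Hypotheses (mf : measurable_fun setT f) (fM : forall x, `|f x| <= M).

Let intg (g : T -> R) : measurable_fun setT g -> (exists K, forall x, `|g x| <= K) ->
  mu.-integrable setT (EFin \o g).
Proof.
move=> mg [K gK]; apply: measurable_bounded_integrable => //.
  by apply: (@le_lt_trans _ _ 1%E); rewrite ?ltry // -(probability_setT mu).
exists K; split; first by rewrite num_real.
by move=> y My x _ /=; rewrite (le_trans (gK _))// ltW.
Qed.

(* [maxsum n] is the maximum of [0] and the first [n] Birkhoff sums. *)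
Fixpoint maxsum n (x : T) : R :=
  if n is n'.+1 then Num.max 0 (f x + maxsum n' (h x)) else 0.

Lemma maxsum_ge0 n x : 0 <= maxsum n x.
Proof. by case: n => //= n; rewrite le_max lexx. Qed.

Lemma maxsum_le n x : maxsum n x <= maxsum n.+1 x.
Proof.
elim: n x => [|n IH] x; first exact: maxsum_ge0.
by rewrite [leLHS]/= [leRHS]/= ge_max le_max lexx/= le_max lerD2l IH orbT.
Qed.

Lemma birkhoff_le_maxsum n x : birkhoff_sum f n x <= maxsum n x.
Proof.
elim: n x => [|n IH] x; first by rewrite /birkhoff_sum big_ord0.
by rewrite birkhoff_sumS /= le_max lerD2l IH orbT.
Qed.

Lemma measurable_maxsum n : measurable_fun setT (maxsum n).
Proof.
elim: n => [|n IH] /=; first exact: measurable_cst.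
apply: measurable_maxr; first exact: measurable_cst.
by apply: measurable_funD => //; exact: measurableT_comp.
Qed.

Lemma maxsum_bounded n x : `|maxsum n x| <= n%:R * M.
Proof.
rewrite ger0_norm ?maxsum_ge0//; elim: n x => [|n IH] x /=; first by rewrite mul0r.
have M0 : 0 <= M by exact: le_trans (fM x).
rewrite ge_max mulr_ge0//= -natr1 mulrDl mul1r addrC lerD//.
exact: le_trans (ler_norm _) (fM x).
Qed.

Let int_h (g : T -> R) : measurable_fun setT g -> (exists K, forall x, `|g x| <= K) ->
  \int[mu]_x (g (h x)) = \int[mu]_x g x.
Proof.
move=> mg bg; rewrite /Rintegral; congr fine.
have := @integral_pushforward _ _ _ _ _ h mh mu setT (EFin \o g).
rewrite preimage_setT => <-//.
- by apply: eq_measure_integral => A mA _; exact: mu_h.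
- exact/measurable_EFinP.
- apply: intg; first exact: measurableT_comp.
  by case: bg => K gK; exists K => x; exact: gK.
Qed.

(** Where [maxsum n.+1] is positive, [f x] equals [maxsum n.+1 x - maxsum n (h x)]. Elsewhere the
    first term vanishes and the second is nonnegative, so the integral is at least that of the
    difference over the whole space, which invariance and monotonicity in [n] make nonnegative. *)
Lemma garsia n : 0 <= \int[mu]_(x in [set x | 0 < maxsum n.+1 x]) f x.
Proof.
set E := mkset _.
have mE : measurable E.
  rewrite (_ : E = maxsum n.+1 @^-1` `]0, +oo[%classic).
    by rewrite -[X in measurable X]setTI; exact: measurable_maxsum.
  by apply/seteqP; split => x; rewrite /preimage/= in_itv/= andbT.
have bM k : exists K, forall x, `|maxsum k x| <= K by exists (k%:R * M); exact: maxsum_bounded.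
have iM k : mu.-integrable setT (EFin \o maxsum k).
  by apply: intg => //; exact: measurable_maxsum.
have iMh k : mu.-integrable setT (EFin \o (maxsum k \o h)).
  apply: intg; last by case: (bM k) => K HK; exists K => x; exact: HK.
  exact: measurableT_comp (measurable_maxsum k) mh.
have sub (g : T -> R) : mu.-integrable setT (EFin \o g) -> mu.-integrable E (EFin \o g).
  by move=> ig; apply: integrableS ig.
rewrite (@eq_Rintegral _ _ _ _ _ (fun x => maxsum n.+1 x - maxsum n (h x))); last first.
  move=> x; rewrite inE/= /E/= lt_max ltxx/= => s0.
  by rewrite max_r ?ltW// addrK.
rewrite RintegralB//; [|exact/sub/iM|exact/sub/iMh].
have -> : \int[mu]_(x in E) maxsum n.+1 x = \int[mu]_x maxsum n.+1 x.
  rewrite Rintegral_mkcond; apply: eq_Rintegral => x _.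
  rewrite patchE; case: ifPn => //; rewrite notin_setE => h0.
  have s0 : maxsum n.+1 x <= 0 by rewrite leNgt; apply/negP.
  by apply/le_anti; rewrite s0 (maxsum_ge0 n.+1).
have le1 : \int[mu]_(x in E) maxsum n (h x) <= \int[mu]_x maxsum n (h x).
  rewrite Rintegral_mkcond; apply: le_Rintegral => //.
  - by have /integrable_mkcond := sub _ (iMh n); rewrite restrict_EFin; apply.
  - exact: iMh.
  - by move=> x _; rewrite patchE; case: ifPn => // _; exact: maxsum_ge0.
rewrite (int_h (measurable_maxsum n) (bM n)) in le1.
have le2 : \int[mu]_x maxsum n x <= \int[mu]_x maxsum n.+1 x.
  apply: le_Rintegral => // x _; exact: maxsum_le.
rewrite subr_ge0; exact: le_trans le2.
Qed.

Lemma birkhoff_bounded_above : \int[mu]_x f x < 0 ->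
  exists Z, [/\ measurable Z, mu Z = 0%E &
    forall x, ~ Z x -> exists C, forall n, birkhoff_sum f n x <= C].
Proof.
move=> f0.
(* [U] is invariant; if it had full measure, Garsia's inequality would give [0 <= \int f] in the limit. *)
pose U := \bigcap_k \bigcup_n [set x | k%:R < maxsum n x].
have mU : measurable U.
  apply: bigcapT_measurable => k; apply: bigcupT_measurable => n.
  rewrite (_ : mkset _ = maxsum n @^-1` `]k%:R, +oo[%classic).
    by rewrite -[X in measurable X]setTI; exact: measurable_maxsum.
  by apply/seteqP; split => x; rewrite /preimage/= in_itv/= andbT.
(* Passing from [x] to [h x] changes the maxima by at most [M], with the index shifted by one, so
   unboundedness is unaffected. *)
have UE : h @^-1` U = U.
  apply/seteqP; split => x Ux k _.
    have [m] : exists m : nat, k%:R + M < m%:R.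
      by exists (Num.truncn (k%:R + M)).+1; exact: truncnS_gt.
    move=> km; have [n _ /= mn] := Ux m I.
    exists n.+1 => //=; rewrite lt_max; apply/orP; right.
    have := fM x; rewrite ler_norml => /andP[h1 _]; lra.
  have [m] : exists m : nat, k%:R + M < m%:R.
    by exists (Num.truncn (k%:R + M)).+1; exact: truncnS_gt.
  move=> km; have [[|n] _ /= mn] := Ux m I.
    by move: mn; rewrite ltNge ler0n.
  exists n => //=; move: mn; rewrite lt_max => /orP[|mn]; first by rewrite ltNge ler0n.
  have := fM x; rewrite ler_norml => /andP[_ h1]; lra.
exists U; split => //; last first.
  move=> x Ux.
  have [k Hk] : exists k : nat, forall n, maxsum n x <= k%:R.
    apply: contrapT => /forallNP H; apply: Ux => k _.
    by have /existsNP[n /negP] := H k; rewrite -ltNge => Hn; exists n.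
  by exists k%:R => n; apply: le_trans (birkhoff_le_maxsum n x) _.
have [//|U1] := erg mU UE.
exfalso; move: f0; apply/negP; rewrite -leNgt.
pose E n := [set x | 0 < maxsum n.+1 x].
have mE n : measurable (E n).
  rewrite (_ : E n = maxsum n.+1 @^-1` `]0, +oo[%classic).
    by rewrite -[X in measurable X]setTI; exact: measurable_maxsum.
  by apply/seteqP; split => x; rewrite /preimage/= in_itv/= andbT.
have UsubE : U `<=` \bigcup_n E n.
  move=> x Ux; have [[|n] _ /= mn] := Ux 0%N I; first by rewrite ltxx in mn.
  by exists n.
have E1 : (mu (E n) @[n --> \oo] --> (1%E : \bar R)).
  have <- : mu (\bigcup_n E n) = 1%E.
    have mUE : measurable (\bigcup_n E n) by exact: bigcupT_measurable.
    apply: le_anti; apply/andP; split; first exact: probability_le1.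
    by rewrite -[leLHS]U1; apply: le_measure; rewrite ?inE.
  apply: nondecreasing_cvg_mu => //; first exact: bigcupT_measurable.
  apply/nondecreasing_seqP => n; apply/subsetPset => x /= /lt_le_trans; apply.
  exact: maxsum_le.
have iff : mu.-integrable setT (EFin \o f) by apply: intg => //; exists M.
(* Garsia's inequality handles [E n]; on the complement [f] is at least [- M], and the measure of
   the complement tends to 0. *)
have key n : - (M * (1 - fine (mu (E n)))) <= \int[mu]_x f x.
  have mEC : measurable (~` E n) by exact: measurableC.
  rewrite -(setUv (E n)) Rintegral_setU//; last 2 first.
  - by rewrite setUv.
  - by rewrite disj_set2E setICr.
  rewrite -[leLHS]add0r lerD ?garsia//.
  have -> : 1 - fine (mu (E n)) = fine (mu (~` E n)).
    by rewrite probability_setC// fineB ?fin_num_measure.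
  rewrite -mulNr -Rintegral_cst//; apply: le_Rintegral => //.
  - by apply: (@integrableS _ _ _ mu setT) => //; apply: (intg (measurable_cst (- M))); exists `|M| => x; rewrite normrN.
  - exact: (@integrableS _ _ _ mu setT).
  - by move=> x _; have := fM x; rewrite ler_norml => /andP[].
have lim : (- (M * (1 - fine (mu (E n)))) @[n --> \oo] --> (0 : R)).
  rewrite -oppr0 -(mulr0 M) -(subrr 1).
  apply: cvgN; apply: cvgMr; apply: cvgB; first exact: cvg_cst.
  by have /fine_cvgP[] := E1.
rewrite -(cvg_lim _ lim)//; apply: limr_le; first exact: cvgP lim.
by apply: nearW => n; exact: key.
Qed.
End birkhoff.

Lemma measure0_bigcup {R : realType} d (T : measurableType d) (mu : {measure set T -> \bar R})
  (F : nat -> set T) : (forall k, measurable (F k)) -> (forall k, mu (F k) = 0%E) ->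
  mu (\bigcup_k F k) = 0%E.
Proof.
move=> mF F0; apply/negligibleP; first exact: bigcupT_measurable.
by apply: negligible_bigcup => k; apply/negligibleP; [exact: mF|exact: F0].
Qed.

Section birkhoff_theorem.
Context {R : realType} d (T : measurableType d) (mu : probability T R) (h : T -> T).
Hypothesis mh : measurable_fun setT h.
Hypothesis mu_h : forall A, measurable A -> mu (h @^-1` A) = mu A.
Hypothesis erg : forall A, measurable A -> h @^-1` A = A -> mu A = 0%E \/ mu A = 1%E.

Lemma birkhoff_sumB_cst (f : T -> R) c n x :
  birkhoff_sum h (fun x => f x - c) n x = birkhoff_sum h f n x - n%:R * c.
Proof. by rewrite /birkhoff_sum sumrB sumr_const card_ord mulr_natl. Qed.

Lemma birkhoff_sumN (f : T -> R) n x :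
  birkhoff_sum h (fun x => - f x) n x = - birkhoff_sum h f n x.
Proof. by rewrite /birkhoff_sum sumrN. Qed.

(** Subtracting slightly more than the mean makes the integral negative. The resulting sums are
    almost everywhere bounded above, a bound that disappears after division by [n]; the excesses
    [1/(k+1)] contribute countably many null sets. *)
Lemma birkhoff_limsup (f : T -> R) M : measurable_fun setT f -> (forall x, `|f x| <= M) ->
  exists Z, [/\ measurable Z, mu Z = 0%E &
    forall x, ~ Z x -> forall e, 0 < e ->
      \forall n \near \oo, n%:R^-1 * birkhoff_sum h f n x <= \int[mu]_x f x + e].
Proof.
move=> mf fM; set I := Rintegral _ _ _.
have H k : exists Z, [/\ measurable Z, mu Z = 0%E &
    forall x, ~ Z x -> exists C, forall n, birkhoff_sum h (fun x => f x - (I + k.+1%:R^-1)) n x <= C].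
  apply: (@birkhoff_bounded_above _ _ _ _ _ mh mu_h erg _ (M + `|I + k.+1%:R^-1|)).
  - exact: measurable_funB.
  - by move=> x; rewrite (le_trans (ler_normB _ _))// lerD.
  have iff : mu.-integrable setT (EFin \o f).
    apply: measurable_bounded_integrable => //.
      by apply: (@le_lt_trans _ _ 1%E); rewrite ?ltry // -(probability_setT mu).
    exists M; split; first by rewrite num_real.
    by move=> y My x _ /=; rewrite (le_trans (fM _))// ltW.
  have ic c : mu.-integrable setT (EFin \o (fun=> c) : T -> \bar R).
    apply: measurable_bounded_integrable => //.
      by apply: (@le_lt_trans _ _ 1%E); rewrite ?ltry // -(probability_setT mu).
    exists `|c|; split; first by rewrite num_real.
    by move=> y My x _ /=; rewrite ltW.
  have m1 : fine (mu setT) = 1 by rewrite probability_setT.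
  rewrite RintegralB// -/I Rintegral_cst// [X in _ * X](_ : _ = 1); last exact: m1.
  by rewrite mulr1 opprD addNKr oppr_lt0 invr_gt0.
have [Z HZ] := choice H.
exists (\bigcup_k Z k); split.
- by apply: bigcupT_measurable => k; have [] := HZ k.
- by apply: measure0_bigcup => k; have [] := HZ k.
- move=> x Zx e e0.
  have [k ke] : exists k, (k.+1%:R^-1 : R) < e / 2.
    have [k _ /(_ k (leqnn k)) Hk] := near_infty_natSinv_lt (PosNum (divr_gt0 e0 (ltr0n _ 2))).
    by exists k.
  have [_ _ /(_ x)[|C HC]] := HZ k; first by apply: contra_not Zx => Zk; exists k.
  near=> n.
  have n0 : (0 : R) < n%:R by rewrite ltr0n; near: n; exists 1%N.
  have := HC n; rewrite birkhoff_sumB_cst lerBlDr => Hn.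
  rewrite mulrC ler_pdivrMr//; apply: le_trans Hn _.
  have Cn : C <= e / 2 * n%:R.
    rewrite mulrC -ler_pdivrMr ?divr_gt0//.
    by near: n; exact: nbhs_infty_ger.
  have : n%:R * k.+1%:R^-1 <= n%:R * (e / 2) by rewrite ler_wpM2l// ltW.
  by move: (k.+1%:R^-1 : R) (n%:R : R) Cn => q m Cn mq; nra.
Unshelve. all: by end_near. Qed.

Lemma birkhoff_ergodic (f : T -> R) M : measurable_fun setT f -> (forall x, `|f x| <= M) ->
  exists Z, [/\ measurable Z, mu Z = 0%E &
    forall x, ~ Z x -> (n%:R^-1 * birkhoff_sum h f n x) @[n --> \oo] --> \int[mu]_x f x].
Proof.
move=> mf fM.
have [Z1 [mZ1 Z10 H1]] := birkhoff_limsup mf fM.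
have [|x|Z2 [mZ2 Z20 H2]] := @birkhoff_limsup (fun x => - f x) M; first exact: measurable_funN.
  by rewrite normrN.
exists (Z1 `|` Z2); split; first exact: measurableU.
  by apply/negligibleP; [exact: measurableU|apply: negligibleU; apply/negligibleP].
move=> x /not_orP[Zx1 Zx2]; apply/cvgrPdist_le => e e0.
have NI : \int[mu]_x (- f x) = - \int[mu]_x f x.
  under eq_Rintegral do rewrite -mulN1r.
  rewrite RintegralZl// ?mulN1r//.
  apply: measurable_bounded_integrable => //.
    by apply: (@le_lt_trans _ _ 1%E); rewrite ?ltry // -(probability_setT mu).
  exists M; split; first by rewrite num_real.
  by move=> y My z _ /=; rewrite (le_trans (fM _))// ltW.
near=> n.
have h1 : n%:R^-1 * birkhoff_sum h f n x <= \int[mu]_x f x + e by near: n; exact: H1.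
have h2 : n%:R^-1 * birkhoff_sum h (fun x => - f x) n x <= \int[mu]_x (- f x) + e.
  by near: n; exact: H2.
move: h2; rewrite NI birkhoff_sumN mulrN => h2.
rewrite ler_norml; apply/andP; split; lra.
Unshelve. all: by end_near. Qed.
End birkhoff_theorem.

(** * Simplicial complexes and inverse branches *)

Section complexes.
Context {R : realType} {N : nat} {V V' : finType}.

Lemma shull_sub (p : V -> 'rV[R]_N) (s t : {set V}) : s \subset t -> shull p s `<=` shull p t.
Proof.
move=> st x [b [b0 bs b1 ->]]; exists b; split => // v vt; apply: bs.
by apply: contraNN vt => /(fintype.subsetP st).
Qed.

Lemma shull_set0 (p : V -> 'rV[R]_N) : shull p finset.set0 = set0.
Proof.
apply/seteqP; split => // x [b [_ bs b1 _]].
by move: b1; rewrite big1 => [/eqP|v _]; rewrite ?bs ?inE// eq_sym oner_eq0.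
Qed.

Lemma shull_vertex (p : V -> 'rV[R]_N) (s : {set V}) v : v \in s -> shull p s (p v).
Proof.
move=> vs; exists (fun w => (w == v)%:R); split.
- by move=> w; rewrite ler0n.
- by move=> w ws; case: eqVneq => // wv; rewrite wv vs in ws.
- by rewrite (bigD1 v)//= eqxx big1 ?addr0// => w /negbTE ->.
- by rewrite (bigD1 v)//= eqxx scale1r big1 ?addr0// => w /negbTE ->; rewrite scale0r.
Qed.

Lemma aff_indep_uniq (p : V -> 'rV[R]_N) (s : {set V}) (b c : V -> R) : aff_indep p s ->
  (forall v, v \notin s -> b v = 0) -> (forall v, v \notin s -> c v = 0) ->
  \sum_v b v = \sum_v c v -> \sum_v b v *: p v = \sum_v c v *: p v -> b = c.
Proof.
move=> ind bs cs sbc pbc; apply/funext => v; apply/eqP; rewrite -subr_eq0; apply/eqP.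
apply: (ind (fun v => b v - c v)) => [w ws||].
- by rewrite bs// cs// subrr.
- by rewrite sumrB sbc subrr.
- by under eq_bigr do rewrite scalerBl; rewrite sumrB pbc subrr.
Qed.

(** A point of two simplices also has coordinates on their common face, and affine independence
    identifies these with both given ones. *)
Lemma bary_uniq (p : V -> 'rV[R]_N) (S : {set {set V}}) x b c :
  gcomplex p S -> bary p S x b -> bary p S x c -> b = c.
Proof.
move=> [_ _ _ ind inter] [s sS [b0 bs b1 bx]] [t tS [c0 ct c1 cx]].
have : (shull p s `&` shull p t) x by split; [exists b|exists c].
rewrite inter// => -[e [e0 est e1 ex]].
have be : b = e.
  apply: (aff_indep_uniq (ind _ sS)) => //; rewrite ?b1 ?e1 -?bx -?ex//.
  by move=> v vs; apply: est; rewrite inE (negbTE vs).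
rewrite be; symmetry.
apply: (aff_indep_uniq (ind _ tS)) => //; rewrite ?c1 ?e1 -?cx -?ex//.
by move=> v vs; apply: est; rewrite inE (negbTE vs) andbF.
Qed.

Lemma shull_comp (p : V -> 'rV[R]_N) (gamma : V' -> V) (s : {set V'}) :
  shull (p \o gamma) s `<=` shull p (gamma @: s).
Proof.
move=> x [b [b0 bs b1 ->]].
exists (fun w => \sum_(v | gamma v == w) b v); split.
- by move=> w; exact: sumr_ge0.
- move=> w ws; apply: big1 => v /eqP vw; apply: bs.
  by apply: contraNN ws => vs; rewrite -vw imset_f.
- by rewrite -b1 [RHS](partition_big gamma predT).
- rewrite (partition_big gamma predT)//=; apply: eq_bigr => w _.
  by rewrite scaler_suml; apply: eq_bigr => v /eqP ->.
Qed.

Lemma sum_inj_imset (U : zmodType) (gamma : V' -> V) (s : {set V'}) (F : V -> U) :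
  {in s &, injective gamma} -> (forall w, w \notin gamma @: s -> F w = 0) ->
  \sum_w F w = \sum_v (if v \in s then F (gamma v) else 0).
Proof.
move=> inj F0; rewrite -big_mkcond/= [LHS](bigID (mem (gamma @: s)))/= [X in _ + X]big1 ?addr0; last exact: F0.
by rewrite big_imset.
Qed.

Lemma shull_comp_inj (p : V -> 'rV[R]_N) (gamma : V' -> V) (s : {set V'}) :
  {in s &, injective gamma} -> shull (p \o gamma) s = shull p (gamma @: s).
Proof.
move=> inj; apply/seteqP; split; first exact: shull_comp.
move=> x [b [b0 bs b1 ->]].
exists (fun v => if v \in s then b (gamma v) else 0); split.
- by move=> v; case: ifP.
- by move=> v /negbTE ->.
- by rewrite -b1 (sum_inj_imset inj bs).
- rewrite (sum_inj_imset (F := fun w => b w *: p w) inj); last by move=> w /bs ->; rewrite scale0r.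
  by apply: eq_bigr => v _; case: ifP => //; rewrite scale0r.
Qed.

Lemma aff_indep_comp (p : V -> 'rV[R]_N) (gamma : V' -> V) (s : {set V'}) :
  {in s &, injective gamma} -> aff_indep p (gamma @: s) -> aff_indep (p \o gamma) s.
Proof.
move=> inj ind c cs c0 cp v.
have [vs|vs] := boolP (v \in s); last exact: cs.
have <- : \sum_(u | gamma u == gamma v) c u = c v.
  rewrite (bigD1 v)//= big1 ?addr0// => u /andP[/eqP uv nuv]; apply: cs.
  by apply: contraNN nuv => us; apply/eqP; apply: inj.
apply: (ind (fun w => \sum_(u | gamma u == w) c u)).
- move=> w ws; apply: big1 => u /eqP uw; apply: cs.
  by apply: contraNN ws => us; rewrite -uw imset_f.
- by rewrite -[RHS]c0 [RHS](partition_big gamma predT).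
- rewrite -[RHS]cp [RHS](partition_big gamma predT)//=; apply: eq_bigr => w _.
  by rewrite scaler_suml; apply: eq_bigr => u /eqP <-.
Qed.
End complexes.

(* [affext q r s] is an affine map of the whole space sending the simplex [s]
   with vertices [q] to the one with vertices [r]. *)
Section affext.
Context {R : realType} {N d : nat} {V : finType}.
Implicit Types (q r : V -> 'rV[R]_N) (s : {set V}).

Definition affextM q r s : 'M[R]_N := pinvmx (vA q d s) *m vA r d s.

Definition affext q r s (x : 'rV[R]_N) : 'rV[R]_N := va r s + (x - va q s) *m affextM q r s.

Lemma affextE q r s (b : V -> R) : #|s| = d.+1 -> aff_indep q s ->
  (forall v, 0 <= b v) -> (forall v, v \notin s -> b v = 0) -> \sum_v b v = 1 ->
  affext q r s (\sum_v b v *: q v) = \sum_v b v *: r v.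
Proof.
move=> sd ind b0 bs b1; have [y sy yE] := @chart_of_coef R N _ _ _ _ sd b0 bs b1.
rewrite !yE /affext /affm addrAC subrr add0r /affextM mulmxA; congr (_ + _ *m _).
by rewrite mulmxKp// vA_free.
Qed.

Lemma affext_affm q r s m (a : 'rV[R]_N) (A : 'M[R]_(m, N)) x :
  affext q r s (affm a A x) = affm (affext q r s a) (A *m affextM q r s) x.
Proof. by rewrite /affext /affm mulmxA -[RHS]addrA -mulmxDl addrAC. Qed.

Lemma affext_continuous q r s : continuous (affext q r s).
Proof.
rewrite (_ : affext q r s = fun x : 'rV[R]_N =>
    va r s - va q s *m affextM q r s + \sum_i x 0 i *: row i (affextM q r s)).
  by move=> x; apply: (continuousD (@cst_continuous _ _ _ _) (@continuous_sum_scale _ _ _ _ _)).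
by apply/funext => x; rewrite /affext mulmxBl -mulmx_sum_row addrAC addrA.
Qed.

Lemma affext_image q r s : #|s| = d.+1 -> aff_indep q s ->
  affext q r s @` shull q s = shull r s.
Proof.
move=> sd ind; apply/seteqP; split => x.
  by move=> [_ [b [b0 bs b1 ->]] <-]; exists b; split => //; exact: affextE.
move=> [b [b0 bs b1 ->]]; exists (\sum_v b v *: q v); last exact: affextE.
by exists b.
Qed.

End affext.
Arguments affext {R N} d {V} q r s x.
Arguments affextM {R N} d {V} q r s.

Section finite_unions.
Context {R : realType} d (T : measurableType d) (mu : probability T R) (I : finType)
  (F : I -> set T).
Hypothesis mF : forall i, measurable (F i).

Lemma measure0_bigsetU (P : pred I) : (forall i, P i -> mu (F i) = 0%E) ->
  mu (\big[setU/set0]_(i | P i) F i) = 0%E.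
Proof.
move=> F0.
suff [] : measurable (\big[setU/set0]_(i | P i) F i) /\ mu (\big[setU/set0]_(i | P i) F i) = 0%E by [].
elim/big_ind : _ => [|A B [mA A0] [mB B0]|i Pi]; first by split => //; exact: measure0.
  split; first exact: measurableU.
  by rewrite measureU0.
by split => //; exact: F0.
Qed.

(** The set [D] is arbitrary because the inductive hypothesis is also used with [F i], to see that
    [F i] meets the remaining union in a null set. *)
Lemma measure_ae_bigsetU (r : seq I) (D : set T) : uniq r -> measurable D ->
  {in r &, forall i j, i != j -> mu (F i `&` F j) = 0%E} ->
  mu (D `&` \big[setU/set0]_(i <- r) F i) = (\sum_(i <- r) mu (D `&` F i))%E.
Proof.
elim: r D => [|i r IH] D; first by rewrite !big_nil setI0 measure0.
move=> /= /andP[ir ur] mD null; rewrite !big_cons.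
have mU : measurable (\big[setU/set0]_(j <- r) F j) by exact: bigsetU_measurable.
have mDi : measurable (D `&` F i) by exact: measurableI.
have mDU : measurable (D `&` \big[setU/set0]_(j <- r) F j) by exact: measurableI.
have IH' : {in r &, forall i j, i != j -> mu (F i `&` F j) = 0%E}.
  by move=> j k jr kr; apply: null; rewrite inE ?jr ?kr orbT.
rewrite -(IH D)// setIUr.
have null0 : mu (D `&` F i `&` (D `&` \big[setU/set0]_(j <- r) F j)) = 0%E.
  apply: (@subset_measure0 _ _ _ mu _ (F i `&` \big[setU/set0]_(j <- r) F j)).
  - exact: measurableI.
  - exact: measurableI.
  - by move=> x [[_ ?] [_ ?]].
  apply: etrans (IH _ ur (mF i) IH') _; apply: big1_seq => j /= jr; apply: null; rewrite ?inE ?eqxx ?jr ?orbT//.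
  by apply: contraNneq ir => ->.
rewrite measureUfinr//; first by rewrite [X in (_ - X)%E]null0 sube0.
by apply: le_lt_trans (probability_le1 mu _) _; rewrite ?ltry.
Qed.
End finite_unions.

Record simplicial_system (R : realType) (N d : nat) (V V' : finType)
    (p : V -> 'rV[R]_N) (S : {set {set V}}) (p' : V' -> 'rV[R]_N) (S' : {set {set V'}})
    (gamma : V' -> V) (g : 'rV[R]_N -> 'rV[R]_N) : Prop := SimplicialSystem {
  sysK : gcomplex p S;
  sysK' : gcomplex p' S';
  sys_dim : everywhere_dim S d;
  sys_sub : proper_subdivision p S p' S';
  sys_gamma : simplicial_nondeg S S' gamma;
  sys_g : pl_map_of p p' S' gamma (polyh p S) g }.

(** * Inverse branches and self-similarity of the simplex measures *)

Section pieces.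
Context {R : realType} {N d : nat} {V V' : finType}.
Context {p : V -> 'rV[R]_N} {S : {set {set V}}} {p' : V' -> 'rV[R]_N} {S' : {set {set V'}}}.
Context {gamma : V' -> V} {g : 'rV[R]_N -> 'rV[R]_N}.
Hypothesis sys : simplicial_system d p S p' S' gamma g.
Local Notation X := (polyh p S).

Definition lamS (s : {set V}) := lamM (va p s) (vA p d s).
(** The inverse branch of [g] with values in [s'], extended to an affine map of the whole space so
    that preimages under it are Borel. *)
Definition psi (s' : {set V'}) := affext d (p \o gamma) p' s'.
Definition inJ (s : {set V}) (s' : {set V'}) := `[< shull p' s' `<=` shull p s >].
Definition nu (s : {set V}) (s' : {set V'}) : R := fine (lam p d s (shull p' s')).

Lemma inJP s s' : reflect (shull p' s' `<=` shull p s) (inJ s s').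
Proof. exact: asboolP. Qed.

Lemma dsimpP s : s \in dsimp S d -> [/\ s \in S, #|s| = d.+1 & aff_indep p s].
Proof.
rewrite inE => /andP[sS /eqP sd]; split => //.
by have [_ _ _ ind _] := sysK sys; exact: ind.
Qed.

Lemma dsimpP' s' : s' \in dsimp S' d -> [/\ s' \in S', #|s'| = d.+1 & aff_indep p' s'].
Proof.
rewrite inE => /andP[sS /eqP sd]; split => //.
by have [_ _ _ ind _] := sysK' sys; exact: ind.
Qed.

Lemma dsimp_gamma s' : s' \in dsimp S' d -> gamma @: s' \in dsimp S d.
Proof.
move=> /dsimpP'[sS' sd _]; have [gS cg] := sys_gamma sys sS'.
by rewrite inE gS cg sd eqxx.
Qed.

Lemma gamma_inj s' : s' \in S' -> {in s' &, injective gamma}.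
Proof. by move=> /(sys_gamma sys) [_ /eqP/imset_injP]. Qed.

Lemma shull_pgamma s' : s' \in S' -> shull (p \o gamma) s' = shull p (gamma @: s').
Proof. by move=> /gamma_inj; exact: shull_comp_inj. Qed.

Lemma pgamma_indep s' : s' \in dsimp S' d -> aff_indep (p \o gamma) s'.
Proof.
move=> sD; have [sS' _ _] := dsimpP' sD; have [_ _ ind] := dsimpP (dsimp_gamma sD).
by apply: aff_indep_comp => //; exact: gamma_inj.
Qed.

Lemma shull_subX s : s \in S -> shull p s `<=` X.
Proof. by move=> sS x sx; exists s. Qed.

Lemma shull_subX' s' : s' \in S' -> shull p' s' `<=` X.
Proof.
have [h _ _] := sys_sub sys; move=> /h[s sS ss']; exact: subset_trans (shull_subX sS).
Qed.

Lemma X_dsimp x : X x -> exists2 s, s \in dsimp S d & shull p s x.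
Proof.
move=> [s sS sx]; have [_ [t tS /andP[st td]]] := sys_dim sys sS.
by exists t; [rewrite inE tS td|exact: (shull_sub st)].
Qed.

Lemma X_simp' x : X x -> exists2 s', s' \in S' & shull p' s' x.
Proof.
move=> [s sS sx]; have [_ h _] := sys_sub sys; move: sx; rewrite h// => -[s' [? _ ?]].
by exists s'.
Qed.

Lemma g_coef s' b : s' \in S' -> (forall v, 0 <= b v) -> (forall v, v \notin s' -> b v = 0) ->
  \sum_v b v = 1 -> g (\sum_v b v *: p' v) = \sum_v b v *: p (gamma v).
Proof.
move=> sS' b0 bs b1; apply: (sys_g sys); last by exists s'.
by apply: (shull_subX' sS'); exists b.
Qed.

Lemma g_shull s' x : s' \in S' -> shull p' s' x -> shull p (gamma @: s') (g x).
Proof.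
move=> sS' [b [b0 bs b1 ->]]; rewrite (g_coef sS')// -shull_pgamma//.
by exists b.
Qed.

Lemma g_X x : X x -> X (g x).
Proof.
move=> /X_simp'[s' sS' sx]; exists (gamma @: s'); last exact: g_shull.
by have [] := sys_gamma sys sS'.
Qed.

Lemma iter_g_X n x : X x -> X (iter n g x).
Proof. by move=> Xx; elim: n => //= n; exact: g_X. Qed.

Lemma psi_image s' : s' \in dsimp S' d -> psi s' @` shull p (gamma @: s') = shull p' s'.
Proof.
move=> sD; have [sS' sd _] := dsimpP' sD.
by rewrite -shull_pgamma//; apply: affext_image => //; exact: pgamma_indep.
Qed.

Lemma psi_shull s' y : s' \in dsimp S' d -> shull p (gamma @: s') y -> shull p' s' (psi s' y).
Proof. by move=> sD ty; rewrite -psi_image//; exists y. Qed.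

Lemma g_psi s' y : s' \in dsimp S' d -> shull p (gamma @: s') y -> g (psi s' y) = y.
Proof.
move=> sD; have [sS' sd _] := dsimpP' sD; rewrite -shull_pgamma// => -[b [b0 bs b1 ->]].
by rewrite /psi affextE ?(g_coef sS')//; exact: pgamma_indep.
Qed.

Lemma measurable_psi s' : measurable_fun setT (psi s' : borelT R N -> borelT R N).
Proof. by apply: measurable_fun_cont; exact: affext_continuous. Qed.

Lemma lamS_free s : s \in dsimp S d -> row_free (vA p d s).
Proof. by move=> /dsimpP[_ sd ind]; exact: vA_free. Qed.

Lemma shull_dsimp s : s \in dsimp S d -> shull p s = affm (va p s) (vA p d s) @` ssimp d.
Proof. by move=> /dsimpP[_ sd ind]; exact: shull_chart. Qed.

Lemma lamS_piece s s' : s \in dsimp S d -> s' \in dsimp S' d -> inJ s s' ->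
  (0 < lamS s (shull p' s'))%E /\
  forall D : set 'rV[R]_N, measurable (D : set (borelT R N)) ->
    lamS s (D `&` shull p' s') = (lamS s (shull p' s') * lamS (gamma @: s') (psi s' @^-1` D))%E.
Proof.
move=> sD sD' /inJP ss'; have [sS' sd' ind'] := dsimpP' sD'.
have tD := dsimp_gamma sD'.
pose b := psi s' (va p (gamma @: s')).
pose B := vA p d (gamma @: s') *m affextM d (p \o gamma) p' s'.
have bE y : affm b B y = psi s' (affm (va p (gamma @: s')) (vA p d (gamma @: s')) y).
  by rewrite /psi affext_affm.
have imE : affm b B @` ssimp d = shull p' s'.
  rewrite -psi_image// (shull_dsimp tD) image_comp; congr (_ @` _).
  by apply/funext.
have fB : row_free B.
  (* The enumerations of [s'] and of [gamma @: s'] need not correspond, so the two charts of the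
     image simplex are related through a matrix [T]. *)
  have [T TE] : exists T, vA p d (gamma @: s') = T *m vA (p \o gamma) d s'.
    apply/submxP; apply: (@affm_sub _ _ _ (va (p \o gamma) s') _ (va p (gamma @: s'))).
    by rewrite -shull_dsimp// -shull_chart// shull_pgamma.
  have BE : B = T *m vA p' d s'.
    by rewrite /B TE /affextM mulmxA mulmxKp// vA_free//; exact: pgamma_indep.
  have /row_freeP[C CE] := vA_free sd' ind'.
  have /row_freeP[C' CE'] := lamS_free tD.
  apply: inj_row_free => v; rewrite BE mulmxA => /(congr1 (mulmx^~ C)).
  rewrite -mulmxA CE mulmx1 mul0mx => vT0.
  by rewrite -[v]mulmx1 -CE' mulmxA TE mulmxA vT0 !mul0mx.
have sub : affm b B @` ssimp d `<=` affm (va p s) (vA p d s) @` ssimp d.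
  by rewrite imE -shull_dsimp.
have [pos H] := lamM_piece (lamS_free sD) fB sub.
rewrite imE in pos H; split => // D mD; rewrite [LHS]H//; congr (_ * _)%E.
by rewrite /lamS /lamM; congr (_ * leb _ _ (_ `&` _))%E; apply/seteqP; split => y /=; rewrite /preimage/= bE.
Qed.

Lemma lamS_out s D : s \in dsimp S d -> D `&` shull p s = set0 -> lamS s D = 0%E.
Proof. by move=> sD; rewrite shull_dsimp//; exact: lamM_out. Qed.

HB.instance Definition _ s := Probability.on (lamS s).

Lemma lamS_simplex (W : finType) (q : W -> 'rV[R]_N) (w : {set W}) s :
  (#|w| <= d)%N -> s \in dsimp S d -> lamS s (shull q w) = 0%E.
Proof. by move=> wd sD; apply: lamM_lowdim => //; exact: lamS_free. Qed.

Lemma lamS_ball_gt0 s x e : s \in dsimp S d -> shull p s x -> 0 < e -> (0 < lamS s (ball x e))%E.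
Proof.
move=> sD sx e0; apply: lamM_ball_gt0 => //; first exact: lamS_free.
by rewrite -shull_dsimp.
Qed.

(** The subdivision only provides simplices of some dimension. If no d-dimensional one contained
    [x], a whole ball would avoid them all; its part in [s] would be covered by finitely many null
    simplices, although balls around points of [s] have positive measure. *)
Lemma dsimp_cover s x : s \in dsimp S d -> shull p s x ->
  exists s', [/\ s' \in dsimp S' d, inJ s s' & shull p' s' x].
Proof.
move=> sD sx; apply: contrapT => /forallNP H.
pose U := \bigcup_(s' in [set s' | s' \in dsimp S' d /\ inJ s s']) shull p' s'.
have cU : closed U.
  by apply: closed_bigcup => [|s' _]; [exact: finite_finset|exact: shull_closed].
have Ux : (~` U) x by move=> [s' [sD' ss'] sx']; apply: (H s').
have [e /= e0 xe] : exists2 e : R, 0 < e & ball x e `<=` ~` U.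
  have : nbhs x (~` U) by apply: open_nbhs_nbhs; split => //; rewrite openC.
  by rewrite -nbhs_ballE => -[e ? ?]; exists e.
have := lamS_ball_gt0 sD sx e0; rewrite lt0e => /andP[/eqP + _]; apply.
pose P s' := (s' \in S') && (#|s'| <= d)%N.
have mL : measurable (\big[setU/set0]_(s' | P s') shull p' s' : set (borelT R N)).
  by apply: bigsetU_measurable => s' _; exact: measurable_shull.
have mC : measurable (~` shull p s : set (borelT R N)).
  by apply: measurableC; exact: measurable_shull.
apply: (@subset_measure0 _ _ _ (lamS s) _ (\big[setU/set0]_(s' | P s') shull p' s' `|` ~` shull p s)).
- by apply: measurable_open; exact: ball_open.
- exact: measurableU.
- move=> y xy; have [sy|] := pselect (shull p s y); last by right.
  left; have [sS _ _] := dsimpP sD.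
  have [_ h _] := sys_sub sys; move: (sy); rewrite h// => -[s' [sS' ss' sy']].
  rewrite -(bigcup_pred P); exists s' => //=; rewrite unfold_in /P sS' /=.
  (* Nondegeneracy bounds the dimension of [s'] by that of a simplex of [S], so [s'] is either of
     dimension [d] or among the null ones. *)
  have [gS cg] := sys_gamma sys sS'.
  have [le _] := sys_dim sys gS; rewrite cg leq_eqVlt ltnS in le.
  case/orP: le => // sd'; exfalso; apply: (xe y xy); exists s' => //=.
  by rewrite inE sS' sd'; split => //; apply/inJP.
- apply: etrans (@measureU0 _ _ _ (lamS s) _ _ mL mC _) _.
    by apply: lamS_out => //; exact: setICl.
  by apply: measure0_bigsetU => [s'|s' /andP[_ ?]]; [exact: measurable_shull|exact: lamS_simplex].
Qed.

Lemma lamS_fin s D : measurable (D : set (borelT R N)) -> lamS s D \is a fin_num.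
Proof. by move=> mD; exact: fin_num_measure. Qed.

Lemma nuE s s' : lamS s (shull p' s') = (nu s s')%:E.
Proof.
rewrite /nu lamE; last exact: measurable_shull.
by rewrite fineK//; apply: lamS_fin; exact: measurable_shull.
Qed.

Lemma nu_gt0 s s' : s \in dsimp S d -> s' \in dsimp S' d -> inJ s s' -> 0 < nu s s'.
Proof. by move=> sD sD' ss'; have [] := lamS_piece sD sD' ss'; rewrite nuE lte_fin. Qed.

Lemma lamS_selfsim s (D : set 'rV[R]_N) : s \in dsimp S d -> measurable (D : set (borelT R N)) ->
  lamS s D = (\sum_(s' in dsimp S' d | inJ s s') (nu s s')%:E * lamS (gamma @: s') (psi s' @^-1` D))%E.
Proof.
move=> sD mD.
have Es : \big[setU/set0]_(s' in dsimp S' d | inJ s s') shull p' s' = shull p s.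
  rewrite -(bigcup_pred (fun s' => (s' \in dsimp S' d) && inJ s s')).
  apply/seteqP; split => x; first by move=> [s' /= /andP[_ /inJP ss'] sx]; exact: ss'.
  move=> sx; have [s' [sD' ss' sx']] := dsimp_cover sD sx.
  by exists s' => //=; rewrite unfold_in sD' ss'.
have ms : measurable (shull p s : set (borelT R N)) by exact: measurable_shull.
have mDs : measurable (D `&` shull p s : set (borelT R N)) by exact: measurableI.
have -> : lamS s D = lamS s (D `&` shull p s).
  rewrite (measureDI (lamS s) mD ms) -[RHS]add0e; congr (_ + _)%E.
  by apply: lamS_out => //; rewrite setDE -setIA setICl setI0.
rewrite -{1}Es -big_filter measure_ae_bigsetU//.
- rewrite big_filter; apply: eq_bigr => s' /andP[sD' ss'].
  by have [_ H] := lamS_piece sD sD' ss'; rewrite [LHS]H// nuE.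
- by move=> s'; exact: measurable_shull.
- by apply: filter_uniq; exact: index_enum_uniq.
(* Distinct d-simplices of the subdivision share at most a proper face, which is null. *)
- move=> s1 s2; rewrite !mem_filter => /andP[/andP[sD1 _] _] /andP[/andP[sD2 _] _] s12.
  have [sS1 c1 _] := dsimpP' sD1; have [sS2 c2 _] := dsimpP' sD2.
  have [_ _ _ _ inter] := sysK' sys; rewrite inter//; apply: lamS_simplex => //.
  rewrite -ltnS -c1; apply: proper_card; rewrite finset.properEneq finset.subsetIl andbT.
  apply: contra_neq s12 => /finset.setIidPl s12; apply/eqP.
  by rewrite eqEcard s12 c1 c2 leqnn.
Qed.
End pieces.

(** * The Markov chain of top-dimensional simplices *)

(** The columns sum to 1, so 1 is an eigenvalue. The absolute value [w] of an eigenvector satisfies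
    [w <= P w] entrywise, and both sides have the same total; hence they are equal, and [w] only
    needs normalising. *)
Lemma stationary_exists (R : realType) (T : finType) (P : T -> T -> R) (t0 : T) :
  (forall s t, 0 <= P s t) -> (forall t, \sum_s P s t = 1) ->
  exists v : T -> R, [/\ forall t, 0 <= v t, \sum_t v t = 1 & forall s, \sum_t P s t * v t = v s].
Proof.
move=> P0 P1; pose n := #|T|.
pose M : 'M[R]_n := \matrix_(i, j) P (enum_val i) (enum_val j).
have dM : \det (M - 1%:M) = 0.
  apply/eqP/det0P; exists (const_mx 1).
    apply/eqP => /rowP/(_ (enum_rank t0)); rewrite !mxE => /eqP.
    by rewrite oner_eq0.
  apply/rowP => j; rewrite !mxE.
  under eq_bigr do rewrite !mxE mul1r.
  have E1 : \sum_(i < n) P (enum_val i) (enum_val j) = 1.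
    by rewrite -[RHS](P1 (enum_val j)) [RHS](reindex (@enum_val T T)) //; exact: onW_bij (enum_val_bij T).
  rewrite sumrB E1.
  by rewrite (bigD1 j)//= eqxx big1 ?addr0 ?subrr// => i /negbTE ->.
have /eqP/det0P[u u0 uM] : \det (M - 1%:M)^T = 0 by rewrite det_tr.
pose w t := `|u 0 (enum_rank t)|.
have wE s : u 0 (enum_rank s) = \sum_t P s t * u 0 (enum_rank t).
  have /rowP/(_ (enum_rank s)) := uM.
  rewrite linearB/= trmx1 mulmxBr mulmx1 !mxE => /eqP; rewrite subr_eq0 => /eqP <-.
  rewrite (reindex (@enum_rank T)) /=; last exact: onW_bij (enum_rank_bij T).
  by apply: eq_bigr => t _; rewrite !mxE !enum_rankK mulrC.
have wle s : w s <= \sum_t P s t * w t.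
  rewrite /w {1}wE (le_trans (ler_norm_sum _ _ _))// ler_sum// => t _.
  by rewrite normrM ger0_norm.
have sw : \sum_s (\sum_t P s t * w t - w s) = 0.
  rewrite sumrB exchange_big/=; apply/eqP; rewrite subr_eq0; apply/eqP.
  by apply: eq_bigr => t _; rewrite -mulr_suml P1 mul1r.
have weq s : \sum_t P s t * w t = w s.
  apply/eqP; rewrite -subr_eq0; apply/eqP; apply: (psumr_eq0P _ sw) => // t _.
  by rewrite subr_ge0.
have w0 t : 0 <= w t by exact: normr_ge0.
have W0 : 0 < \sum_t w t.
  rewrite lt0r sumr_ge0// andbT; apply: contraNneq u0 => /eqP.
  rewrite psumr_eq0// => /allP H; apply/eqP/rowP => i; rewrite mxE.
  have := H (enum_val i); rewrite mem_index_enum /w enum_valK normr_eq0 => /(_ isT)/eqP//.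
exists (fun t => w t / \sum_t w t); split.
- by move=> t; exact: divr_ge0 (w0 t) (ltW W0).
- by rewrite -mulr_suml divff// gt_eqF.
- by move=> s; rewrite -weq mulr_suml; apply: eq_bigr => t _; rewrite mulrA.
Qed.

Section markov.
Context {R : realType} {N d : nat} {V V' : finType}.
Context {p : V -> 'rV[R]_N} {S : {set {set V}}} {p' : V' -> 'rV[R]_N} {S' : {set {set V'}}}.
Context {gamma : V' -> V} {g : 'rV[R]_N -> 'rV[R]_N}.
Hypothesis sys : simplicial_system d p S p' S' gamma g.
Local Notation D := (dsimp S d).
Local Notation D' := (dsimp S' d).
Local Notation OGr := (OG p S p' S' gamma d).
Local Notation Gr := (Grel p S p' S' gamma d).
Local Notation inJ := (@inJ R N V V' p p').
Local Notation nu := (@nu R N d V V' p p').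
Local Notation lamS := (@lamS R N d V p).
Local Notation psi := (@psi R N d V V' p p' gamma).

Lemma nu_sum1 s : s \in D -> \sum_(s' in D' | inJ s s') nu s s' = 1.
Proof.
move=> sD; have := lamS_selfsim sys sD (@measurableT _ (borelT R N)).
rewrite probability_setT => /esym.
under eq_bigr do rewrite preimage_setT (@probability_setT _ _ _ (lamS _)) mule1.
by rewrite sumEFin => -[].
Qed.

(** Moves between sums over target simplices and sums over pieces of [s1], the form in which
    self-similarity appears. *)
Lemma Gamma_sum (F : {set V} -> R) s1 : s1 \in D ->
  \sum_(s2 in D) Gamma p p' S' gamma d s2 s1 * F s2 =
  \sum_(s' in D' | inJ s1 s') nu s1 s' * F (gamma @: s').
Proof.
move=> sD; rewrite [RHS](partition_big (fun s' : {set V'} => gamma @: s') (mem D))/=; last first.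
  by move=> s' /andP[s'D _]; exact: (dsimp_gamma sys).
apply: eq_bigr => s2 _; rewrite /Gamma mulr_suml; apply: eq_big => s'.
  by rewrite -andbA; congr (_ && _); rewrite andbC.
by move=> /andP[_ /andP[/eqP <- _]].
Qed.

Lemma Gr_succ s s' : s \in D -> s' \in D' -> inJ s s' -> Gr s (gamma @: s').
Proof.
move=> sD sD' /inJP ss'; split => //; first exact: (dsimp_gamma sys).
by exists s'.
Qed.

Lemma GrP s t : Gr s t -> exists s', [/\ s \in D, s' \in D', inJ s s' & t = gamma @: s'].
Proof. by move=> [sD tD [s' sD' [ss' <-]]]; exists s'; split => //; apply/inJP. Qed.

Lemma OG_dsimp s t : OGr s t -> s \in D /\ t \in D.
Proof. by elim=> [x y []//|x y z _ [? _] _ [_ ?]]. Qed.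

(** At a point where the bound [M] is attained, [M] is at most a mean, with positive weights, of
    values not exceeding [M]. All these values equal [M], and the argument repeats along paths. *)
Lemma subharmonic_max (C : {set {set V}}) (h : {set V} -> R) (M : R) :
  (forall s t, s \in C -> Gr s t -> t \in C) ->
  (forall s, s \in C -> h s <= M) ->
  (forall s, s \in C -> h s <= \sum_(s' in D' | inJ s s') nu s s' * h (gamma @: s')) ->
  forall s t, OGr s t -> s \in C -> h s = M -> t \in C /\ h t = M.
Proof.
move=> clC hM sub s t; elim=> [x y xy xC hx|x y z _ IH1 _ IH2 xC hx]; last first.
  by have [yC hy] := IH1 xC hx; exact: IH2.
split; first exact: clC xy.
have [s' [xD sD' xs' yE]] := GrP xy.
have S0 : \sum_(s' in D' | inJ x s') nu x s' * (M - h (gamma @: s')) = 0.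
  apply/le_anti; apply/andP; split.
    under eq_bigr do rewrite mulrBr.
    rewrite sumrB -mulr_suml nu_sum1// mul1r subr_le0 -hx; exact: sub.
  apply: sumr_ge0 => u /andP[uD xu]; rewrite mulr_ge0//; first exact/ltW/(nu_gt0 sys).
  by rewrite subr_ge0 hM// (clC x)//; exact: Gr_succ.
have : nu x s' * (M - h (gamma @: s')) = 0.
  apply: (psumr_eq0P _ S0) => [u /andP[uD xu]|]; last by rewrite sD'.
  rewrite mulr_ge0//; first exact/ltW/(nu_gt0 sys).
  by rewrite subr_ge0 hM// (clC x)//; exact: Gr_succ.
move=> /eqP; rewrite mulf_eq0 gt_eqF ?(nu_gt0 sys)//= subr_eq0 -yE => /eqP.
by [].
Qed.

Lemma dsimp_succ s : s \in D -> exists t, Gr s t.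
Proof.
move=> sD; have [_ sd _] := dsimpP sys sD.
have [v vs] : exists v, v \in s by apply/card_gt0P; rewrite sd.
have [s' [sD' ss' _]] := dsimp_cover sys sD (shull_vertex p vs).
by exists (gamma @: s'); exact: Gr_succ.
Qed.

Lemma reach_terminal s : s \in D ->
  exists B t, [/\ G_terminal p S p' S' gamma d B, t \in B & OGr s t].
Proof.
move=> sD; pose Rch u := [set t in D | `[< OGr u t >]]%SET.
have RchP u t : reflect (OGr u t) (t \in Rch u).
  rewrite inE; apply: (iffP andP) => [[_ /asboolP]//|ut].
  by split; [have [] := OG_dsimp ut|apply/asboolP].
have Rsub u t : OGr u t -> Rch t \subset Rch u.
  by move=> ut; apply/fintype.subsetP => w /RchP tw; apply/RchP; exact: t_trans ut tw.
(* A reachable simplex from which the fewest simplices are reachable is recurrent. *)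
have [t0 st0] := dsimp_succ sD.
have s0 : t0 \in Rch s by apply/RchP; exact: t_step.
pose t := [arg min_(t < t0 in Rch s) #|Rch t|].
have [st tmin] : t \in Rch s /\ forall u, u \in Rch s -> (#|Rch t| <= #|Rch u|)%N.
  by rewrite /t; case: arg_minnP.
have REq u : u \in Rch t -> Rch u = Rch t.
  move=> tu; have us : u \in Rch s by exact: (fintype.subsetP (Rsub _ _ (RchP _ _ st))).
  by apply/eqP; rewrite eqEcard Rsub ?tmin//; exact/RchP.
have [_ tD] := OG_dsimp (RchP _ _ st).
have [u tu] := dsimp_succ tD.
have uR : u \in Rch t by apply/RchP; exact: t_step.
have uu : OGr u u by apply/RchP; rewrite REq.
exists (Rch t), u; split => //; last first.
  by apply: t_trans (RchP _ _ st) _; exact: t_step.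
split.
  exists u; split => //; apply/setP => w; apply/idP/idP.
    move=> wt; have /RchP uw : w \in Rch u by rewrite REq.
    rewrite inE; have [_ ->] := OG_dsimp uw; apply/asboolP; split => //.
    by apply/RchP; rewrite REq.
  by rewrite inE => /andP[_ /asboolP[uw _]]; rewrite -(REq u uR); apply/RchP.
by move=> x y xt xy; rewrite -(REq x xt); apply/RchP.
Qed.

Section terminal.
Context {B : {set {set V}}}.
Hypothesis Bt : G_terminal p S p' S' gamma d B.

Lemma terminal_dsimp s : s \in B -> s \in D.
Proof. by have [[u [_ ->]] _] := Bt; rewrite inE => /andP[]. Qed.

Lemma terminal_conn s t : s \in B -> t \in B -> OGr s t.
Proof.
have [[u [_ ->]] _] := Bt; rewrite !inE => /andP[_ /asboolP[us su]] /andP[_ /asboolP[ut tu]].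
exact: t_trans su ut.
Qed.

Lemma terminal_closed s t : s \in B -> Gr s t -> t \in B.
Proof. by have [_ h] := Bt; move=> sB st; apply: h sB _; exact: t_step. Qed.

Lemma terminal_nonempty : exists s, s \in B.
Proof.
have [[u [uu ->]] _] := Bt; exists u; rewrite inE; have [-> _] := OG_dsimp uu.
exact/asboolP.
Qed.

Lemma terminal_gamma s s' : s \in B -> s' \in D' -> inJ s s' -> gamma @: s' \in B.
Proof. by move=> sB sD' ss'; apply: (terminal_closed sB); apply: Gr_succ => //; exact: terminal_dsimp. Qed.

(** Since [vB] is chosen by [xget], it has the defining property as soon as some distribution has
    it. *)
Lemma vB_stat : stat_supp p S p' S' gamma d B (vB p S p' S' gamma d B).
Proof.
suff H : exists v, stat_supp p S p' S' gamma d B v.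
  by case: H => v Hv; rewrite /vB; case: xgetP => // /(_ v).
have [b0 b0B] := terminal_nonempty.
pose Gm := Gamma p p' S' gamma d.
have Gm0 s2 s1 : s1 \in D -> 0 <= Gm s2 s1.
  move=> sD; apply: sumr_ge0 => s' /andP[sD' /andP[_ ss']]; exact/ltW/(nu_gt0 sys).
(* Outside [B] the chain jumps to [b0], so that every stationary distribution lives on [B]. *)
pose P s2 s1 : R := if s1 \in B then (if s2 \in B then Gm s2 s1 else 0) else (s2 == b0)%:R.
have P0 s2 s1 : 0 <= P s2 s1.
  rewrite /P; case: ifP => sB; last by rewrite ler0n.
  by case: ifP => // _; apply: Gm0; exact: terminal_dsimp.
have P1 s1 : \sum_s2 P s2 s1 = 1.
  rewrite /P; case: (boolP (s1 \in B)) => sB; last first.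
    by rewrite (bigD1 b0)//= eqxx big1 ?addr0// => i /negbTE ->.
  have sD := terminal_dsimp sB.
  have -> : \sum_s2 (if s2 \in B then Gm s2 s1 else 0) =
     \sum_(s2 in D) Gm s2 s1 * (s2 \in B)%:R.
    rewrite [RHS]big_mkcond/=; apply: eq_bigr => s2 _.
    case: ifP => s2B; first by rewrite (terminal_dsimp s2B) mulr1.
    by case: ifP => // _; rewrite mulr0.
  rewrite Gamma_sum// -[RHS](nu_sum1 sD); apply: eq_bigr => s' /andP[sD' ss'].
  by rewrite (terminal_gamma sB)// mulr1n mulr1.
have [v [v0 v1 vP]] := stationary_exists b0 P0 P1.
have vout s : s \notin B -> v s = 0.
  move=> sB; rewrite -vP big1// => s1 _; rewrite /P (negbTE sB).
  case: ifP => _; rewrite ?mul0r//; case: eqVneq => [sb|_]; last by rewrite mul0r.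
  by rewrite sb b0B in sB.
have vG s2 : s2 \in B -> v s2 = \sum_(s1 in B) Gm s2 s1 * v s1.
  move=> sB; rewrite -vP [RHS]big_mkcond/=; apply: eq_bigr => s1 _.
  rewrite /P sB; case: ifPn => // s1B; by rewrite (vout _ s1B) mulr0.
exists (finfun v); split.
- by move=> s _; rewrite ffunE.
- under eq_bigr do rewrite ffunE.
  rewrite -v1 [RHS](bigID (mem D))/= [X in _ = _ + X]big1 ?addr0// => s sD.
  by apply: vout; apply: contraNN sD; exact: terminal_dsimp.
- move=> s2 s2D; under eq_bigr do rewrite ffunE; rewrite ffunE.
  have -> : \sum_(s1 in D) Gm s2 s1 * v s1 = \sum_(s1 in B) Gm s2 s1 * v s1.
    rewrite big_mkcond [RHS]big_mkcond; apply: eq_bigr => s1 _.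
    case: ifPn => sD; case: ifPn => sB //; first by rewrite vout// mulr0.
    by rewrite (terminal_dsimp sB) in sD.
  have [sB|sB] := boolP (s2 \in B); first by rewrite vG.
  rewrite vout// big1// => s1 s1B; rewrite /Gm /Gamma big1 ?mul0r//.
  move=> s' /andP[sD' /andP[/eqP gs ss']]; move: sB; rewrite -gs.
  by rewrite (terminal_gamma s1B).
- have [s1 s1v] : exists s1, v s1 != 0.
    apply/existsP; apply: contraT; rewrite negb_exists => /forallP H.
    have : \sum_t v t = 0 by apply: big1 => t _; apply/eqP; have := H t; rewrite negbK.
    by rewrite v1 => /eqP; rewrite oner_eq0.
  have s1B : s1 \in B by apply: contraT => /vout; move/eqP: s1v.
  (* Positive mass is passed on along [Gr], so from one charged simplex it reaches all of the
     strongly connected class [B]. *)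
  have prop s t : OGr s t -> s \in B -> 0 < v s -> 0 < v t.
    move=> st; elim: st => [x y xy xB vx|x y z xy IH1 _ IH2 xB vx]; last first.
      apply: IH2; last exact: IH1.
      by have [_ h] := Bt; exact: h xB xy.
    have yB := terminal_closed xB xy.
    rewrite (vG _ yB) (bigD1 x)//= ltr_pwDl//; last first.
      by apply: sumr_ge0 => s1' /andP[sB' _]; rewrite mulr_ge0// Gm0//; exact: terminal_dsimp.
    rewrite mulr_gt0//; have [s' [xD sD' xs' yE]] := GrP xy.
    rewrite /Gm /Gamma (bigD1 s')/=; last by rewrite sD' yE eqxx.
    rewrite ltr_pwDl//; first exact: (nu_gt0 sys).
    by apply: sumr_ge0 => u /andP[/andP[uD /andP[_ xu]] _]; exact/ltW/(nu_gt0 sys).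
  apply/setP => s; rewrite inE ffunE; apply/andP/idP => [[_]|sB].
    by apply: contraNT => /vout ->.
  split; first exact: terminal_dsimp.
  rewrite gt_eqF//; apply: (prop s1) => //; first exact: terminal_conn.
  by rewrite lt0r s1v v0.
Qed.
End terminal.
End markov.

(** * Contraction of the inverse branches and chain recurrence *)

(** The positive and negative parts of [c] have the same mass [m], so [m] times [c] is a positive
    combination of differences of two unit vectors, with weights [cp i * cn j]. Each difference has
    l1 norm at most 2, and the hypothesis maps it to norm at most [k * 2]. *)
Lemma dobrushin (R : realType) (I J : finType) (A : {set I}) (c : I -> R) (B : I -> J -> R) (k : R) :
  (forall i, i \notin A -> c i = 0) -> \sum_i c i = 0 ->
  (forall i j, i \in A -> j \in A -> \sum_u `|B i u - B j u| <= k * 2) ->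
  \sum_u `|\sum_i c i * B i u| <= k * \sum_i `|c i|.
Proof.
move=> cA c0 Bk.
pose cp i := (`|c i| + c i) / 2; pose cn i := (`|c i| - c i) / 2.
have cp0 i : 0 <= cp i by rewrite divr_ge0//; have := ler_norm (- c i); rewrite normrN; lra.
have cn0 i : 0 <= cn i by rewrite divr_ge0// subr_ge0 ler_norm.
have cE i : c i = cp i - cn i by rewrite /cp /cn; lra.
have cabs i : `|c i| = cp i + cn i by rewrite /cp /cn; lra.
pose m := \sum_i cp i.
have mn : \sum_i cn i = m.
  by apply/eqP; rewrite eq_sym -subr_eq0 -sumrB; under eq_bigr do rewrite -cE; rewrite c0.
have cabsE : \sum_i `|c i| = m * 2.
  by under eq_bigr do rewrite cabs; rewrite big_split/= mn -/m; ring.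
have m0 : 0 <= m by exact: sumr_ge0.
have [mz|mN0] := eqVneq m 0.
  have cz i : c i = 0.
    apply/eqP; rewrite -normr_le0; apply: le_trans (_ : \sum_i `|c i| <= 0).
      by rewrite (bigD1 i)//= lerDl sumr_ge0.
    by rewrite cabsE mz mul0r.
  rewrite cabsE mz mul0r mulr0 big1// => u _; rewrite big1 ?normr0// => i _.
  by rewrite cz mul0r.
have mp : 0 < m by rewrite lt0r mN0.
have key u : m * (\sum_i c i * B i u) = \sum_i \sum_j cp i * cn j * (B i u - B j u).
  have -> : \sum_i \sum_j cp i * cn j * (B i u - B j u) =
     \sum_i cp i * B i u * m - \sum_j cn j * B j u * m.
    under eq_bigr do (under eq_bigr do rewrite mulrBr; rewrite sumrB).
    rewrite sumrB; congr (_ - _).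
      apply: eq_bigr => i _; rewrite -mn mulr_sumr; apply: eq_bigr => j _; ring.
    rewrite exchange_big/=; apply: eq_bigr => j _.
    rewrite /m mulr_sumr; apply: eq_bigr => i _; ring.
  rewrite -sumrB mulr_sumr; apply: eq_bigr => i _; rewrite cE; ring.
rewrite -(ler_pM2l mp) mulr_sumr.
under eq_bigr do rewrite -[X in X * _](gtr0_norm mp) -normrM key.
apply: (@le_trans _ _ (\sum_i \sum_j cp i * cn j * (k * 2))).
  apply: (@le_trans _ _ (\sum_u \sum_i \sum_j cp i * cn j * `|B i u - B j u|)).
    apply: ler_sum => u _; apply: le_trans (ler_norm_sum _ _ _) _; apply: ler_sum => i _.
    apply: le_trans (ler_norm_sum _ _ _) _; apply: ler_sum => j _.
    by rewrite normrM (normrM (cp i)) (ger0_norm (cp0 i)) (ger0_norm (cn0 j)).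
  rewrite exchange_big/=; apply: ler_sum => i _.
  rewrite exchange_big/=; apply: ler_sum => j _.
  rewrite -mulr_sumr.
  have [iA|iA] := boolP (i \in A); last by rewrite /cp cA// normr0 addr0 !mul0r.
  have [jA|jA] := boolP (j \in A); last by rewrite /cn cA// normr0 subr0 !(mul0r, mulr0).
  by apply: ler_wpM2l; [exact: (mulr_ge0 (cp0 i) (cn0 j))|exact: Bk].
under eq_bigr do rewrite -mulr_suml -mulr_sumr mn.
by rewrite -mulr_suml -mulr_suml -/m cabsE mulrA le_eqVlt; apply/orP; left; apply/eqP; ring.
Qed.

Lemma finite_lt1_bound (R : realType) (I : finType) (P : pred I) (f : I -> R) :
  (forall i, P i -> f i < 1) -> exists k, [/\ 0 <= k, k < 1 & forall i, P i -> f i <= k].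
Proof.
move=> f1; exists (\big[Num.max/0]_(i | P i) f i); split.
- exact: bigmax_ge_id.
- by elim/big_ind : _ => // [x y x0 y0]; rewrite gt_max x0.
- move=> i Pi; exact: le_bigmax_cond.
Qed.

Section contraction.
Context {R : realType} {N d : nat} {V V' : finType}.
Context {p : V -> 'rV[R]_N} {S : {set {set V}}} {p' : V' -> 'rV[R]_N} {S' : {set {set V'}}}.
Context {gamma : V' -> V} {g : 'rV[R]_N -> 'rV[R]_N}.
Hypothesis sys : simplicial_system d p S p' S' gamma g.
Local Notation D := (dsimp S d).
Local Notation D' := (dsimp S' d).
Local Notation OGr := (OG p S p' S' gamma d).
Local Notation Gr := (Grel p S p' S' gamma d).
Local Notation inJ := (@inJ R N V V' p p').
Local Notation nu := (@nu R N d V V' p p').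
Local Notation lamS := (@lamS R N d V p).
Local Notation psi := (@psi R N d V V' p p' gamma).
Local Notation X := (polyh p S).

Definition bco (x : 'rV[R]_N) : V -> R := xget (fun=> 0) [set b | bary p S x b].
(** On a simplex of the subdivision [g] merely relabels coefficients, so this distance of its images
    is the l1 distance of the coefficients, to which Dobrushin's estimate applies. *)
Definition dist1 (x y : 'rV[R]_N) : R := \sum_v `|bco x v - bco y v|.

Lemma bcoE s b : s \in S -> (forall v, 0 <= b v) -> (forall v, v \notin s -> b v = 0) ->
  \sum_v b v = 1 -> bco (\sum_v b v *: p v) = b.
Proof.
move=> sS b0 bs b1; have bb : bary p S (\sum_v b v *: p v) b by exists s.
by apply: (bary_uniq (sysK sys) _ bb); rewrite /bco; case: xgetP => // /(_ b).
Qed.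

Lemma bcoP s x : s \in S -> shull p s x ->
  [/\ forall v, 0 <= bco x v, forall v, v \notin s -> bco x v = 0,
      \sum_v bco x v = 1 & x = \sum_v bco x v *: p v].
Proof. by move=> sS [b [b0 bs b1 ->]]; rewrite (bcoE sS). Qed.

Lemma dist1_le2 x y : X x -> X y -> dist1 x y <= 2.
Proof.
move=> [s sS sx] [t tS ty]; have [x0 _ x1 _] := bcoP sS sx; have [y0 _ y1 _] := bcoP tS ty.
have -> : (2 : R) = \sum_v (bco x v + bco y v) by rewrite big_split/= x1 y1.
apply: ler_sum => v _; rewrite (le_trans (ler_normB _ _))// !ger0_norm//.
Qed.

(** Converts contraction in [dist1] into the norm estimates that balls and epsilon-chains ask
    for. *)
Lemma dist1_norm : exists C, 0 < C /\ forall x y, X x -> X y -> `|x - y| <= C * dist1 x y.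
Proof.
exists (1 + \sum_v `|p v|); split; first by rewrite ltr_pwDl// sumr_ge0.
move=> x y [s sS sx] [t tS ty].
have [x0 _ x1 {1}->] := bcoP sS sx; have [y0 _ y1 {1}->] := bcoP tS ty.
rewrite -sumrB; under eq_bigr do rewrite -scalerBl.
apply: le_trans (ler_norm_sum _ _ _) _; rewrite /dist1 mulr_sumr; apply: ler_sum => v _.
rewrite normrZ mulrC ler_wpM2r// (bigD1 v)//= addrCA lerDl addr_ge0// sumr_ge0//.
Qed.

(* This is where properness of the subdivision enters: the barycentric coordinates of two
   vertices of a simplex of [K*] have overlapping supports, so that the stochastic matrix
   of an inverse branch of [g] is a strict contraction. *)
Lemma vertex_overlap s' v w : s' \in D' -> v \in s' -> w \in s' ->
  exists2 u, 0 < bco (p' v) u & 0 < bco (p' w) u.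
Proof.
move=> sD vs ws; have [sS' _ _] := dsimpP' sys sD.
have [h1 _ h3] := sys_sub sys; have [s sS ss'] := h1 _ sS'.
have [v0 vz v1 vE] := bcoP sS (ss' _ (shull_vertex p' vs)).
have [w0 wz w1 wE] := bcoP sS (ss' _ (shull_vertex p' ws)).
apply: contrapT => H.
have [_ sub _ _ inter] := sysK sys.
(* [F x] is the carrier of the vertex [x]. Disjoint carriers of two vertices of [s'] would be two
   disjoint simplices both met by [s'], contrary to properness. *)
pose F (x : V') := [set u | 0 < bco (p' x) u]%SET.
have pos (x : V') : (forall u, 0 <= bco (p' x) u) -> (forall u, u \notin s -> bco (p' x) u = 0) ->
    \sum_u bco (p' x) u = 1 -> p' x = \sum_u bco (p' x) u *: p u ->
    F x \in S /\ shull p (F x) (p' x).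
  move=> x0 xz x1 xE.
  have xF u : u \notin F x -> bco (p' x) u = 0.
    by rewrite inE -leNgt => h; apply/le_anti; rewrite h x0.
  split; last by exists (bco (p' x)).
  apply: (sub s) => //.
    apply/fintype.subsetP => u; rewrite inE; apply: contraTT => /xz ->.
    by rewrite ltxx.
  apply/card_gt0P; apply: contrapT => /forallNP nF.
  have : \sum_u bco (p' x) u = 0 by apply: big1 => u _; apply: xF; exact/negP/nF.
  by rewrite x1 => /eqP; rewrite oner_eq0.
have [Fv pv] := pos v v0 vz v1 vE; have [Fw pw] := pos w w0 wz w1 wE.
apply: (h3 s' (F v) (F w)) => //.
  rewrite inter//; have -> : F v :&: F w = finset.set0.
    apply/setP => u; rewrite !inE; apply/negP => /andP[uv uw]; apply: H.
    by exists u.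
  exact: shull_set0.
by split; [exists (p' v)|exists (p' w)]; split => //; exact: shull_vertex.
Qed.

(** If [b] holds the coefficients of [x] on [s'], those of [g x] are [b] relabelled, while those of
    [x] in the coarse complex are the image of [b] under the matrix with rows [bco (p' v)]. The
    claim is Dobrushin's estimate for this matrix. *)
Lemma g_contraction : exists k, [/\ 0 <= k, k < 1 & forall s' x y, s' \in D' ->
  shull p' s' x -> shull p' s' y -> dist1 x y <= k * dist1 (g x) (g y)].
Proof.
pose P (vw : V' * V') := [exists s' in D', (vw.1 \in s') && (vw.2 \in s')].
(* Half the l1 distance of two rows is below 1 because their supports overlap; there are finitely
   many pairs, so one [k] serves them all. *)
have [[v w] /= /exists_inP[s' sD /andP[vs ws]]|k [k0 k1 kP]] :=
    @finite_lt1_bound R _ P (fun vw => dist1 (p' vw.1) (p' vw.2) / 2).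
  rewrite ltr_pdivrMr// mul1r.
  have [u uv uw] := vertex_overlap sD vs ws.
  have [sS' _ _] := dsimpP' sys sD.
  have [h1 _ _] := sys_sub sys; have [s sS ss'] := h1 _ sS'.
  have [v0 vz v1 vE] := bcoP sS (ss' _ (shull_vertex p' vs)).
  have [w0 wz w1 wE] := bcoP sS (ss' _ (shull_vertex p' ws)).
  have -> : (2 : R) = \sum_u (bco (p' v) u + bco (p' w) u) by rewrite big_split/= v1 w1.
  rewrite /dist1 (bigD1 u)//= [ltRHS](bigD1 u)//= ltr_leD//.
    by rewrite ltr_norml; apply/andP; split; lra.
  by apply: ler_sum => z _; rewrite (le_trans (ler_normB _ _))// !ger0_norm.
exists k; split => // s' x y sD sx sy.
have [sS' _ _] := dsimpP' sys sD; have [gS' _] := sys_gamma sys sS'.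
have [h1 _ _] := sys_sub sys; have [s sS ss'] := h1 _ sS'.
case: sx => [b [b0 bs b1 ->]]; case: sy => [c [c0 cs c1 ->]].
have bcoX (e : V' -> R) : (forall v, 0 <= e v) -> (forall v, v \notin s' -> e v = 0) ->
    \sum_v e v = 1 -> bco (\sum_v e v *: p' v) = (fun u => \sum_v e v * bco (p' v) u).
  move=> e0 es e1.
  have H v : v \in s' -> [/\ forall u, 0 <= bco (p' v) u, forall u, u \notin s -> bco (p' v) u = 0,
      \sum_u bco (p' v) u = 1 & p' v = \sum_u bco (p' v) u *: p u].
    by move=> vs; apply: bcoP => //; apply/ss'/shull_vertex.
  have -> : \sum_v e v *: p' v = \sum_u (\sum_v e v * bco (p' v) u) *: p u.
    under [RHS]eq_bigr do rewrite scaler_suml.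
    rewrite exchange_big/=; apply: eq_bigr => v _.
    have [vs|vs] := boolP (v \in s'); last first.
      by rewrite es// scale0r big1// => u _; rewrite mul0r scale0r.
    have [_ _ _ {1}->] := H v vs; rewrite scaler_sumr.
    by apply: eq_bigr => u _; rewrite scalerA.
  apply: (bcoE sS).
  - move=> u; apply: sumr_ge0 => v _.
    have [vs|vs] := boolP (v \in s'); last by rewrite es// mul0r.
    by have [v0 _ _ _] := H v vs; rewrite mulr_ge0.
  - move=> u us; apply: big1 => v _.
    have [vs|vs] := boolP (v \in s'); last by rewrite es// mul0r.
    by have [_ vz _ _] := H v vs; rewrite vz// mulr0.
  - rewrite exchange_big/= -e1; apply: eq_bigr => v _; rewrite -mulr_sumr.
    have [vs|vs] := boolP (v \in s'); last by rewrite es// mul0r.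
    by have [_ _ -> _] := H v vs; rewrite mulr1.
have bcoG (e : V' -> R) : (forall v, 0 <= e v) -> (forall v, v \notin s' -> e v = 0) ->
    \sum_v e v = 1 -> bco (g (\sum_v e v *: p' v)) = (fun u => \sum_(v | gamma v == u) e v).
  move=> e0 es e1; rewrite (g_coef sys sS')//.
  have -> : \sum_v e v *: p (gamma v) = \sum_u (\sum_(v | gamma v == u) e v) *: p u.
    rewrite (partition_big gamma predT)//=; apply: eq_bigr => u _.
    by rewrite scaler_suml; apply: eq_bigr => v /eqP ->.
  apply: (bcoE gS').
  - by move=> u; exact: sumr_ge0.
  - move=> u ug; apply: big1 => v /eqP vu; apply: es.
    by apply: contraNN ug => vs; rewrite -vu imset_f.
  - by rewrite -[RHS]e1 [RHS](partition_big gamma predT).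
have dG : dist1 (g (\sum_v b v *: p' v)) (g (\sum_v c v *: p' v)) = \sum_v `|b v - c v|.
  rewrite /dist1 !bcoG//.
  rewrite (sum_inj_imset (gamma_inj sys sS')); last first.
    move=> u ug; rewrite !big1 ?subrr ?normr0// => v /eqP vu.
      by apply: cs; apply: contraNN ug => vs; rewrite -vu imset_f.
    by apply: bs; apply: contraNN ug => vs; rewrite -vu imset_f.
  apply: eq_bigr => v _; case: ifPn => vs; last by rewrite bs// cs// subrr normr0.
  have one (e : V' -> R) : (forall v, v \notin s' -> e v = 0) -> \sum_(w | gamma w == gamma v) e w = e v.
    move=> es; rewrite (bigD1 v)//= big1 ?addr0// => w /andP[/eqP wv nwv]; apply: es.
    by apply: contraNN nwv => ws; apply/eqP; apply: (gamma_inj sys sS').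
  by rewrite !one.
rewrite dG /dist1 !bcoX//.
under eq_bigr do rewrite -sumrB.
under eq_bigr do under eq_bigr do rewrite -mulrBl.
apply: (@dobrushin _ _ _ s').
- by move=> v vs; rewrite bs// cs// subrr.
- by rewrite sumrB b1 c1 subrr.
- move=> v w vs ws; rewrite -ler_pdivrMr//; apply: (kP (v, w)).
  by apply/exists_inP; exists s' => //=; rewrite vs.
Qed.
End contraction.

Lemma pigeonhole_io (T : finType) (a : nat -> T) :
  exists t, forall m, exists2 n, (m <= n)%N & a n = t.
Proof.
apply: contrapT => /forallNP H.
have /choice[f fP] : forall t, exists m, forall n, (m <= n)%N -> a n <> t.
  move=> t; have /existsNP[m Hm] := H t; exists m => n mn ant.
  by apply: Hm; exists n.
pose m := (\max_(t : T) f t)%N.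
by apply: (fP (a m) m) => //; exact: leq_bigmax.
Qed.

Lemma geometric_small (R : realType) (C k e : R) : 0 <= k -> k < 1 -> 0 < e ->
  exists n0, forall n, (n0 <= n)%N -> C * k ^+ n < e.
Proof.
move=> k0 k1 e0.
have h : (C * k ^+ n) @[n --> \oo] --> (0 : R).
  rewrite -(mulr0 C); apply: cvgMr; apply: cvg_expr.
  by rewrite ger0_norm.
move/cvgrPdist_lt : h => /(_ e e0)[n0 _ H].
exists n0 => n nn; have := H n nn; rewrite sub0r normrN; exact: le_lt_trans (ler_norm _).
Qed.

(** * Shadowing, chain recurrence and basic sets *)

Section dynamics.
Context {R : realType} {N d : nat} {V V' : finType}.
Context {p : V -> 'rV[R]_N} {S : {set {set V}}} {p' : V' -> 'rV[R]_N} {S' : {set {set V'}}}.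
Context {gamma : V' -> V} {g : 'rV[R]_N -> 'rV[R]_N}.
Hypothesis sys : simplicial_system d p S p' S' gamma g.
Local Notation D := (dsimp S d).
Local Notation D' := (dsimp S' d).
Local Notation OGr := (OG p S p' S' gamma d).
Local Notation Gr := (Grel p S p' S' gamma d).
Local Notation inJ := (@inJ R N V V' p p').
Local Notation nu := (@nu R N d V V' p p').
Local Notation lamS := (@lamS R N d V p).
Local Notation psi := (@psi R N d V V' p p' gamma).
Local Notation X := (polyh p S).
Local Notation dist1 := (@dist1 R N V p S).
(** A point on a common face can be given several symbols; the last condition makes successive
    choices compatible, so that the inverse branches along the itinerary compose. *)
Definition itinerary (x : 'rV[R]_N) (a : nat -> {set V'}) := forall n,
  [/\ a n \in D', shull p' (a n) (iter n g x) & inJ (gamma @: a n) (a n.+1)].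

Lemma itinerary_exists s x : s \in D -> shull p s x ->
  exists a, itinerary x a /\ inJ s (a 0).
Proof.
move=> sD sx.
have /choice[f fP] : forall sy : {set V} * 'rV[R]_N, exists s', sy.1 \in D -> shull p sy.1 sy.2 ->
    [/\ s' \in D', inJ sy.1 s' & shull p' s' sy.2].
  move=> [t y] /=; have [[tD ty]|H] := pselect (t \in D /\ shull p t y).
    by have [s' ?] := dsimp_cover sys tD ty; exists s'.
  by exists finset.set0 => tD ty; exfalso; apply: H.
pose st := fix st n : {set V} := if n is n'.+1 then gamma @: f (st n', iter n' g x) else s.
have stP n : st n \in D /\ shull p (st n) (iter n g x).
  elim: n => [//|n [IH1 IH2]]; have [h1 h2 h3] := fP (st n, iter n g x) IH1 IH2.
  split; first exact: (dsimp_gamma sys).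
  by apply: (g_shull sys) => //; have [] := dsimpP' sys h1.
exists (fun n => f (st n, iter n g x)); split.
  move=> n; have [h1 h2] := stP n; have [h3 h4] := stP n.+1.
  have [k1 _ k3] := fP (st n, iter n g x) h1 h2; split => //.
  by have [_ ? _] := fP (st n.+1, iter n.+1 g x) h3 h4.
by have [] := fP (s, x) sD sx.
Qed.

Lemma itinerary_shift x a : itinerary x a -> itinerary (g x) (a \o succn).
Proof. by move=> xa n; have [? ? ?] := xa n.+1; split => //=; rewrite -iterSr. Qed.

(** The point [z] is [y] pulled back through the inverse branches of [a n], ..., [a 0]. Each
    contracts by [k], starting from a distance of at most 2. *)
Lemma shadowing k : 0 <= k ->
  (forall s' x y, s' \in D' -> shull p' s' x -> shull p' s' y -> dist1 x y <= k * dist1 (g x) (g y)) ->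
  forall n x a y, itinerary x a -> shull p (gamma @: a n) y ->
  exists z, [/\ shull p' (a 0) z, dist1 x z <= k ^+ n.+1 * 2 & iter n.+1 g z = y].
Proof.
move=> k0 kP; elim=> [|n IH] x a y xa ay.
  have [aD ax _] := xa 0%N; exists (psi (a 0) y).
  have [aS _ _] := dsimpP' sys aD.
  split; [exact: (psi_shull sys)| |by rewrite /= (g_psi sys)].
  apply: le_trans (kP _ _ _ aD ax (psi_shull sys aD ay)) _.
  rewrite expr1 ler_wpM2l// (g_psi sys)//; apply: (dist1_le2 sys).
    by apply: (shull_subX _ (g_shull sys aS ax)); have [] := dsimpP sys (dsimp_gamma sys aD).
  by apply: (shull_subX _ ay); have [] := dsimpP sys (dsimp_gamma sys aD).
have [z [z0 zd zE]] := IH (g x) (a \o succn) y (itinerary_shift xa) ay.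
have [aD ax /inJP a01] := xa 0%N.
have zg := a01 _ z0.
exists (psi (a 0) z); split.
- exact: (psi_shull sys).
- apply: le_trans (kP _ _ _ aD ax (psi_shull sys aD zg)) _.
  by rewrite (g_psi sys)// exprS -mulrA ler_wpM2l.
- by rewrite iterSr (g_psi sys).
Qed.

Definition chain_of_length (e : R) n (x y : 'rV[R]_N) := exists z : nat -> 'rV[R]_N,
  [/\ z 0%N = x, z n = y, (forall i, (i <= n)%N -> X (z i)) &
      forall i, (i < n)%N -> `|g (z i) - z i.+1| < e].

Lemma chain_of_length_cat e n m x y z : chain_of_length e n x y -> chain_of_length e m y z ->
  chain_of_length e (n + m) x z.
Proof.
move=> [u [u0 un uX us]] [w [w0 wm wX ws]].
exists (fun i => if (i <= n)%N then u i else w (i - n)%N); split.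
- by rewrite leq0n.
- case: ifP => [|_]; last by rewrite addKn.
  by rewrite -subn_eq0 addKn => /eqP m0; rewrite m0 addn0 un -wm m0 w0.
- move=> i im; case: ifPn => [/uX//|]; rewrite -ltnNge => ni; apply: wX.
  by rewrite leq_subLR.
- move=> i im; case: (ltngtP i n) => [lt|gt|eqn].
  + exact: us.
  + by rewrite subSn ?(ltnW gt)//; apply: ws; rewrite ltn_subLR// ltnW.
  + rewrite eqn subSnn un -w0; apply: ws.
    by rewrite -(ltn_add2l n) addn0 -{1}eqn.
Qed.

Lemma eps_chainE e x y : eps_chain X g e x y <-> exists2 n, (0 < n)%N & chain_of_length e n x y.
Proof.
split=> [[n [z [n0 ? ? ? ?]]]|[n n0 [z [? ? ? ?]]]]; first by exists n => //; exists z.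
by exists n, z.
Qed.

Lemma chain_rel_trans x y z : chain_rel X g x y -> chain_rel X g y z -> chain_rel X g x z.
Proof.
move=> xy yz e e0; have /eps_chainE[n n0 xny] := xy e e0.
have /eps_chainE[m m0 ymz] := yz e e0.
by apply/eps_chainE; exists (n + m)%N; [rewrite addn_gt0 n0|exact: chain_of_length_cat ymz].
Qed.

Lemma chain_rel_iter n z : X z -> chain_rel X g z (iter n.+1 g z).
Proof.
move=> Xz e e0; exists n.+1, (fun i => iter i g z); split => //.
  by move=> i _; exact: (iter_g_X sys).
by move=> i _; rewrite subrr normr0.
Qed.

Lemma chain_rel_X x y : chain_rel X g x y -> X x /\ X y.
Proof.
move=> /(_ 1 ltr01)[n [u [n0 u0 un uX us]]].
by split; [rewrite -u0|rewrite -un]; exact: uX.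
Qed.

Lemma itinerary_chain x a t y : X x -> itinerary x a ->
  (forall m, exists2 n, (m <= n)%N & a n = t) -> shull p (gamma @: t) y -> chain_rel X g x y.
Proof.
move=> Xx xa io ty e e0.
have [C [C0 Cd]] := dist1_norm sys.
have [k [k0 k1 kP]] := g_contraction sys.
have [n0 Hn0] := geometric_small (C * 2) k0 k1 e0.
have [[|n] nn an] := io n0.+1; first by [].
have ay : shull p (gamma @: (a \o succn) n) y by rewrite /= an.
have [z [za zd zE]] := shadowing k0 kP (itinerary_shift xa) ay.
have Xz : X z.
  have [aD _ _] := itinerary_shift xa 0%N; have [aS _ _] := dsimpP' sys aD.
  exact: (shull_subX' sys aS).
(* The only jump is the first one, from [g x] to the shadowing point [z]; from there on the chain is
   a true orbit ending at [y]. *)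
exists n.+2, (fun i => if i is i'.+1 then iter i' g z else x); split => //.
- by move=> [|i] _ //; exact: (iter_g_X sys).
- move=> [|i] _; last by rewrite subrr normr0.
  apply: le_lt_trans (Cd _ _ (g_X sys Xx) Xz) _.
  apply: le_lt_trans (Hn0 n.+1 _); last exact: ltnW.
  by rewrite -mulrA (mulrC 2) ler_wpM2l// ltW.
Qed.

(** On each of finitely many closed pieces [g] is affine; a small radius stays clear of the pieces
    that miss [y]. *)
Lemma g_continuous y e : X y -> 0 < e ->
  exists2 r, 0 < r & forall w, X w -> `|w - y| < r -> `|g w - g y| < e.
Proof.
move=> Xy e0.
have H (s' : {set V'}) : exists r, 0 < r /\ (s' \in D' -> forall w, shull p' s' w -> `|w - y| < r -> `|g w - g y| < e).
  have [sD|sD] := boolP (s' \in D'); last by exists 1.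
  have [sS' sd ind] := dsimpP' sys sD.
  have [sy|sy] := pselect (shull p' s' y); last first.
    have : nbhs y (~` shull p' s').
      by apply: open_nbhs_nbhs; split => //; rewrite openC; exact: shull_closed.
    rewrite -nbhs_ballE => -[r /= r0 yr]; exists r; split => // _ w sw wy; exfalso.
    by apply: (yr w) => //; rewrite -ball_normE /ball_/= distrC.
  pose f := affext d p' (p \o gamma) s'.
  have fE w : shull p' s' w -> g w = f w.
    move=> [b [b0 bs b1 ->]]; rewrite (g_coef sys sS')// /f affextE//.
  have := @affext_continuous R N d V' p' (p \o gamma) s' y.
  move=> /cvgrPdist_lt/(_ e e0); rewrite -nbhs_ballE => -[r /= r0 yr].
  exists r; split => // _ w sw wy; rewrite !fE// distrC; apply: yr.
  by rewrite -ball_normE /ball_/= distrC.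
have [r rP] := choice H.
have [m [m0 mP]] : exists m, 0 < m /\ forall s', m <= r s'.
  exists (\big[Num.min/1]_s' r s'); split.
    by elim/big_ind : _ => // [a b a0 b0|s' _]; [rewrite lt_min a0|have [] := rP s'].
  by move=> s'; exact: bigmin_le.
exists m => // w Xw wy; have [s sD sw] := X_dsimp sys Xw.
have [s' [sD' _ sw']] := dsimp_cover sys sD sw.
by have [_ h] := rP s'; apply: h => //; exact: lt_le_trans (mP s').
Qed.

Lemma chain_rel_g y x : chain_rel X g y x -> chain_rel X g x x -> chain_rel X g (g y) x.
Proof.
move=> yx xx e e0; have [Xy Xx] := chain_rel_X yx.
have e2 : 0 < e / 2 by rewrite divr_gt0.
have [r r0 rP] := g_continuous (g_X sys Xy) e2.
pose q := Num.min r (e / 2).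
have q0 : 0 < q by rewrite lt_min r0.
have /eps_chainE[n n0 yn] := yx q q0; have /eps_chainE[m m0 xm] := xx q q0.
(* Appending a loop at [x] makes the chain at least two steps long. The new chain jumps from [g y]
   directly to [z 2]: continuity brings [g (g y)] near [g (z 1)], which is near [z 2]. *)
have l1 : (1 < n + m)%N by rewrite -(addn1 1) leq_add.
have [z [z0 zl zX zs]] := chain_of_length_cat yn xm.
move: (n + m)%N l1 zl zX zs => l l1 zl zX zs.
case: l l1 zl zX zs => [//|l] l1 zl zX zs.
exists l, (fun i => if i is i'.+1 then z i'.+2 else g y); split => //.
- by case: l l1 zl {zX zs}.
- by move=> [|i] il; [exact: (g_X sys)|exact: zX].
- move=> [|i] il; last first.
    by apply: lt_le_trans (zs i.+2 _) _ => //; rewrite ge_min; apply/orP; right; lra.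
  have z1 : `|g (z 0%N) - z 1%N| < q by exact: zs.
  have z2 : `|g (z 1%N) - z 2%N| < q by exact: zs.
  have -> : g (g y) - z 2%N = (g (g y) - g (z 1%N)) + (g (z 1%N) - z 2%N) by rewrite addrA subrK.
  apply: le_lt_trans (ler_normD _ _) _; rewrite [e](splitr e) ltrD//.
    rewrite distrC; apply: rP; first exact: zX.
    by rewrite distrC -z0; apply: lt_le_trans z1 _; rewrite ge_min lexx.
  by apply: lt_le_trans z2 _; rewrite ge_min lexx orbT.
Qed.

Lemma chain_rel_iter_back n x : chain_rel X g x x -> chain_rel X g (iter n g x) x.
Proof. by move=> xx; elim: n => //= n IH; exact: chain_rel_g. Qed.

(* A symbol occurring infinitely often in the itinerary of a chain recurrent point
   determines the basic set of that point. *)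
Definition basic_symbol (t : {set V'}) (B : set 'rV[R]_N) := exists x a,
  [/\ X x, chain_rel X g x x, B = [set y | X y /\ chain_rel X g x y /\ chain_rel X g y x],
      itinerary x a & forall m, exists2 n, (m <= n)%N & a n = t].

(** From [x1] every point of the image of [t] is reached, in particular a forward iterate of [x2];
    chain recurrence of [x2] leads back from that iterate. *)
Lemma basic_symbol_le t x1 x2 a1 a2 : X x1 -> chain_rel X g x2 x2 ->
  itinerary x1 a1 -> (forall m, exists2 n, (m <= n)%N & a1 n = t) ->
  itinerary x2 a2 -> (forall m, exists2 n, (m <= n)%N & a2 n = t) -> chain_rel X g x1 x2.
Proof.
move=> X1 x22 xa1 io1 xa2 io2; have [n _ an] := io2 0%N.
apply: (@chain_rel_trans _ (iter n.+1 g x2)); last exact: chain_rel_iter_back.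
apply: (itinerary_chain X1 xa1 io1); rewrite -an.
have [aD ax _] := xa2 n; have [aS _ _] := dsimpP' sys aD.
exact: (g_shull sys).
Qed.

Lemma basic_symbol_uniq t B1 B2 : basic_symbol t B1 -> basic_symbol t B2 -> B1 = B2.
Proof.
move=> [x1 [a1 [X1 x11 -> xa1 io1]]] [x2 [a2 [X2 x22 -> xa2 io2]]].
have x12 : chain_rel X g x1 x2 by exact: basic_symbol_le io1 xa2 io2.
have x21 : chain_rel X g x2 x1 by exact: basic_symbol_le io2 xa1 io1.
apply/seteqP; split => y [Xy [h1 h2]]; split => //; split.
- exact: chain_rel_trans h1.
- exact: chain_rel_trans h2 x12.
- exact: chain_rel_trans h1.
- exact: chain_rel_trans h2 x21.
Qed.

Lemma finite_basic_sets : finite_set [set B | basic_set X g B].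
Proof.
apply: (@sub_finite_set _ _ ((fun t => xget set0 (basic_symbol t)) @` [set: {set V'}])).
  move=> B [x [Xx xx BE]].
  have [s sD sx] := X_dsimp sys Xx; have [a [xa _]] := itinerary_exists sD sx.
  have [t tio] := pigeonhole_io a.
  have tB : basic_symbol t B by exists x, a.
  by exists t => //; case: xgetP => [C _ tC|/(_ B)//]; exact: basic_symbol_uniq tC tB.
by apply: finite_image; exact: finite_finset.
Qed.

Lemma OG_onto s t : OGr s t -> forall y, shull p t y ->
  exists z n, shull p s z /\ iter n.+1 g z = y.
Proof.
elim=> [u w /(GrP (p := p)) uw|u v w _ IH1 _ IH2] y.
  have [s' [uD sD' /inJP us' ->]] := uw => gy.
  by exists (psi s' y), 0%N; split; [apply: us'; exact: (psi_shull sys)|rewrite /= (g_psi sys)].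
move=> /IH2[z [n [vz zE]]]; have [z' [m [uz zE']]] := IH1 z vz.
by exists z', (n + m.+1)%N; split => //; rewrite -addSn iterD zE'.
Qed.

Section terminal.
Context {B : {set {set V}}}.
Hypothesis Bt : G_terminal p S p' S' gamma d B.
Local Notation UB := [set x | exists2 s, s \in B & shull p s x].

Lemma UB_X x : UB x -> X x.
Proof.
by move=> [s sB]; apply: shull_subX; have [] := dsimpP sys (terminal_dsimp Bt sB).
Qed.

Lemma UB_g x : UB x -> UB (g x).
Proof.
move=> [s sB sx]; have [s' [sD' ss' sx']] := dsimp_cover sys (terminal_dsimp Bt sB) sx.
exists (gamma @: s'); first exact: (terminal_gamma sys Bt sB).
by apply: (g_shull sys) => //; have [] := dsimpP' sys sD'.
Qed.

Lemma UB_closed : closed UB.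
Proof. by have := @polyh_closed R N V p B; rewrite /polyh. Qed.

(** A symbol [t] recurring along [x] makes all of its image simplex reachable. That simplex belongs
    to [B], so by connectedness one of its points is carried exactly onto [y] by an iterate of
    [g]. *)
Lemma UB_chain x y : UB x -> UB y -> chain_rel X g x y.
Proof.
move=> UBx [u uB uy]; have [s sB sx] := UBx.
have [a [xa sa]] := itinerary_exists (terminal_dsimp Bt sB) sx.
have aB n : gamma @: a n \in B.
  elim: n => [|n IH]; have [aD _ an] := xa 0%N.
    exact: (terminal_gamma sys Bt sB).
  have [_ _ an'] := xa n; have [aD' _ _] := xa n.+1.
  exact: (terminal_gamma sys Bt IH).
have [t tio] := pigeonhole_io a.
have [n _ an] := tio 0%N.
have tB : gamma @: t \in B by rewrite -an.
have [z [m [tz zE]]] := OG_onto (terminal_conn Bt tB uB) uy.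
apply: (chain_rel_trans (itinerary_chain (UB_X UBx) xa tio tz)).
by rewrite -zE; apply: chain_rel_iter; apply: UB_X; exists (gamma @: t).
Qed.

(** The barycentre of a d-simplex has all its vertices in its carrier, so by maximality it lies in
    no other simplex; near it the polyhedron coincides with the simplex. *)
Lemma UB_interior : exists x, rel_interior X UB x.
Proof.
have [s sB] := terminal_nonempty Bt.
have sD := terminal_dsimp Bt sB; have [sS sd ind] := dsimpP sys sD.
pose c (v : V) : R := if v \in s then d.+1%:R^-1 else 0.
have c0 v : 0 <= c v by rewrite /c; case: ifP.
have cs v : v \notin s -> c v = 0 by rewrite /c => /negbTE ->.
have c1 : \sum_v c v = 1.
  by rewrite -big_mkcond/= sumr_const sd -[_ *+ _]mulr_natl divff.
pose x := \sum_v c v *: p v.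
have sx : shull p s x by exists c.
exists x; split; first exact: (shull_subX sS).
pose P (t : {set V}) := (t \in S) && (t != s).
have xP t : P t -> ~ shull p t x.
  move=> /andP[tS ts] tx; have [le _] := sys_dim sys tS.
  have bc : @bco R N V p S x = c by exact: (bcoE sys sS).
  have [_ bt _ _] := bcoP sys tS tx; move: ts; apply/negP; rewrite negbK.
  rewrite eq_sym eqEcard sd le andbT; apply/fintype.subsetP => v vs.
  apply: contraT => /bt; rewrite bc /c vs => /eqP.
  by rewrite invr_eq0 pnatr_eq0.
pose U := \bigcup_(t in [set t | P t]) shull p t.
have cU : closed U.
  by apply: closed_bigcup => [|t _]; [exact: finite_finset|exact: shull_closed].
have : nbhs x (~` U).
  by apply: open_nbhs_nbhs; split; [rewrite openC|move=> [t Pt]; exact: xP].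
rewrite -nbhs_ballE => -[e /= e0 xe]; exists e => // y [t tS ty] xy.
have [ts|ts] := eqVneq t s; first by exists s => //; rewrite -ts.
exfalso; apply: (xe y); first by rewrite -ball_normE.
by exists t => //=; rewrite /P tS.
Qed.

Lemma UB_visible : exists2 C, visible X g C & UB `<=` C.
Proof.
have [x [Xx [e e0 xe]]] := UB_interior.
have UBx : UB x by apply: xe => //; rewrite subrr normr0.
pose C := [set y | X y /\ chain_rel X g x y /\ chain_rel X g y x].
have UBC : UB `<=` C.
  by move=> y UBy; split; [exact: UB_X|split; exact: UB_chain].
exists C => //; split.
  by exists x; split => //; exact: UB_chain.
(* Orbits starting near [x] never leave the closed invariant union, so it contains their limit
   points. *)
exists x; split => //; exists e => // y Xy xy; split => // z zw.
apply: UBC; apply: UB_closed => A; rewrite -nbhs_ballE => -[r /= r0 rA].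
have [n _ nz] := zw r r0 0%N.
exists (iter n g y); split; last by apply: rA; rewrite -ball_normE /ball_/= distrC.
by elim: n {nz} => [|n IH] /=; [exact: xe|exact: UB_g].
Qed.
End terminal.
End dynamics.

(** * Ergodicity *)

Section ergodicity.
Context {R : realType} {N d : nat} {V V' : finType}.
Context {p : V -> 'rV[R]_N} {S : {set {set V}}} {p' : V' -> 'rV[R]_N} {S' : {set {set V'}}}.
Context {gamma : V' -> V} {g : 'rV[R]_N -> 'rV[R]_N}.
Hypothesis sys : simplicial_system d p S p' S' gamma g.
Local Notation D := (dsimp S d).
Local Notation D' := (dsimp S' d).
Local Notation OGr := (OG p S p' S' gamma d).
Local Notation Gr := (Grel p S p' S' gamma d).
Local Notation inJ := (@inJ R N V V' p p').
Local Notation nu := (@nu R N d V V' p p').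
Local Notation lamS := (@lamS R N d V p).
Local Notation psi := (@psi R N d V V' p p' gamma).
Local Notation X := (polyh p S).
Local Notation dist1 := (@dist1 R N V p S).
Local Notation mblR := (fun A : set 'rV[R]_N => measurable (A : set (borelT R N))).

Definition lamr (s : {set V}) (A : set 'rV[R]_N) : R := fine (lamS s A).

Lemma lamrE s A : mblR A -> lamS s A = (lamr s A)%:E.
Proof. by move=> mA; rewrite fineK//; exact: lamS_fin. Qed.

Lemma lamr_ge0 s A : 0 <= lamr s A.
Proof. by apply: fine_ge0; exact: measure_ge0. Qed.

Lemma lamr_le1 s A : mblR A -> lamr s A <= 1.
Proof. by move=> mA; rewrite -lee_fin -lamrE//; exact: probability_le1. Qed.

Lemma le_lamr s A A' : mblR A -> mblR A' -> A `<=` A' -> lamr s A <= lamr s A'.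
Proof. by move=> mA mA' AA'; rewrite -lee_fin -!lamrE//; apply: le_measure; rewrite ?inE. Qed.

Lemma lamS_congr s A A' : s \in D -> (forall x, shull p s x -> (A x <-> A' x)) -> lamS s A = lamS s A'.
Proof.
move=> sD AA'; rewrite /lamS /lamM; congr (_ * leb _ _ _)%E.
have sx x : ssimp d x -> shull p s (affm (va p s) (vA p d s) x).
  by move=> xs; rewrite (shull_dsimp sys sD); exists x.
by apply/seteqP; split => x [/= h xs]; split => //=; apply/(AA' _ (sx _ xs)).
Qed.

Lemma lamr_congr s A A' : s \in D -> (forall x, shull p s x -> (A x <-> A' x)) -> lamr s A = lamr s A'.
Proof. by move=> sD h; rewrite /lamr (lamS_congr sD h). Qed.

Lemma lamr_selfsim s A : s \in D -> mblR A ->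
  lamr s A = \sum_(s' in D' | inJ s s') nu s s' * lamr (gamma @: s') (psi s' @^-1` A).
Proof.
move=> sD mA; apply: EFin_inj; rewrite -lamrE// (lamS_selfsim sys sD mA) -sumEFin.
apply: eq_bigr => s' _; rewrite EFinM -lamrE//.
exact: (measurable_preimageT (measurable_psi s') mA).
Qed.

Lemma shull_sub_X s : s \in D -> shull p s `<=` X.
Proof. by move=> sD; apply: shull_subX; have [] := dsimpP sys sD. Qed.

Lemma measurable_X : mblR X.
Proof. by apply: measurable_closed; exact: polyh_closed. Qed.

(** Off the polyhedron [g] is arbitrary; within it the preimage is a finite union of preimages under
    affine maps, each restricted to its piece. *)
Lemma measurable_Xg A : mblR A -> mblR (X `&` g @^-1` A).
Proof.
move=> mA; pose f s' := affext d p' (p \o gamma) s'.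
have -> : X `&` g @^-1` A = \bigcup_(s' in [set s' | s' \in D']) (shull p' s' `&` f s' @^-1` A).
  have fE s' x : s' \in D' -> shull p' s' x -> f s' x = g x.
    move=> sD' [b [b0 bs b1 ->]]; have [sS' sd ind] := dsimpP' sys sD'.
    by rewrite (g_coef sys sS')// /f affextE.
  apply/seteqP; split => x.
    move=> [Xx /= gA]; have [s sD sx] := X_dsimp sys Xx.
    have [s' [sD' _ sx']] := dsimp_cover sys sD sx; exists s' => //; split => //.
    by rewrite /preimage/= fE.
  move=> [s' /= sD' [sx']]; rewrite /preimage/= fE// => gA; split => //.
  by apply: (shull_subX' sys _ sx'); have [] := dsimpP' sys sD'.
apply: (@fin_bigcup_measurable _ (borelT R N)); first exact: finite_finset.
move=> s' _; apply: (@measurableI _ (borelT R N)); first exact: measurable_shull.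
apply: (measurable_preimageT _ mA); apply: measurable_fun_cont.
exact: affext_continuous.
Qed.

Lemma lamr_pullback s A : s \in D -> mblR A ->
  lamr s (X `&` g @^-1` A) = \sum_(s' in D' | inJ s s') nu s s' * lamr (gamma @: s') A.
Proof.
move=> sD mA; rewrite lamr_selfsim//; last exact: measurable_Xg.
apply: eq_bigr => s' /andP[sD' _]; congr (_ * _).
have tD := dsimp_gamma sys sD'.
apply: lamr_congr => // x tx; rewrite /preimage/= (g_psi sys)//; split => [[]//|Ax]; split => //.
by apply: (shull_subX' sys _ (psi_shull sys sD' tx)); have [] := dsimpP' sys sD'.
Qed.

Section terminal.
Context {B : {set {set V}}}.
Hypothesis Bt : G_terminal p S p' S' gamma d B.
Local Notation v := (vB p S p' S' gamma d B).

Lemma vB_ge0 s : s \in D -> 0 <= v s.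
Proof. by have [h _ _ _] := vB_stat sys Bt; exact: h. Qed.

Lemma vB_gt0 s : s \in B -> 0 < v s.
Proof.
move=> sB; have sD := terminal_dsimp Bt sB; rewrite lt0r vB_ge0// andbT.
by have [_ _ _ h] := vB_stat sys Bt; move: sB; rewrite -{1}h inE => /andP[].
Qed.

Lemma vB_out s : s \in D -> s \notin B -> v s = 0.
Proof.
move=> sD; have [_ _ _ h] := vB_stat sys Bt; rewrite -{1}h inE sD/= negbK.
by move=> /eqP.
Qed.

Lemma vB_sumB (F : {set V} -> R) : \sum_(s in D) F s * v s = \sum_(s in B) F s * v s.
Proof.
rewrite big_mkcond [RHS]big_mkcond; apply: eq_bigr => s _.
case: ifPn => sD; case: ifPn => sB //; first by rewrite vB_out// mulr0.
by rewrite (terminal_dsimp Bt sB) in sD.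
Qed.

Lemma vB_sum1 : \sum_(s in B) v s = 1.
Proof.
have [_ <- _ _] := vB_stat sys Bt.
by have := vB_sumB (fun=> 1); under eq_bigr do rewrite mul1r; under [RHS]eq_bigr do rewrite mul1r.
Qed.

Lemma lamBE A : mblR A ->
  mval (lamB p S p' S' gamma d B) A = (\sum_(s in B) v s * lamr s A)%:E.
Proof.
move=> mA; rewrite /= -sumEFin; apply: eq_bigr => s _.
by rewrite EFinM lamE// -lamrE.
Qed.

Lemma lamB_invariant : invariant_meas X g (lamB p S p' S' gamma d B).
Proof.
move=> A mA; rewrite !lamBE//; last exact: measurable_Xg.
congr (_%:E).
transitivity (\sum_(s in B) \sum_(s2 in D) Gamma p p' S' gamma d s2 s * lamr s2 A * v s).
  apply: eq_bigr => s sB; have sD := terminal_dsimp Bt sB.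
  by rewrite lamr_pullback// -(Gamma_sum sys (fun s => lamr s A) sD) mulrC mulr_suml.
rewrite exchange_big/=.
transitivity (\sum_(s2 in D) lamr s2 A * v s2); last first.
  by rewrite vB_sumB; apply: eq_bigr => s _; rewrite mulrC.
apply: eq_bigr => s2 s2D; have [_ _ h _] := vB_stat sys Bt.
rewrite -h// mulr_sumr.
transitivity (\sum_(s in D) (lamr s2 A * Gamma p p' S' gamma d s2 s) * v s).
  by rewrite vB_sumB; apply: eq_bigr => s _; congr (_ * _); rewrite mulrC.
by apply: eq_bigr => s _; rewrite mulrA.
Qed.

Lemma lamB_setT : mval (lamB p S p' S' gamma d B) setT = 1%E.
Proof.
rewrite lamBE; last exact: measurableT.
rewrite (eq_bigr v) ?vB_sum1// => s _.
by rewrite /lamr (@probability_setT _ _ _ (lamS s)) mulr1.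
Qed.

Section invariant_set.
Context {A : set 'rV[R]_N}.
Hypotheses (mA : mblR A) (Ainv : X `&` g @^-1` A = X `&` A).

Lemma invariantP y : X y -> A (g y) <-> A y.
Proof.
move=> Xy; split => Ay.
  by have [] : (X `&` A) y by rewrite -Ainv.
by have [] : (X `&` g @^-1` A) y by rewrite Ainv.
Qed.

Lemma invariant_harmonic s : s \in D ->
  lamr s A = \sum_(s' in D' | inJ s s') nu s s' * lamr (gamma @: s') A.
Proof.
move=> sD; rewrite -lamr_pullback// Ainv; apply: lamr_congr => // x sx.
by split => [Ax|[]//]; split => //; exact: (shull_sub_X sD).
Qed.

Lemma invariant_const : exists c, [/\ 0 <= c, c <= 1 & forall s, s \in B -> lamr s A = c].
Proof.
have [b0 b0B] := terminal_nonempty Bt.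
pose s0 := [arg max_(s > b0 in B) lamr s A]%O.
have [s0B s0max] : s0 \in B /\ forall s, s \in B -> lamr s A <= lamr s0 A.
  by rewrite /s0; case: arg_maxP.
exists (lamr s0 A); split; [exact: lamr_ge0|exact: lamr_le1|] => s sB.
have [] := @subharmonic_max _ _ _ _ _ _ _ _ _ _ _ sys B (fun s => lamr s A) (lamr s0 A) _ _ _
  s0 s (terminal_conn Bt s0B sB) s0B erefl => //.
- by move=> ? ? uB; exact: (terminal_closed Bt).
- by move=> u uB; rewrite invariant_harmonic//; exact: (terminal_dsimp Bt).
Qed.

Variable c : R.
Hypotheses (c0 : 0 <= c) (Ac : forall s, s \in B -> lamr s A = c).

(* Every piece of [D1] is blown up by the expanding map to a full simplex, on which
   [A] has density [c]; hence [A] has density at least [c] near [D1]. *)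
Lemma density_near k : 0 <= k ->
  (forall s' x y, s' \in D' -> shull p' s' x -> shull p' s' y -> dist1 x y <= k * dist1 (g x) (g y)) ->
  forall n (D1 D2 : set 'rV[R]_N), mblR D1 -> mblR D2 ->
  (forall x y, X x -> X y -> dist1 x y <= k ^+ n * 2 -> D1 x -> D2 y) ->
  forall s, s \in B -> c * lamr s D1 <= lamr s (A `&` D2).
Proof.
move=> k0 kP; elim=> [|n IH] D1 D2 m1 m2 D12 s sB; have sD := terminal_dsimp Bt sB.
  (* For [n = 0] the allowed distance 2 exceeds every distance in the polyhedron, so a single point
     of [D1] in [s] forces [s] into [D2]. *)
  have [[x sx Dx]|H] := pselect (exists2 x, shull p s x & D1 x).
    have -> : lamr s (A `&` D2) = lamr s A.
      apply: lamr_congr => // y sy; split => [[]//|Ay]; split => //.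
      apply: (D12 x) => //; [exact: (shull_sub_X sD)|exact: (shull_sub_X sD)|].
      by rewrite mul1r; apply: (dist1_le2 sys); exact: (shull_sub_X sD).
    by rewrite Ac// ler_piMr// lamr_le1.
  rewrite (_ : lamr s D1 = 0) ?mulr0 ?lamr_ge0//.
  rewrite /lamr (lamS_out sys sD) //; apply/seteqP; split => // x [Dx sx].
  by apply: H; exists x.
have mAD : mblR (A `&` D2) by exact: (@measurableI _ (borelT R N)).
rewrite (lamr_selfsim sD m1) (lamr_selfsim sD mAD) mulr_sumr; apply: ler_sum => s' /andP[sD' ss'].
rewrite mulrCA ler_pM2l ?(nu_gt0 sys)//.
have tB := terminal_gamma sys Bt sB sD' ss'.
have tD := terminal_dsimp Bt tB.
pose t := gamma @: s'.
have mt : mblR (shull p t) by exact: measurable_shull.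
have mp := measurable_psi (p := p) (p' := p') (gamma := gamma) (d := d) s'.
(* The inductive hypothesis compares arbitrary points of the polyhedron, but the inverse branch is
   controlled only on [t]. So the first set is cut down to [t] and the second is filled up outside
   it; neither changes the measures on [t]. *)
have mE1 : mblR (psi s' @^-1` D1 `&` shull p t).
  by apply: (@measurableI _ (borelT R N)) => //; exact: (measurable_preimageT mp m1).
have mE2 : mblR (psi s' @^-1` D2 `|` ~` shull p t).
  apply: (@measurableU _ (borelT R N)); first exact: (measurable_preimageT mp m2).
  exact: (@measurableC _ (borelT R N)).
have := IH _ _ mE1 mE2 _ t tB.
have -> : lamr t (psi s' @^-1` D1 `&` shull p t) = lamr t (psi s' @^-1` D1).
  by apply: lamr_congr => // x tx; split => [[]//|].
have -> : lamr t (A `&` (psi s' @^-1` D2 `|` ~` shull p t)) = lamr t (psi s' @^-1` (A `&` D2)).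
  apply: lamr_congr => // x tx.
  have Xp : X (psi s' x).
    by apply: (shull_subX' sys _ (psi_shull sys sD' tx)); have [] := dsimpP' sys sD'.
  have := invariantP Xp; rewrite (g_psi sys)// => AE.
  split; first by move=> [/AE Ax [D2x|//]]; split.
  by move=> [/AE Ax D2x]; split => //; left.
apply=> x y Xx Xy xy [D1x tx].
have [ty|] := pselect (shull p t y); last by right.
left; have [sS' _ _] := dsimpP' sys sD'.
apply: (D12 (psi s' x)) => //.
- exact: (shull_subX' sys sS' (psi_shull sys sD' tx)).
- exact: (shull_subX' sys sS' (psi_shull sys sD' ty)).
apply: le_trans (kP s' _ _ sD' (psi_shull sys sD' tx) (psi_shull sys sD' ty)) _.
by rewrite !(g_psi sys)// exprS -mulrA ler_wpM2l.
Qed.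

Lemma density_open U s : open U -> s \in B -> c * lamr s U <= lamr s (A `&` U).
Proof.
move=> oU sB; have sD := terminal_dsimp Bt sB.
have mU : mblR U by exact: measurable_open.
have [C [C0 Cd]] := dist1_norm sys.
have [k [k0 k1 kP]] := g_contraction sys.
(* Points of [Um m] are at distance at least [1/(m+1)] from the complement of [U]. Once [k ^+ n] is
   small enough, [density_near] applies to this set and [U], and these sets exhaust [U] within the
   polyhedron. *)
pose Um m : set 'rV[R]_N := ~` \bigcup_(z in ~` U) ball z (m.+1%:R^-1).
have mUm m : mblR (Um m).
  apply: (@measurableC _ (borelT R N)); apply: measurable_open.
  by apply: bigcup_open => z _; exact: ball_open.
have UmP m : c * lamr s (X `&` Um m) <= lamr s (A `&` U).
  have e0 : (0 : R) < m.+1%:R^-1 by rewrite invr_gt0.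
  have [n Hn] := geometric_small (C * 2) k0 k1 e0.
  apply: (density_near k0 kP (n := n)) => //.
    by apply: (@measurableI _ (borelT R N)) => //; exact: measurable_X.
  move=> x y Xx Xy xy [_ Ux]; apply: contrapT => Uy; apply: Ux; exists y => //.
  rewrite -ball_normE /ball_/= distrC.
  apply: le_lt_trans (Cd _ _ Xx Xy) _; apply: le_lt_trans (Hn n (leqnn n)).
  by rewrite -mulrA (mulrC 2) ler_wpM2l// ltW.
have UmE : \bigcup_m (X `&` Um m) = X `&` U.
  apply/seteqP; split => x.
    move=> [m _ [Xx Ux]]; split => //; apply: contrapT => nUx; apply: Ux.
    by exists x => //; exact: ballxx.
  move=> [Xx Ux]; have : nbhs x U by apply: open_nbhs_nbhs.
  rewrite -nbhs_ballE => -[e /= e0 xe].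
  have [m _ /(_ m (leqnn m)) Hm] := near_infty_natSinv_lt (PosNum e0).
  exists m => //; split => // -[z nUz zx]; apply: nUz; apply: xe.
  by apply: ball_sym; apply: le_ball zx; exact: ltW.
have mXU m : mblR (X `&` Um m).
  by apply: (@measurableI _ (borelT R N)) => //; exact: measurable_X.
have cv : (lamS s (X `&` Um m) @[m --> \oo] --> lamS s (X `&` U)).
  rewrite -UmE; apply: nondecreasing_cvg_mu => //.
    by rewrite UmE; apply: (@measurableI _ (borelT R N)) => //; exact: measurable_X.
  apply/nondecreasing_seqP => m; apply/subsetPset => x [Xx Ux]; split => //.
  move=> [z nUz zx]; apply: Ux; exists z => //; apply: le_ball zx.
  by rewrite lef_pV2 ?posrE// ler_nat.
have -> : lamr s U = lamr s (X `&` U).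
  by apply: lamr_congr => // x sx; split => [Ux|[]//]; split => //; exact: (shull_sub_X sD).
have cvr : (c * lamr s (X `&` Um m) @[m --> \oo] --> c * lamr s (X `&` U)).
  by apply: cvgMr; apply: fine_cvg; rewrite -lamrE//; apply: (@measurableI _ (borelT R N)) => //; exact: measurable_X.
rewrite -(cvg_lim _ cvr)//; apply: limr_le; first exact: cvgP cvr.
by apply: nearW.
Qed.
End invariant_set.

Lemma lamB_ergodic : ergodic_inv_prob X g (lamB p S p' S' gamma d B).
Proof.
split; [exact: lamB_setT|exact: lamB_invariant|] => A mA Ainv.
have [c [c0 c1 Ac]] := invariant_const mA Ainv.
have mC : mblR (~` A) by exact: (@measurableC _ (borelT R N)).
have Cinv : X `&` g @^-1` (~` A) = X `&` ~` A.
  apply/seteqP; split => x [Xx nA]; split => // Ax; apply: nA.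
    exact/(invariantP Ainv Xx).
  exact/(invariantP Ainv Xx).
have Cc s : s \in B -> lamr s (~` A) = 1 - c.
  move=> sB; rewrite -(Ac s sB) /lamr (@probability_setC _ _ _ (lamS s)) // fineB ?lamS_fin//.
(* The set and its complement have the lower densities [c] and [1 - c]; these add up to 1, so both
   bounds are equalities. *)
have open_eq s U : open U -> s \in B -> lamr s (A `&` U) = c * lamr s U.
  move=> oU sB; have mU : mblR U by exact: measurable_open.
  have h1 := density_open mA Ainv c0 Ac oU sB.
  have c0' : 0 <= 1 - c by rewrite subr_ge0.
  have h2 := density_open mC Cinv c0' Cc oU sB.
  have : lamr s U = lamr s (~` A `&` U) + lamr s (A `&` U).
    apply: EFin_inj; rewrite EFinD -!lamrE//; try exact: (@measurableI _ (borelT R N)).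
    by rewrite (measureDI (lamS s) mU mA) setDE setIC [U `&` A]setIC.
  move: h2; rewrite mulrBl mul1r => h2 h3; apply/le_anti; rewrite h1 andbT; lra.
have [s sB] := terminal_nonempty Bt.
(* The restriction of the simplex measure to [A] and its multiple by [c] agree on open sets, which
   are stable under intersection and generate the Borel sets. Evaluating both at [A] itself gives
   [c = c * c]. *)
pose m1 : {measure set (borelT R N) -> \bar R} := mrestr (lamS s) mA.
pose m2 : {measure set (borelT R N) -> \bar R} := mscale (NngNum c0) (lamS s).
have m1E U : mblR U -> m1 U = (lamr s (A `&` U))%:E.
  by move=> mU; rewrite -[LHS]/(lamS s (U `&` A)) setIC lamrE//; exact: (@measurableI _ (borelT R N)).
have m2E U : mblR U -> m2 U = (c * lamr s U)%:E.
  by move=> mU; rewrite -[LHS]/(c%:E * lamS s U)%E lamrE.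
have m12 : m1 A = m2 A.
  apply: (@measure_unique _ R (borelT R N) (@open 'rV[R]_N) (fun=> setT)) => //.
  - by move=> U1 U2; exact: openI.
  - by move=> _; exact: openT.
  - by rewrite bigcup_const.
  - move=> U oU; have mU : mblR U by exact: measurable_open.
    by rewrite m1E// m2E// open_eq.
  - by move=> _; rewrite m1E ?ltry.
move: m12; rewrite m1E// m2E// setIid Ac// => -[cc].
have lB : mval (lamB p S p' S' gamma d B) A = c%:E.
  rewrite lamBE//; congr (_%:E); rewrite (eq_bigr (fun s => v s * c)).
    by rewrite -mulr_suml vB_sum1 mul1r.
  by move=> t tB; rewrite Ac.
rewrite lB; have [->|cN0] := eqVneq c 0; first by left.
by right; congr (_%:E); apply: (mulfI cN0); rewrite mulr1.
Qed.

Lemma msupp_lamB : msupp (lamB p S p' S' gamma d B) = [set x | exists2 s, s \in B & shull p s x].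
Proof.
apply/seteqP; split => x.
  move=> xs; apply: contrapT => nx.
  have : nbhs x (~` [set x | exists2 s, s \in B & shull p s x]).
    apply: open_nbhs_nbhs; split => //; rewrite openC.
    exact: (UB_closed (B := B)).
  rewrite -nbhs_ballE => -[e /= e0 xe].
  have := xs e e0; rewrite lamBE; last by apply: measurable_open; exact: ball_open.
  rewrite big1 ?ltxx// => s sB; rewrite /lamr (lamS_out sys (terminal_dsimp Bt sB)) ?mulr0//.
  by apply/seteqP; split => // y [/xe nBy sy]; apply: nBy; exists s.
move=> [s sB sx] e e0; have mb : mblR (ball x e) by apply: measurable_open; exact: ball_open.
have sD := terminal_dsimp Bt sB.
rewrite lamBE// lte_fin (bigD1 s)//= ltr_pwDl//.
  by rewrite mulr_gt0 ?vB_gt0// -lte_fin -lamrE//; exact: (lamS_ball_gt0 sys).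
apply: sumr_ge0 => t /andP[tB _]; rewrite mulr_ge0 ?lamr_ge0//; exact/ltW/vB_gt0.
Qed.

Lemma UB_Bstar : [set x | exists2 s, s \in B & shull p s x] =
  [set x | exists2 s', Bstar p p' S' gamma d B s' & shull p' s' x].
Proof.
apply/seteqP; split => x.
  move=> [s sB sx]; have [s' [sD' ss' sx']] := dsimp_cover sys (terminal_dsimp Bt sB) sx.
  exists s' => //; split => //; first exact: (terminal_gamma sys Bt sB).
  by exists s => //; exact/inJP.
by move=> [s' [sD' _ [s sB ss']] sx]; exists s => //; exact: ss'.
Qed.

End terminal.
End ergodicity.

(** * Genericity *)

(* In the step function of a list of rational balls with values, the last ball of the
   list containing a point decides.  Only countably many cells occur, so one null set
   serves all continuous functions in the proof of genericity. *)
Section step_functions.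
Context {R : realType} {N : nat}.
Local Notation idx := ('rV[rat]_N * nat)%type.

Definition lball (l : seq idx) : set 'rV[R]_N := \big[setU/set0]_(q <- l) ratball q.

Definition cell (l : seq idx) : set 'rV[R]_N :=
  if l is q :: l' then ratball q `\` lball l' else set0.

Fixpoint stepf (l : seq (idx * R)) (y : 'rV[R]_N) : R :=
  if l is (q, v) :: l' then v * \1_(cell (q :: unzip1 l')) y + stepf l' y else 0.

Lemma measurable_lball l : measurable (lball l : set (borelT R N)).
Proof. by apply: (@bigsetU_measurable _ (borelT R N)) => q _; exact: measurable_ratball. Qed.

Lemma measurable_cell l : measurable (cell l : set (borelT R N)).
Proof.
case: l => [|q l]; first exact: measurable0.
by apply: (@measurableD _ (borelT R N)); [exact: measurable_ratball|exact: measurable_lball].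
Qed.

Lemma measurable_stepf l : measurable_fun setT (stepf l : borelT R N -> R).
Proof.
elim: l => [|[q v] l IH]; first exact: measurable_cst.
apply: measurable_funD => //; apply: measurable_funM; first exact: measurable_cst.
by apply: measurable_indic; exact: measurable_cell.
Qed.

Lemma stepf_bounded l : exists M, forall y, `|stepf l y| <= M.
Proof.
elim: l => [|[q v] l [M HM]]; first by exists 0 => y /=; rewrite normr0.
exists (`|v| + M) => y /=; rewrite (le_trans (ler_normD _ _))// lerD//.
rewrite normrM ler_piMr// indicE; by case: (_ \in _); rewrite ?normr0 ?normr1.
Qed.

Lemma stepf_out l y : ~ lball (unzip1 l) y -> stepf l y = 0.
Proof.
elim: l => [//|[q v] l IH] /=; rewrite /lball big_cons => /not_orP[nq nl].
by rewrite IH// indicE memNset ?mulr0 ?addr0// => -[].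
Qed.

Lemma stepf_approx (A : set 'rV[R]_N) (u : 'rV[R]_N -> R) (e : R) l y :
  (forall q v, (q, v) \in l -> forall z, A z -> ratball q z -> `|u z - v| < e) ->
  A y -> lball (unzip1 l) y -> `|u y - stepf l y| < e.
Proof.
elim: l => [_ _|[q v] l IH H Ay]; first by rewrite /lball/= big_nil.
rewrite /lball /= big_cons => yl.
have [ly|nly] := pselect (lball (unzip1 l) y).
  rewrite indicE memNset ?mulr0 ?add0r; last by move=> [].
  by apply: IH => // q' v' qv; apply: H; rewrite inE qv orbT.
have qy : ratball q y by case: yl.
rewrite stepf_out// addr0 indicE mem_set// mulr1.
by apply: (H q v) => //; rewrite inE eqxx.
Qed.

(** Compactness extracts finitely many rational balls on each of which [u] stays within [e] of one
    value. *)
Lemma continuous_stepf (A : set 'rV[R]_N) (u : 'rV[R]_N -> R) (e : R) : compact A ->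
  {within A, continuous u} -> 0 < e -> exists l, forall y, A y -> `|u y - stepf l y| < e.
Proof.
move=> cA cu e0.
pose Q : set (idx * R) := [set qv | forall z, A z -> ratball qv.1 z -> `|u z - qv.2| < e].
have cover : A `<=` \bigcup_(qv in Q) (ratball qv.1 : set 'rV[R]_N).
  move=> y Ay.
  have /subspace_continuousP/(_ y Ay)/cvgrPdist_lt/(_ e e0) := cu.
  rewrite near_withinE -nbhs_ballE => -[r /= r0 yr].
  have [q [qy qr]] := ratball_sub y r0.
  exists (q, u y) => // z Az qz; rewrite distrC; apply: yr => //; exact: qr.
have := cA; rewrite compact_cover => /(_ _ Q (fun qv => ratball qv.1)).
case=> [qv _|//|F FQ Fcov]; first exact: ball_open.
exists (finmap.enum_fset F) => y Ay; apply: (@stepf_approx A) => //.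
  by move=> q v qF z Az; have := FQ _ qF; rewrite inE => /(_ z Az).
have [qv qF qy] := Fcov y Ay.
rewrite /lball -bigcup_seq; exists qv.1 => //=.
by apply/mapP; exists qv.
Qed.
End step_functions.

Section probability_of_measure.
Context d (T : measurableType d) (R : realType) (m : {measure set T -> \bar R}).
Hypothesis m1 : m setT = 1%E.

(** The proof of total mass 1 is an argument so that the probability instance can be attached to the
    term. *)
Definition probability_of of m setT = 1%E : set T -> \bar R := m.
Local Notation mu := (probability_of m1).

Let mu0 : mu set0 = 0%E. Proof. exact: measure0. Qed.
Let mu_ge0 A : (0 <= mu A)%E. Proof. exact: measure_ge0. Qed.
Let mu_sigma : semi_sigma_additive mu. Proof. exact: (@measure_semi_sigma_additive _ _ _ m). Qed.
HB.instance Definition _ := isMeasure.Build _ _ _ mu mu0 mu_ge0 mu_sigma.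
HB.instance Definition _ := Measure_isProbability.Build _ _ _ mu m1.

Lemma probability_of_measure : exists P : probability T R, forall A, P A = m A.
Proof. by exists mu. Qed.
End probability_of_measure.

Section genericity.
Context {R : realType} {N d : nat} {V V' : finType}.
Context {p : V -> 'rV[R]_N} {S : {set {set V}}} {p' : V' -> 'rV[R]_N} {S' : {set {set V'}}}.
Context {gamma : V' -> V} {g : 'rV[R]_N -> 'rV[R]_N}.
Hypothesis sys : simplicial_system d p S p' S' gamma g.
Local Notation D := (dsimp S d).
Local Notation D' := (dsimp S' d).
Local Notation OGr := (OG p S p' S' gamma d).
Local Notation Gr := (Grel p S p' S' gamma d).
Local Notation inJ := (@inJ R N V V' p p').
Local Notation nu := (@nu R N d V V' p p').
Local Notation lamS := (@lamS R N d V p).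
Local Notation psi := (@psi R N d V V' p p' gamma).
Local Notation X := (polyh p S).
Local Notation dist1 := (@dist1 R N V p S).
Local Notation mblR := (fun A : set 'rV[R]_N => measurable (A : set (borelT R N))).
Local Notation lamr := (@lamr R N d V p).

(** Extending by the identity off the polyhedron gives a Borel map of the whole space, as the
    ergodic theorem requires, without changing orbits inside. *)
Definition gX (x : 'rV[R]_N) : 'rV[R]_N := if `[< X x >] then g x else x.

Lemma gX_in x : X x -> gX x = g x.
Proof. by move=> Xx; rewrite /gX asboolT. Qed.

Lemma iter_gX n x : X x -> iter n gX x = iter n g x.
Proof. by move=> Xx; elim: n => //= n ->; rewrite gX_in//; exact: (iter_g_X sys). Qed.

Lemma gX_preimage A : gX @^-1` A = (X `&` g @^-1` A) `|` (~` X `&` A).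
Proof.
apply/seteqP; split => x; rewrite /preimage/= /gX.
  by case: asboolP => Xx h; [left|right].
by case: asboolP => Xx [[]|[]].
Qed.

Lemma measurable_gX : measurable_fun setT (gX : borelT R N -> borelT R N).
Proof.
move=> _ A mA; rewrite setTI gX_preimage; apply: measurableU.
  exact: (measurable_Xg sys).
by apply: measurableI => //; apply: measurableC; exact: measurable_X.
Qed.

Section terminal.
Context {B : {set {set V}}}.
Hypothesis Bt : G_terminal p S p' S' gamma d B.
Local Notation v := (vB p S p' S' gamma d B).
Local Notation muB := (lamB p S p' S' gamma d B).

Lemma lamB_probability : exists P : probability (borelT R N) R, forall A, mblR A -> P A = mval muB A.
Proof.
pose nB k := nth finset.set0 (enum B) k.
pose mm k : {measure set (borelT R N) -> \bar R} := mscale (NngNum (normr_ge0 (v (nB k)))) (lamS (nB k)).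
pose m : {measure set (borelT R N) -> \bar R} := msum mm #|B|.
have mE A : mblR A -> m A = mval muB A.
  move=> mA; rewrite lamBE// -sumEFin -big_enum (big_nth finset.set0) -cardE big_mkord.
  apply: eq_bigr => k _; rewrite -[LHS]/(`|v (nB k)|%:E * lamS (nB k) A)%E.
  have kB : nB k \in B by rewrite -mem_enum mem_nth// -cardE.
  by rewrite ger0_norm ?(ltW (vB_gt0 sys Bt kB))// lamrE// EFinM.
have m1 : m setT = 1%E by rewrite mE ?(lamB_setT sys Bt).
have [P PE] := probability_of_measure m1.
by exists P => A mA; rewrite PE mE.
Qed.

Lemma visit_frequency A : mblR A -> exists Z, [/\ mblR Z, mval muB Z = 0%E &
  forall x, X x -> ~ Z x ->
    n%:R^-1 * (\sum_(i < n) \1_A (iter i g x)) @[n --> \oo] --> \sum_(s in B) v s * lamr s A].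
Proof.
move=> mA; have [P PE] := lamB_probability.
have Pinv U : mblR U -> P (gX @^-1` U) = P U.
  move=> mU; have mgU : mblR (gX @^-1` U) by exact: (measurable_preimageT measurable_gX mU).
  have mXU := measurable_Xg sys mU.
  rewrite !PE// -(lamB_invariant sys Bt mU) !lamBE//; congr (_%:E).
  apply: eq_bigr => s sB; congr (_ * _); have sD := terminal_dsimp Bt sB.
  apply: (lamr_congr sys sD) => x sx; have Xx := shull_sub_X sys sD sx.
  by rewrite gX_preimage; split => [[//|[]//]|]; left.
have Perg U : mblR U -> gX @^-1` U = U -> P U = 0%E \/ P U = 1%E.
  move=> mU UE; rewrite PE//; have [_ _ h] := lamB_ergodic sys Bt.
  apply: h => //; apply/seteqP; split => x [Xx Ux]; split => //.
    by rewrite -UE gX_preimage; left.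
  by move: Ux; rewrite -{1}UE gX_preimage => -[[]//|[]//].
have mI : measurable_fun setT (\1_A : borelT R N -> R) by exact: measurable_indic.
have bI x : `|\1_A x : R| <= 1 by rewrite indicE; case: (_ \in _); rewrite ?normr0 ?normr1.
have [Z [mZ Z0 HZ]] := birkhoff_ergodic measurable_gX Pinv Perg mI bI.
exists Z; split => //; first by rewrite -PE.
move=> x Xx Zx; have := HZ x Zx.
have -> : (\int[P]_x \1_A x)%R = \sum_(s in B) v s * lamr s A.
  rewrite /Rintegral integral_indic// setIT.
  exact: (congr1 fine (etrans (PE _ mA) (lamBE mA))).
rewrite (_ : (fun n => _) = (fun n => n%:R^-1 * \sum_(i < n) \1_A (iter i g x)))//.
apply/funext => n; congr (_ * _); rewrite /birkhoff_sum.
by apply: eq_bigr => i _; rewrite iter_gX.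
Qed.

Lemma visit_frequency_cells : exists Z, [/\ mblR Z, mval muB Z = 0%E &
  forall x, X x -> ~ Z x -> forall l,
    n%:R^-1 * (\sum_(i < n) \1_(cell l) (iter i g x)) @[n --> \oo] --> \sum_(s in B) v s * lamr s (cell l)].
Proof.
have /choice[Z HZ] := fun l => visit_frequency (@measurable_cell R N l).
have [P PE] := lamB_probability.
pose F k : set (borelT R N) := if (unpickle k : option (seq ('rV[rat]_N * nat))) is Some l then Z l else set0.
have mF k : measurable (F k).
  by rewrite /F; case: unpickle => [l|//]; have [] := HZ l.
exists (\bigcup_k F k); split.
- exact: bigcupT_measurable.
- rewrite -PE; last exact: bigcupT_measurable.
  apply: measure0_bigcup => // k; rewrite /F; case: unpickle => [l|]; last exact: measure0.
  by have [mZ Z0 _] := HZ l; exact: etrans (PE _ mZ) Z0.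
- move=> x Xx nZ l; have [_ _ h] := HZ l; apply: h => // Zx; apply: nZ.
  by exists (pickle l) => //; rewrite /F pickleK.
Qed.

Definition stepI l : R := \sum_(s in B) v s * cint (d := d) p s (stepf l).

Lemma stepf_average x : (forall l,
    n%:R^-1 * (\sum_(i < n) \1_(cell l) (iter i g x)) @[n --> \oo] --> \sum_(s in B) v s * lamr s (cell l)) ->
  forall l, n%:R^-1 * (\sum_(i < n) stepf l (iter i g x)) @[n --> \oo] --> stepI l.
Proof.
move=> H; elim=> [|[q w] l IH].
  rewrite (_ : (fun n => _) = fun=> 0); last first.
    by apply/funext => n; rewrite big1 ?mulr0.
  rewrite (_ : stepI [::] = 0); first exact: cvg_cst.
  rewrite /stepI big1// => s _; rewrite (_ : cint _ _ _ = 0) ?mulr0//.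
  have := @cint_indic R N d V p s set0 0 measurable0; rewrite mul0r => <-.
  by congr (cint _ _ _); apply/funext => y /=; rewrite mul0r.
have -> : stepI ((q, w) :: l) = w * (\sum_(s in B) v s * lamr s (cell (q :: unzip1 l))) + stepI l.
  rewrite /stepI mulr_sumr -big_split/=; apply: eq_bigr => s _.
  have [M HM] := stepf_bounded l.
  have mc := @measurable_cell R N (q :: unzip1 l).
  rewrite (@cintD R N d V p s (fun y => w * \1_(cell (q :: unzip1 l)) y) (stepf l) `|w| M)//.
  - by rewrite cint_indic// mulrDr; congr (_ + _); rewrite mulrCA.
  - by apply: measurable_funM; [exact: measurable_cst|exact: measurable_indic].
  - exact: measurable_stepf.
  - move=> y; rewrite normrM ler_piMr// indicE; by case: (_ \in _); rewrite ?normr0 ?normr1.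
rewrite (_ : (fun n => _) = fun n => w * (n%:R^-1 * (\sum_(i < n) \1_(cell (q :: unzip1 l)) (iter i g x)))
    + n%:R^-1 * (\sum_(i < n) stepf l (iter i g x))); last first.
  apply/funext => n; rewrite [w * (_ * _)]mulrCA -mulrDr; congr (_ * _).
  by rewrite mulr_sumr -big_split.
by apply: cvgD => //; apply: cvgMr; exact: H.
Qed.

(** Extension by zero is Borel because it is a pointwise limit of step functions multiplied by the
    indicator of the polyhedron. *)
Lemma cutoff (u : 'rV[R]_N -> R) : {within X, continuous u} ->
  exists U : borelT R N -> R, exists M, [/\ measurable_fun setT U, forall x, `|U x| <= M &
    forall x, X x -> U x = u x].
Proof.
move=> cu; exists (fun x => if `[< X x >] then u x else 0).
have cX : compact X by exact: polyh_compact.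
have /choice[l Hl] : forall n : nat, exists l, forall y, X y -> `|u y - stepf l y| < n.+1%:R^-1.
  by move=> n; apply: continuous_stepf => //; rewrite invr_gt0.
have [M HM] := stepf_bounded (l 0%N).
exists (M + 1); split.
- apply: (@measurable_fun_cvg _ (borelT R N) _ setT (fun n x => \1_X x * stepf (l n) x)).
    move=> n; apply: measurable_funM; last exact: measurable_stepf.
    by apply: measurable_indic; exact: measurable_X.
  move=> x _; case: asboolP => Xx.
    rewrite (_ : (fun n => _) = fun n => stepf (l n) x); last first.
      by apply/funext => n; rewrite indicE mem_set// mul1r.
    apply/cvgrPdist_lt => e e0; near=> n.
    apply: lt_trans (Hl n x Xx) _.
    near: n; exact: (near_infty_natSinv_lt (PosNum e0)).
  rewrite (_ : (fun n => _) = fun=> 0); first exact: cvg_cst.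
  by apply/funext => n; rewrite indicE memNset// mul0r.
- move=> x; case: asboolP => Xx; last by rewrite normr0 (le_trans (normr_ge0 (stepf (l 0%N) x)))// (le_trans (HM x))// lerDl.
  have := Hl 0%N x Xx; rewrite invr1 => h.
  rewrite -(subrK (stepf (l 0%N) x) (u x)) (le_trans (ler_normD _ _))// addrC lerD// ltW//.
- by move=> x Xx; rewrite asboolT.
Unshelve. all: by end_near. Qed.

Lemma generic_of_cells x : X x -> (forall l,
    n%:R^-1 * (\sum_(i < n) \1_(cell l) (iter i g x)) @[n --> \oo] --> \sum_(s in B) v s * lamr s (cell l)) ->
  generic X g muB x.
Proof.
move=> Xx H u cu.
have [U [M [mU UM UE]]] := cutoff cu.
have -> : mint muB u = (\sum_(s in B) v s * cint (d := d) p s U)%:E.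
  rewrite /= -sumEFin; apply: eq_bigr => s sB; have sD := terminal_dsimp Bt sB.
  rewrite EFinM (@lamintE R N d V p s u U M)// => y; rewrite -(shull_dsimp sys sD) => sy.
  by rewrite UE//; exact: (shull_sub_X sys sD).
apply: cvg_EFin; first by apply: nearW.
apply/cvgrPdist_lt => e e0.
(* Replacing [u] by a step function costs [e / 4] in the space mean and in the time mean; the two
   means of the step function eventually differ by less than [e / 4]. *)
have e4 : 0 < e / 4 by rewrite divr_gt0.
have [l Hl] := continuous_stepf (@polyh_compact R N V p S) cu e4.
have IU : `|\sum_(s in B) v s * cint (d := d) p s U - stepI l| <= e / 4.
  rewrite /stepI -sumrB; under eq_bigr do rewrite -mulrBr.
  have -> : e / 4 = \sum_(s in B) v s * (e / 4) by rewrite -mulr_suml (vB_sum1 sys Bt) mul1r.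
  apply: le_trans (ler_norm_sum _ _ _) _; apply: ler_sum => s sB.
  have sD := terminal_dsimp Bt sB; have v0 := ltW (vB_gt0 sys Bt sB).
  rewrite normrM ger0_norm// ler_wpM2l//.
  have [M' HM'] := stepf_bounded l.
  apply: (cint_approx mU (@measurable_stepf R N l) UM HM') => y.
  rewrite -(shull_dsimp sys sD) => sy; have Xy := shull_sub_X sys sD sy.
  by rewrite UE// ltW// Hl.
have /cvgrPdist_lt/(_ _ e4) S1 := stepf_average H (l := l).
near=> n.
have h1 : `|stepI l - n%:R^-1 * (\sum_(i < n) stepf l (iter i g x))| < e / 4 by near: n.
have n0 : (0 : R) < n%:R by rewrite ltr0n; near: n; exists 1%N.
have h2 : `|n%:R^-1 * (\sum_(i < n) stepf l (iter i g x)) - n%:R^-1 * \sum_(i < n) u (iter i g x)| <= e / 4.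
  rewrite -mulrBr -sumrB normrM gtr0_norm ?invr_gt0// mulrC ler_pdivrMr//.
  apply: le_trans (ler_norm_sum _ _ _) _.
  apply: le_trans (_ : \sum_(i < n) (e / 4) <= _); last by rewrite sumr_const card_ord mulr_natr.
  apply: ler_sum => i _; rewrite distrC ltW// Hl//; exact: (iter_g_X sys).
have -> : \sum_(s in B) v s * cint (d := d) p s U - (n%:R)^-1 * (\sum_(i < n) u (iter i g x)) =
  (\sum_(s in B) v s * cint (d := d) p s U - stepI l) +
  ((stepI l - n%:R^-1 * (\sum_(i < n) stepf l (iter i g x))) +
   (n%:R^-1 * (\sum_(i < n) stepf l (iter i g x)) - n%:R^-1 * \sum_(i < n) u (iter i g x))).
  by rewrite !addrA !subrK.
apply: le_lt_trans (ler_normD _ _) _.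
have := ler_normD (stepI l - n%:R^-1 * (\sum_(i < n) stepf l (iter i g x)))
  (n%:R^-1 * (\sum_(i < n) stepf l (iter i g x)) - n%:R^-1 * \sum_(i < n) u (iter i g x)).
lra.
Unshelve. all: by end_near. Qed.

(** The averages along the orbits of [x] and of [g x] differ by [u x - u (iter n g x)] divided by
    [n], and [u] is bounded on the polyhedron. *)
Lemma generic_g x : X x -> generic X g muB (g x) -> generic X g muB x.
Proof.
move=> Xx gen u cu; have [U [M [mU UM UE]]] := cutoff cu.
have [r rE] : exists r, mint muB u = r%:E.
  have -> : mint muB u = (\sum_(s in B) v s * cint (d := d) p s U)%:E; last by eexists.
  rewrite /= -sumEFin; apply: eq_bigr => s sB; have sD := terminal_dsimp Bt sB.
  rewrite EFinM (@lamintE R N d V p s u U M)// => y; rewrite -(shull_dsimp sys sD) => sy.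
  by rewrite UE//; exact: (shull_sub_X sys sD).
have := gen u cu; rewrite rE => /fine_cvgP[_] gr.
apply: cvg_EFin; first by apply: nearW.
have uM y : X y -> `|u y| <= M by move=> Xy; rewrite -UE.
have E n : n%:R^-1 * (\sum_(i < n) u (iter i g x)) =
   n%:R^-1 * (\sum_(i < n) u (iter i g (g x))) + n%:R^-1 * (u x - u (iter n g x)).
  rewrite -mulrDr; congr (_ * _).
  have : \sum_(i < n.+1) u (iter i g x) = \sum_(i < n) u (iter i g (g x)) + u x.
    rewrite big_ord_recl/= addrC; congr (_ + _).
    by apply: eq_bigr => i _; rewrite -iterSr.
  rewrite big_ord_recr/= => h; lra.
rewrite (_ : fine \o _ = fun n => n%:R^-1 * (\sum_(i < n) u (iter i g x)))//.
rewrite (funext E) -[r]addr0; apply: cvgD => //.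
apply/cvgrPdist_lt => e e0; near=> n.
have n0 : (0 : R) < n%:R by rewrite ltr0n; near: n; exists 1%N.
rewrite sub0r normrN normrM gtr0_norm ?invr_gt0// mulrC ltr_pdivrMr//.
apply: (@le_lt_trans _ _ (M + M)).
  rewrite (le_trans (ler_normB _ _))// lerD// uM//; exact: (iter_g_X sys).
rewrite mulrC -ltr_pdivrMr//.
by near: n; exact: nbhs_infty_gtr.
Unshelve. all: by end_near. Qed.
End terminal.
End genericity.

(** * The exceptional null set and overlaps of terminal classes *)

Section tractability.
Context {R : realType} {N d : nat} {V V' : finType}.
Context {p : V -> 'rV[R]_N} {S : {set {set V}}} {p' : V' -> 'rV[R]_N} {S' : {set {set V'}}}.
Context {gamma : V' -> V} {g : 'rV[R]_N -> 'rV[R]_N}.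
Hypothesis sys : simplicial_system d p S p' S' gamma g.
Local Notation D := (dsimp S d).
Local Notation D' := (dsimp S' d).
Local Notation OGr := (OG p S p' S' gamma d).
Local Notation Gr := (Grel p S p' S' gamma d).
Local Notation inJ := (@inJ R N V V' p p').
Local Notation nu := (@nu R N d V V' p p').
Local Notation lamS := (@lamS R N d V p).
Local Notation psi := (@psi R N d V V' p p' gamma).
Local Notation X := (polyh p S).
Local Notation dist1 := (@dist1 R N V p S).
Local Notation mblR := (fun A : set 'rV[R]_N => measurable (A : set (borelT R N))).
Local Notation lamr := (@lamr R N d V p).
Local Notation terminal := (G_terminal p S p' S' gamma d).
Local Notation UB B := [set x | exists2 s, s \in B & shull p s x].

Lemma terminal_disjoint B1 B2 t : terminal B1 -> terminal B2 -> t \in B1 -> t \in B2 -> B1 = B2.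
Proof.
have sub B B' : terminal B -> terminal B' -> t \in B -> t \in B' -> B \subset B'.
  move=> Bt Bt' tB tB'; apply/fintype.subsetP => u uB.
  by have [_ h] := Bt'; exact: h tB' (terminal_conn Bt tB uB).
by move=> T1 T2 t1 t2; apply/eqP; rewrite finset.eqEsubset !sub.
Qed.

(** Distinct terminal classes share no simplex, so the overlap is covered by proper faces common to
    two d-simplices. *)
Lemma lamS_terminal_overlap B1 B2 s : s \in D -> terminal B1 -> terminal B2 -> B1 != B2 ->
  lamS s (UB B1 `&` UB B2) = 0%E.
Proof.
move=> sD T1 T2 B12.
pose P (t : {set V} * {set V}) := [&& t.1 \in B1, t.2 \in B2 & t.1 != t.2].
have mU (B : {set {set V}}) : mblR (UB B) by apply: measurable_closed; exact: (UB_closed (B := B)).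
apply: (@subset_measure0 _ _ _ (lamS s) _ (\big[setU/set0]_(t | P t) shull p (t.1 :&: t.2))).
- by apply: (@measurableI _ (borelT R N)); exact: mU.
- by apply: (@bigsetU_measurable _ (borelT R N)) => t _; exact: measurable_shull.
- move=> x [[t1 t1B xt1] [t2 t2B xt2]]; rewrite -(bigcup_pred P).
  have [_ _ _ _ inter] := sysK sys.
  have [S1 _ _] := dsimpP sys (terminal_dsimp T1 t1B).
  have [S2 _ _] := dsimpP sys (terminal_dsimp T2 t2B).
  exists (t1, t2) => /=; last by rewrite -inter.
  rewrite unfold_in /P /= t1B t2B /=; apply: contraNneq B12 => t12.
  by apply/eqP; apply: (@terminal_disjoint _ _ t1) => //; rewrite t12.
apply: measure0_bigsetU => [t|[t1 t2] /and3P[/= t1B t2B t12]]; first exact: measurable_shull.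
have [S1 c1 _] := dsimpP sys (terminal_dsimp T1 t1B).
have [S2 c2 _] := dsimpP sys (terminal_dsimp T2 t2B).
apply: (lamS_simplex sys) => //; rewrite -ltnS -c1; apply: proper_card.
rewrite finset.properEneq finset.subsetIl andbT.
apply: contra_neq t12 => /finset.setIidPl h; apply/eqP.
by rewrite eqEcard h c1 c2 leqnn.
Qed.

Lemma generic_iter B m x : terminal B -> X x ->
  generic X g (lamB p S p' S' gamma d B) (iter m g x) -> generic X g (lamB p S p' S' gamma d B) x.
Proof.
move=> T Xx; elim: m => //= m IH gen; apply: IH; apply: (generic_g sys T) => //.
exact: (iter_g_X sys).
Qed.

Lemma measurable_iter_gX m : measurable_fun setT (iter m (@gX R N V p S g) : borelT R N -> borelT R N).
Proof.
elim: m => [|m IH]; first exact: measurable_id.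
exact: (measurableT_comp (measurable_gX sys) IH).
Qed.

Lemma nongeneric_null : exists Z, [/\ mblR Z, forall s, s \in D -> lamS s Z = 0%E &
  forall x, X x -> ~ Z x -> exists2 B, terminal B & generic X g (lamB p S p' S' gamma d B) x].
Proof.
have /choice[Z HZ] : forall B, exists Z, terminal B ->
    [/\ mblR Z, mval (lamB p S p' S' gamma d B) Z = 0%E &
      forall x, X x -> ~ Z x -> generic X g (lamB p S p' S' gamma d B) x].
  move=> B; have [T|T] := pselect (terminal B); last by exists set0.
  have [Z [mZ Z0 h]] := visit_frequency_cells sys T; exists Z => _; split => // x Xx nZ.
  by apply: (generic_of_cells sys T Xx) => l; exact: h.
(* [W] collects the points that are bad for every terminal class at once. Outside [K] some iterate
   is good for some class, and genericity is pulled back from that iterate. *)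
pose W := \bigcap_(B in terminal) Z B.
pose K := \bigcap_m (iter m (@gX R N V p S g) @^-1` W).
have mW : mblR W.
  by apply: (@fin_bigcap_measurable _ (borelT R N)) => [|B T]; [exact: finite_finset|have [] := HZ B T].
have mK : mblR K.
  apply: (@bigcap_measurableType _ (borelT R N)) => m _.
  exact: (measurable_preimageT (measurable_iter_gX m) mW).
have KZ B : terminal B -> K `<=` Z B by move=> T x Kx; exact: (Kx 0%N I B T).
have lamB0 B s : terminal B -> s \in B -> lamr s K = 0.
  move=> T sB; have [mZ Z0 _] := HZ B T; apply/le_anti; rewrite lamr_ge0 andbT.
  apply: le_trans (le_lamr _ mK mZ (KZ B T)) _.
  move: Z0; rewrite lamBE// => -[] /eqP; rewrite psumr_eq0; last first.
    by move=> t tB; rewrite mulr_ge0 ?lamr_ge0// ltW// (vB_gt0 sys T).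
  move=> /allP/(_ s (mem_index_enum _)); rewrite sB /= mulf_eq0 gt_eqF ?(vB_gt0 sys T)//=.
  by move=> /eqP ->.
(* Within the polyhedron [K] is mapped into itself by [g], so its measure is at most that of its
   preimage, which is the mean over the pieces. *)
have sub s : s \in D -> lamr s K <= \sum_(s' in D' | inJ s s') nu s s' * lamr (gamma @: s') K.
  move=> sD; rewrite -(lamr_pullback sys)//.
  have -> : lamr s K = lamr s (K `&` X).
    apply: (lamr_congr sys sD) => x sx; split => [Kx|[]//]; split => //.
    exact: (shull_sub_X sys sD).
  apply: le_lamr.
  - by apply: (@measurableI _ (borelT R N)) => //; exact: measurable_X.
  - exact: (measurable_Xg sys).
  move=> x [Kx Xx]; split => // m _; have := Kx m.+1 I.
  by rewrite /preimage/= -[g x](gX_in Xx) -iterSr.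
have K0 s : s \in D -> lamr s K = 0.
  (* From a simplex where the measure of [K] is largest some terminal class is reached. By the
     maximum principle the maximum is attained there too, where it is 0. *)
  move=> sD; pose s0 := [arg max_(t > s in D) lamr t K]%O.
  have [s0D s0max] : s0 \in D /\ forall t, t \in D -> lamr t K <= lamr s0 K.
    by rewrite /s0; case: arg_maxP.
  have [B [t [T tB s0t]]] := reach_terminal sys s0D.
  have clD u w : u \in D -> Gr u w -> w \in D by move=> _ [].
  have [_ ht] := subharmonic_max sys (h := fun t => lamr t K) clD s0max sub s0t s0D erefl.
  by apply/le_anti; rewrite lamr_ge0 andbT -(lamB0 B t T tB) ht s0max.
exists K; split => // [s sD|x Xx nK]; first by rewrite lamrE// K0.
move/existsNP : nK => [m nKm].
have nW : ~ W (iter m (@gX R N V p S g) x) by move=> Wm; apply: nKm.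
have [B nB] : exists B, ~ (terminal B -> Z B (iter m g x)).
  apply/existsNP => H; apply: nW => B T; rewrite (iter_gX sys)//; exact: H.
have [T nZ] : terminal B /\ ~ Z B (iter m g x) by apply: contrapT => /not_andP h; apply: nB => T; case: h => // /contrapT.
exists B => //; apply: (generic_iter T Xx (m := m)).
have [_ _ h] := HZ B T; apply: h => //; exact: (iter_g_X sys).
Qed.
End tractability.

Theorem theorem4p12 (R : realType) (N d : nat) (V V' : finType)
    (p : V -> 'rV[R]_N) (S : {set {set V}})
    (p' : V' -> 'rV[R]_N) (S' : {set {set V'}})
    (gamma : V' -> V) (g : 'rV[R]_N -> 'rV[R]_N) (v0 : {set V} -> R) :
  (1 <= d)%N ->
  gcomplex p S -> gcomplex p' S' ->
  everywhere_dim S d ->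
  proper_subdivision p S p' S' ->
  simplicial_nondeg S S' gamma ->
  pl_map_of p p' S' gamma (polyh p S) g ->
  (forall s, s \in dsimp S d -> 0 < v0 s) ->
  \sum_(s in dsimp S d) v0 s = 1 ->
  let X := polyh p S in
  let lam0 := lam_comb p d (dsimp S d) v0 in
  let lamB_ := lamB p S p' S' gamma d in
  (forall B : {set {set V}}, G_terminal p S p' S' gamma d B ->
     [/\ ergodic_inv_prob X g (lamB_ B),
         msupp (lamB_ B) = [set x | exists2 s, s \in B & shull p s x] &
         [set x | exists2 s, s \in B & shull p s x]
           = [set x | exists2 s', Bstar p p' S' gamma d B s' & shull p' s' x]])
  /\ tractable X g lam0
       (fun B : {set {set V}} => `[< G_terminal p S p' S' gamma d B >]) lamB_.
Proof.
move=> _ K1 K2 dimS sub nd pl _ _ X lam0 lamB_.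
have sys : simplicial_system d p S p' S' gamma g by split.
have lam00 A : measurable (A : set (borelT R N)) ->
    (forall s, s \in dsimp S d -> @lamS R N d V p s A = 0%E) -> mval lam0 A = 0%E.
  by move=> mA A0; rewrite /= big1// => s sD; rewrite lamE// [X in (_ * X)%E](A0 s sD) mule0.
have mU (B : {set {set V}}) : measurable ([set x | exists2 s, s \in B & shull p s x] : set (borelT R N)).
  by apply: measurable_closed; exact: (UB_closed (B := B)).
split=> [B Bt|].
  split; [exact: (lamB_ergodic sys Bt)|exact: (msupp_lamB sys Bt)|exact: (UB_Bstar sys Bt)].
split.
- exact: (finite_basic_sets sys).
- split=> [B /asboolP Bt|]; first exact: (lamB_ergodic sys Bt).
  have [Z [mZ Z0 h]] := nongeneric_null sys; exists Z; split => //; first exact: lam00.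
  by move=> x Xx nZ; have [B T gen] := h x Xx nZ; exists B => //; apply/asboolP.
- move=> B /asboolP Bt; have [C vC UBC] := UB_visible sys Bt; exists C => //.
  by rewrite (msupp_lamB sys Bt).
- move=> B1 B2 /asboolP T1 /asboolP T2 B12.
  rewrite (msupp_lamB sys T1) (msupp_lamB sys T2); apply: lam00.
    exact: (@measurableI _ (borelT R N)).
  by move=> s sD; exact: (lamS_terminal_overlap sys sD T1 T2 B12).
Qed.
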